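(* Let $\alpha \in [0,1]$. Assume $n^{-1/2}\lambda_n \to \lambda \in [0,\infty)^p$ as $n\to\infty$ and put $\Lambda = \mathrm{diag}(\lambda)$. If $M \subseteq \mathbb{R}^p$ is a Borel set that satisfies Condition A with matrix $\bar C = C$ and $\min_{d\in\{-1,1\}^p} P(\hat u^d \in M) = 1-\alpha$, where $\hat u^d \sim N(-C^{-1}\Lambda d,\ \sigma^2C^{-1})$, then $$\liminf_{n\to\infty}\ \inf_{\beta\in\mathbb{R}^p} P_\beta\left(\beta \in \hat\beta_L - n^{-1/2}M\right) = 1-\alpha.$$
   Context: For each $n \ge p$ consider $y = X\beta+\varepsilon$, where $X$ is a non-random real $n\times p$ matrix of full column rank $p$ that changes with $n$ only by appending rows, $\beta\in\mathbb{R}^p$, and $\varepsilon$ has $n$ independent identically distributed components (with the same law for all $n$; normality is not assumed) with mean $0$ and finite variance $\sigma^2>0$. $P_\beta$ denotes probability when the true parameter is $\beta$. Assume $C_n = X'X/n \to C$ with $C$ finite and positive definite. For non-random tuning parameters $\lambda_n = (\lambda_{n,1},\dots,\lambda_{n,p})'$ with $\lambda_{n,j}\ge 0$, the Lasso estimator $\hat\beta_L$ (depending on $n$) is the unique minimizer over $b\in\mathbb{R}^p$ of $\|y-Xb\|^2 + 2\sum_{j=1}^p\lambda_{n,j}|b_j|$. Notation: $a - cM = \{a-cm : m\in M\}$. For $m \in \mathbb{R}^p$, $d \in \{-1,1\}^p$ and $\bar C \in \mathbb{R}^{p\times p}$ let $A^d_{\bar C}(m) = \bigcap_{j=1}^p\{z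 \in \mathbb{R}^p : d_j(\bar Cm)_j \le d_j(\bar Cz)_j,\ d_jz_j \le 0\}$. A set $M\subseteq \mathbb{R}^p$ satisfies Condition A with matrix $\bar C$ if $A^d_{\bar C}(m) \subseteq M$ for all $d \in \{-1,1\}^p$ and all $m \in M$. *)

(* Defs.v *)
From HB Require Import structures.
From mathcomp Require Import all_boot all_order all_algebra.
From mathcomp Require Import all_classical all_reals all_analysis.

Set Implicit Arguments.
Unset Strict Implicit.
Unset Printing Implicit Defensive.

Import Order.TTheory GRing.Theory Num.Theory.
Import numFieldNormedType.Exports.

Local Open Scope classical_set_scope.
Local Open Scope ring_scope.

Definition borel_set (R : realType) (p : nat) (M : set 'cV[R]_p) : Prop :=
  <<s [set U : set 'cV[R]_p | open U] >> M.

(* The sets A i may be the whole line, so the product rule over the full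
   (finite) index set contains the rule for every subfamily. *)
Definition mutually_independent (R : realType) (d : measure_display)
    (T : measurableType d) (P : probability T R) (I : finType)
    (Y : I -> {RV P >-> R}) : Prop :=
  forall A : I -> set R, (forall i, measurable (A i)) ->
    (P (\bigcap_(i in [set: I]) (Y i @^-1` A i)) =
     \prod_(i : I) P (Y i @^-1` A i))%E.

Definition has_law (R : realType) (d : measure_display)
    (T : measurableType d) (P : probability T R) (Y : {RV P >-> R})
    (mu : set R -> \bar R) : Prop :=
  forall B : set R, measurable B -> distribution P Y B = mu B.

Definition positive_definite (R : realType) (p : nat) (S : 'M[R]_p) : Prop :=
  S^T = S /\ forall v : 'cV[R]_p, v != 0 -> 0 < (v^T *m S *m v) 0 0.

(* Z ~ N(m, S): Z = m + A G with A A' = S and G standard Gaussian. G lives on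
   the space of Z; when S is invertible this is no restriction, since then
   G = A^-1 (Z - m). *)
Definition gaussian_vector (R : realType) (d : measure_display)
    (T : measurableType d) (P : probability T R) (p : nat)
    (Z : T -> 'cV[R]_p) (m : 'cV[R]_p) (S : 'M[R]_p) : Prop :=
  exists (A : 'M[R]_p) (G : 'I_p -> {RV P >-> R}),
    [/\ A *m A^T = S,
        mutually_independent G,
        forall j, has_law (G j) (normal_prob 0 1) &
        forall w, Z w = m + A *m \col_j G j w].

(* Only the rows x 0, ..., x (n - 1) enter, so that passing from n to n + 1
   appends one row. *)
Definition design (R : realType) (p : nat) (x : nat -> 'rV[R]_p) (n : nat) :
    'M[R]_(n, p) :=
  \matrix_(i < n, j < p) x i 0 j.

Definition gram (R : realType) (p : nat) (x : nat -> 'rV[R]_p) (n : nat) :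
    'M[R]_p :=
  n%:R^-1 *: ((design x n)^T *m design x n).

Definition lasso_objective (R : realType) (n p : nat) (X : 'M[R]_(n, p))
    (lam : 'cV[R]_p) (y : 'cV[R]_n) (b : 'cV[R]_p) : R :=
  \sum_(i < n) ((y - X *m b) i 0) ^+ 2 + 2 * \sum_(j < p) lam j 0 * `|b j 0|.

(* The unique minimizer of the objective; the value 0 is used only if there is
   none, which cannot happen when X has full column rank and lam >= 0. *)
Definition lasso (R : realType) (n p : nat) (X : 'M[R]_(n, p))
    (lam : 'cV[R]_p) (y : 'cV[R]_n) : 'cV[R]_p :=
  xget 0 [set b | forall b', b' != b ->
    lasso_objective X lam y b < lasso_objective X lam y b'].

Definition sign_vector (R : realType) (p : nat) (s : {ffun 'I_p -> bool}) :
    'cV[R]_p :=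
  \col_j (-1) ^+ s j.

Definition Aset (R : realType) (p : nat) (d : 'cV[R]_p) (Cbar : 'M[R]_p)
    (m : 'cV[R]_p) : set 'cV[R]_p :=
  \bigcap_(j in [set: 'I_p])
    [set z | d j 0 * (Cbar *m m) j 0 <= d j 0 * (Cbar *m z) j 0 /\
             d j 0 * z j 0 <= 0].

Definition conditionA (R : realType) (p : nat) (Cbar : 'M[R]_p)
    (M : set 'cV[R]_p) : Prop :=
  forall (s : {ffun 'I_p -> bool}) (m : 'cV[R]_p),
    M m -> Aset (sign_vector R s) Cbar m `<=` M.

(* a - c M *)
Definition reflected_set (R : realType) (p : nat) (a : 'cV[R]_p) (c : R)
    (M : set 'cV[R]_p) : set 'cV[R]_p :=
  [set a - c *: m | m in M].

Definition coverage (R : realType) (d : measure_display)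
    (T : measurableType d) (P : probability T R) (n p : nat)
    (X : 'M[R]_(n, p)) (lam : 'cV[R]_p) (e : 'I_n -> {RV P >-> R})
    (M : set 'cV[R]_p) (beta : 'cV[R]_p) : \bar R :=
  P [set w | reflected_set (lasso X lam (X *m beta + \col_i e i w))
               (Num.sqrt n%:R)^-1 M beta].

(* Main.v *)
Require Import Defs.
From HB Require Import structures.
From mathcomp Require Import all_boot all_order all_algebra.
From mathcomp Require Import all_classical all_reals all_analysis.
From mathcomp Require Import measurable_realfun.
From mathcomp Require Import ring lra.

Set Implicit Arguments.
Unset Strict Implicit.
Unset Printing Implicit Defensive.

Import Order.TTheory GRing.Theory Num.Theory.
Import numFieldNormedType.Exports.

Local Open Scope classical_set_scope.
Local Open Scope ring_scope.

(** Let [V_n^d] be [sqrt n] times the estimation error that results when the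
    penalty [lam_j |b_j|] is replaced by the linear function [lam_j d_j b_j]:
    [V_n^d = C_n^-1 (X' eps / sqrt n - n^(-1/2) Lambda_n d)] ([signed_error],
    [scaled_error]). It does not involve [beta], and it tends in law to the
    Gaussian vector [u^d]. The true value is covered when
    [u_n = sqrt n (lasso - beta)] lies in [M]; this event is compared with
    events on [V_n^d] from both sides.

    Lower bound, uniform in [beta]. Let [d] be the vector of the signs of
    [beta]. The Karush-Kuhn-Tucker conditions read [C_n (u_n - V_n^d) = w] with
    [d_j w_j >= 0], with [w_j = 0] where [d_j u_nj > 0], and with [w] of the
    order of [n^(-1/2) lam_n]. Hence [u_n] belongs to the set [A^d'_C(m)] for
    [m = u_n - C^-1 w] and for the vector [d'] that differs from [d] in the
    coordinates with [d_j u_nj > 0]. Since [m - V_n^d = (C_n^-1 - C^-1) w] is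
    small uniformly, [M] contains [m] as soon as it contains a slightly
    enlarged ball around [V_n^d], and then Condition A gives [M u_n]
    ([conditionA_ball], [cover_lower]). In the limit this bounds the coverage
    from below by the minimum over [d] of the probability that [u^d] is in the
    interior of [M].

    Upper bound. For [beta = c d] with [c] large no coordinate of the estimator
    changes its sign, so that [u_n = V_n^d] ([lasso_signed], [cover_far]). In
    the limit the infimum is at most the probability that [u^d] is in the
    closure of [M].

    The two bounds agree because Condition A makes the boundary of [M] negligible
    ([gaussian_closure_le]): a short move in the direction [C^-1 d] takes the
    part of the closure of [M] in the open orthant of [- d] into the interior of
    [M] ([conditionA_interior]), while it changes a Gaussian law only little,
    uniformly over the open sets ([gaussian_shift]).

    The limit theorem for [V_n^d] is needed for open sets only. Real
    characteristic functions [E cos (<t, V> + b)] suffice: the phase [b] makes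
    cosines alone stable under the addition formula, so the one of a sum of
    independent variables can be expanded term by term ([cos_mean_approx],
    [trig_mean_taylor], [weighted_cos]), the tails of the sum can be read off it
    ([weighted_tail]), and the indicator of an open set can be approximated by
    trigonometric polynomials on compact sets ([trig_urysohn],
    [portmanteau_open]). *)

(** * Column vectors: inner product and maximum norm *)

Lemma cvg_sumr {R : realType} {T : Type} {F : set_system T} {FF : Filter F}
    (I : Type) (r : seq I) (P : pred I) (f : I -> T -> R) (l : I -> R) :
  (forall i, P i -> f i x @[x --> F] --> l i) ->
  \sum_(i <- r | P i) f i x @[x --> F] --> \sum_(i <- r | P i) l i.
Proof. by move=> fl; apply: cvg_big => //; exact: add_continuous. Qed.

Lemma cvg_prodr {R : realType} {T : Type} {F : set_system T} {FF : Filter F}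
    (I : Type) (r : seq I) (P : pred I) (f : I -> T -> R) (l : I -> R) :
  (forall i, P i -> f i x @[x --> F] --> l i) ->
  \prod_(i <- r | P i) f i x @[x --> F] --> \prod_(i <- r | P i) l i.
Proof. by move=> fl; apply: cvg_big => //; exact: mul_continuous. Qed.

Section dot_product.
Context {R : realType}.

Definition dot n (u v : 'cV[R]_n) : R := \sum_i u i 0 * v i 0.

Lemma dotE n (u v : 'cV[R]_n) : dot u v = (u^T *m v) 0 0.
Proof. by rewrite mxE; apply: eq_bigr => i _; rewrite mxE. Qed.

Lemma dotC n (u v : 'cV[R]_n) : dot u v = dot v u.
Proof. by apply: eq_bigr => i _; rewrite mulrC. Qed.

Lemma dotDl n (u v w : 'cV[R]_n) : dot (u + v) w = dot u w + dot v w.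
Proof. by rewrite -big_split/=; apply: eq_bigr => i _; rewrite mxE mulrDl. Qed.

Lemma dotDr n (u v w : 'cV[R]_n) : dot w (u + v) = dot w u + dot w v.
Proof. by rewrite dotC dotDl !(dotC w). Qed.

Lemma dotZl n k (u v : 'cV[R]_n) : dot (k *: u) v = k * dot u v.
Proof. by rewrite /dot big_distrr/=; apply: eq_bigr => i _; rewrite mxE mulrA. Qed.

Lemma dotZr n k (u v : 'cV[R]_n) : dot u (k *: v) = k * dot u v.
Proof. by rewrite dotC dotZl dotC. Qed.

Lemma dotNl n (u v : 'cV[R]_n) : dot (- u) v = - dot u v.
Proof. by rewrite -scaleN1r dotZl mulN1r. Qed.

Lemma dotNr n (u v : 'cV[R]_n) : dot u (- v) = - dot u v.
Proof. by rewrite dotC dotNl dotC. Qed.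

Lemma dotBl n (u v w : 'cV[R]_n) : dot (u - v) w = dot u w - dot v w.
Proof. by rewrite dotDl dotNl. Qed.

Lemma dotBr n (u v w : 'cV[R]_n) : dot w (u - v) = dot w u - dot w v.
Proof. by rewrite dotDr dotNr. Qed.

Lemma dot_mulmx n p (X : 'M[R]_(n, p)) (b : 'cV[R]_p) (r : 'cV[R]_n) :
  dot (X *m b) r = dot b (X^T *m r).
Proof. by rewrite !dotE trmx_mul mulmxA. Qed.

Lemma dot_ge0 n (u : 'cV[R]_n) : 0 <= dot u u.
Proof. by apply: sumr_ge0 => i _; rewrite -expr2 sqr_ge0. Qed.

Lemma sqr_le_dot n (u : 'cV[R]_n) i : u i 0 ^+ 2 <= dot u u.
Proof.
rewrite /dot (bigD1 i)//= -expr2 lerDl; apply: sumr_ge0 => j _.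
by rewrite -expr2 sqr_ge0.
Qed.

Lemma dot_eq0 n (u : 'cV[R]_n) : dot u u = 0 -> u = 0.
Proof.
move=> u0; apply/colP => i; rewrite mxE; apply/eqP.
by rewrite -sqrf_eq0 eq_le sqr_ge0 andbT -u0 sqr_le_dot.
Qed.

Lemma dot_gt0 n (u : 'cV[R]_n) : u != 0 -> 0 < dot u u.
Proof.
by move=> u0; rewrite lt_neqAle dot_ge0 andbT eq_sym; apply: contra u0 => /eqP/dot_eq0 ->.
Qed.

(** The square is completed: [2 u v <= u^2 + v^2] in each coordinate. *)
Lemma dot_self_le n (u v : 'cV[R]_n) : dot u u <= dot u v -> dot u u <= dot v v.
Proof.
move=> uv; have := dot_ge0 (u - v).
by rewrite dotBl !dotBr (dotC v u); lra.
Qed.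

End dot_product.

Lemma mxBE {V : zmodType} m n (A B : 'M[V]_(m, n)) i j :
  (A - B) i j = A i j - B i j.
Proof. by rewrite !mxE. Qed.

Lemma mxZE {R : pzRingType} m n k (A : 'M[R]_(m, n)) i j :
  (k *: A) i j = k * A i j.
Proof. by rewrite mxE. Qed.

Section max_norm.
Context {R : realType}.

Lemma mxnorm_leP m n (A : 'M[R]_(m, n)) e : 0 <= e ->
  (`|A| <= e) <-> (forall i j, `|A i j| <= e).
Proof.
move=> e0; rewrite [X in X <= _]/Num.norm/= mx_normrE; split => [H i j|H].
  by rewrite (le_trans _ H)//; exact: (le_bigmax _ (fun ij => `|A ij.1 ij.2|) (i, j)).
by apply/bigmax_leP; split.
Qed.

Lemma mx_ballP m n (A B : 'M[R]_(m, n)) e : 0 < e ->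
  ball A e B <-> (forall i j, `|A i j - B i j| < e).
Proof.
move=> e0; split=> [[_ H] i j|H]; first exact: H.
by split.
Qed.

Lemma mxnorm_entry m n (A : 'M[R]_(m, n)) i j : `|A i j| <= `|A|.
Proof. by move: i j; apply/mxnorm_leP. Qed.

Lemma mxnorm_mulmx m n p (A : 'M[R]_(m, n)) (B : 'M[R]_(n, p)) :
  `|A *m B| <= n%:R * `|A| * `|B|.
Proof.
apply/mxnorm_leP => [|i j]; first by rewrite !mulr_ge0.
rewrite mxE (le_trans (ler_norm_sum _ _ _))//.
rewrite (@le_trans _ _ (\sum_(k < n) `|A| * `|B|))//.
  by apply: ler_sum => k _; rewrite normrM ler_pM// mxnorm_entry.
by rewrite sumr_const card_ord -mulrA mulr_natl.
Qed.

End max_norm.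

(** * The Lasso objective, its minimizer and the optimality conditions *)

(** The quadratic term vanishes faster than the linear one as [t] goes to 0;
    this turns the minimality along a line into a condition on the slope. *)
Lemma slope_ge0 {R : realType} (c a : R) : 0 <= c ->
  (forall t : R, 0 < t <= 1 -> 0 <= t ^+ 2 * c + 2 * (t * a)) -> 0 <= a.
Proof.
move=> c0 H; rewrite leNgt; apply/negP => a0.
have d0 : 0 < c + 1 - a by lra.
have /H : 0 < - a / (c + 1 - a) <= 1.
  by rewrite divr_gt0 ?oppr_gt0//= ler_pdivrMr// mul1r; lra.
set t := - a / _; have t0 : 0 < t by rewrite divr_gt0 ?oppr_gt0.
have tE : t * (c + 1 - a) = - a by rewrite divfK// gt_eqF.
rewrite expr2 -mulrA mulrCA -[2 * _]mulrCA -mulrDr pmulr_rge0//.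
have : t * c < - a by rewrite -tE ltr_pM2l//; lra.
lra.
Qed.

(** A pair [(b, g)] with these two properties is a point of the graph of the
    subdifferential of [l |b|]; by the first property of one pair and the second
    of the other, [g b' <= l |b'| = g' b']. *)
Lemma subgradient_monotone {R : realType} (l g g' b b' : R) :
  `|g| <= l -> g * b = l * `|b| -> `|g'| <= l -> g' * b' = l * `|b'| ->
  0 <= (b - b') * (g - g').
Proof.
move=> gl gb gl' gb'.
have H1 : g * b' <= l * `|b'| by rewrite (le_trans (ler_norm _))// normrM ler_wpM2r.
have H2 : g' * b <= l * `|b| by rewrite (le_trans (ler_norm _))// normrM ler_wpM2r.
have -> : (b - b') * (g - g') = g * b + g' * b' - g * b' - g' * b by ring.
by rewrite gb gb'; lra.
Qed.

Section lasso.
Context {R : realType} {n p : nat} (X : 'M[R]_(n, p)) (lam : 'cV[R]_p).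
Hypothesis rkX : \rank X = p.
Hypothesis lam_ge0 : forall j, 0 <= lam j 0.

(** Half the negative gradient of the quadratic part of the objective. *)
Definition lasso_score (y : 'cV[R]_n) (b : 'cV[R]_p) : 'cV[R]_p :=
  X^T *m (y - X *m b).

Definition lasso_kkt (y : 'cV[R]_n) (b : 'cV[R]_p) : Prop :=
  forall j, `|lasso_score y b j 0| <= lam j 0 /\
            lasso_score y b j 0 * b j 0 = lam j 0 * `|b j 0|.

Lemma fullrank_inj (h : 'cV[R]_p) : X *m h = 0 -> h = 0.
Proof.
move=> Xh; apply: trmx_inj; rewrite trmx0; apply/eqP.
have fX : row_free X^T by rewrite /row_free mxrank_tr rkX.
by rewrite -(mulmx_free_eq0 _ fX) -trmx_mul Xh trmx0.
Qed.

Lemma fullrank_gram_unit : X^T *m X \in unitmx.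
Proof.
rewrite -row_free_unit; apply/inj_row_free => v vX.
apply: trmx_inj; rewrite trmx0; apply: fullrank_inj; apply: dot_eq0.
have -> : dot (X *m v^T) (X *m v^T) = dot v^T (v *m (X^T *m X))^T.
  by rewrite dot_mulmx !trmx_mul trmxK mulmxA.
by rewrite vX trmx0 -(scale0r 0) dotZr mul0r.
Qed.

Lemma fullrank_left_inverse (h : 'cV[R]_p) :
  invmx (X^T *m X) *m X^T *m (X *m h) = h.
Proof. by rewrite mulmxA -(mulmxA (invmx _)) mulVmx ?fullrank_gram_unit// mul1mx. Qed.

(** The exact expansion of the objective around [b]: what remains besides the
    positive definite quadratic term is a sum over single coordinates. *)
Lemma lasso_objective_split y b h :
  lasso_objective X lam y (b + h) - lasso_objective X lam y b =
  dot (X *m h) (X *m h) +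
  2 * \sum_j (lam j 0 * (`|b j 0 + h j 0| - `|b j 0|) - lasso_score y b j 0 * h j 0).
Proof.
rewrite /lasso_objective.
have sq (c : 'cV[R]_p) : \sum_(i < n) (y - X *m c) i 0 ^+ 2 = dot (y - X *m c) (y - X *m c).
  by apply: eq_bigr => i _; rewrite expr2.
have sqB (r z : 'cV[R]_n) : dot (r - z) (r - z) = dot r r - 2 * dot z r + dot z z.
  by rewrite dotBl !dotBr (dotC r z); ring.
rewrite !sq mulmxDr opprD addrA sqB dot_mulmx -/(lasso_score y b).
rewrite sumrB.
have -> : \sum_j lasso_score y b j 0 * h j 0 = dot h (lasso_score y b).
  by apply: eq_bigr => j _; rewrite mulrC.
have -> : \sum_j lam j 0 * (`|b j 0 + h j 0| - `|b j 0|) =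
  \sum_j lam j 0 * `|(b + h) j 0| - \sum_j lam j 0 * `|b j 0|.
  by rewrite -sumrB; apply: eq_bigr => j _; rewrite mxE mulrBr.
ring.
Qed.

(** Under the optimality conditions each summand of the expansion is nonnegative,
    and the quadratic term is positive by full rank. *)
Lemma lasso_kkt_min y b : lasso_kkt y b ->
  forall b' : 'cV[R]_p,
    b' != b -> lasso_objective X lam y b < lasso_objective X lam y b'.
Proof.
move=> kb b' b'b; have bE : b + (b' - b) = b' by rewrite addrC subrK.
rewrite -subr_gt0 -[X in _ X - _]bE lasso_objective_split ltr_wpDr//.
  rewrite mulr_ge0//; apply: sumr_ge0 => j _; have [g1 g2] := kb j.
  have -> : (b' - b) j 0 = b' j 0 - b j 0 by rewrite !mxE.
  rewrite addrCA subrr addr0 !mulrBr g2.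
  have : lasso_score y b j 0 * b' j 0 <= lam j 0 * `|b' j 0|.
    by rewrite (le_trans (ler_norm _))// normrM ler_wpM2r.
  lra.
apply: dot_gt0; apply: contra b'b => /eqP/fullrank_inj/eqP.
by rewrite subr_eq0.
Qed.

(** Moving one coordinate up or down bounds the score; moving it towards 0, by
    [- t * b j 0], gives the complementarity. *)
Lemma lasso_min_kkt y b :
  (forall b', lasso_objective X lam y b <= lasso_objective X lam y b') ->
  lasso_kkt y b.
Proof.
move=> minb j; set g := lasso_score y b.
pose c := dot (X *m delta_mx j 0) (X *m delta_mx j 0).
have key t : 0 <= t ^+ 2 * c + 2 * (lam j 0 * (`|b j 0 + t| - `|b j 0|) - g j 0 * t).
  have := minb (b + t *: delta_mx j 0); rewrite -subr_ge0 lasso_objective_split.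
  rewrite -scalemxAr dotZl dotZr mulrA -expr2 -/c (bigD1 j)//= big1 ?addr0.
    by rewrite !mxE !eqxx/= mulr1.
  move=> i ij; rewrite !mxE (negbTE ij)/= mulr0 addr0 subrr !mulr0.
  by rewrite subrr.
have c0 : 0 <= c by exact: dot_ge0.
have gle : `|g j 0| <= lam j 0.
  rewrite ler_norml; apply/andP; split.
    rewrite -subr_ge0 opprK; apply: (slope_ge0 c0) => t /andP[t0 t1].
    have := key (- t); rewrite sqrrN.
    have : lam j 0 * (`|b j 0 - t| - `|b j 0|) <= lam j 0 * t.
      apply: ler_wpM2l => //; rewrite lerBlDl (le_trans (ler_normB _ _))//.
      by rewrite (gtr0_norm t0).
    lra.
  rewrite -subr_ge0; apply: (slope_ge0 c0) => t /andP[t0 t1].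
  have := key t.
  have : lam j 0 * (`|b j 0 + t| - `|b j 0|) <= lam j 0 * t.
    apply: ler_wpM2l => //; rewrite lerBlDl (le_trans (ler_normD _ _))//.
    by rewrite (gtr0_norm t0).
  lra.
split => //; apply/eqP; rewrite eq_le; apply/andP; split.
  by rewrite (le_trans (ler_norm _))// normrM ler_wpM2r.
have [->|bj0] := eqVneq (b j 0) 0; first by rewrite normr0 !mulr0.
(* with the step [- t * b j 0] the modulus of the coordinate shrinks linearly *)
have cb0 : 0 < b j 0 ^+ 2 by rewrite exprn_even_gt0.
rewrite -subr_ge0; apply: (@slope_ge0 _ (b j 0 ^+ 2 * c)).
  by rewrite mulr_ge0// ltW.
move=> t /andP[t0 t1]; have := key (- (t * b j 0)).
have -> : `|b j 0 - t * b j 0| - `|b j 0| = - (t * `|b j 0|).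
  rewrite -{1}(mul1r (b j 0)) -mulrBl normrM ger0_norm ?subr_ge0//.
  by rewrite mulrBl mul1r addrC addrA addNr add0r.
rewrite sqrrN exprMn; congr (0 <= _); ring.
Qed.

(** The sublevel set of the origin is compact, because the residual bounds the
    fit and full rank lets the fit bound the coefficients. Bounded closed
    sets are compact among row vectors, hence the transpose. *)
Lemma lasso_min_exists y : exists b, forall b',
  lasso_objective X lam y b <= lasso_objective X lam y b'.
Proof.
pose f (v : 'rV[R]_p) := lasso_objective X lam y v^T.
pose A := [set v : 'rV[R]_p | f v <= f 0].
have cf (v : 'rV[R]_p) : f u @[u --> v] --> f v.
  have FF : Filter (nbhs v) by exact: nbhs_filter.
  rewrite /f /lasso_objective; apply: (@cvgD _ _ _ (nbhs v)).
    apply: cvg_sumr => i _.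
    have ci : (y - X *m u^T) i 0 @[u --> v] --> (y - X *m v^T) i 0.
      rewrite !mxE; under eq_fun do rewrite !mxE.
      apply: cvgB; first exact: cvg_cst.
      apply: cvg_sumr => j _; apply: cvgM; first exact: cvg_cst.
      by rewrite mxE; under eq_fun do rewrite mxE; exact: coord_continuous.
    by rewrite expr2; under eq_fun do rewrite expr2; exact: cvgM.
  apply: cvgM; first exact: cvg_cst.
  apply: cvg_sumr => j _; apply: cvgM; first exact: cvg_cst.
  apply: cvg_norm; rewrite mxE; under eq_fun do rewrite mxE.
  exact: coord_continuous.
have A0 : A 0 by rewrite /A/=.
have cA : compact A.
  apply: bounded_closed_compact; last first.
    exact: (closed_comp (fun v _ => cf v) (closed_le (y := f 0))).
  pose K := \sum_(i < n) y i 0 ^+ 2.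
  have f0E : f 0 = K.
    rewrite /f /lasso_objective trmx0 mulmx0 subr0 [X in _ + 2 * X]big1 ?mulr0 ?addr0//.
    by move=> j _; rewrite mxE normr0 mulr0.
  pose B := n%:R * `|invmx (X^T *m X) *m X^T| * (`|y| + (K + 1)).
  exists B; split; first exact: num_real.
  move=> r Br v; rewrite /A/= f0E => fv.
  have K0 : 0 <= K by apply: sumr_ge0 => i _; exact: sqr_ge0.
  have sv i : (y - X *m v^T) i 0 ^+ 2 <= K.
    apply: le_trans fv; rewrite /f /lasso_objective (bigD1 i)//= -addrA lerDl.
    rewrite addr_ge0// ?mulr_ge0//; apply: sumr_ge0 => j _; first exact: sqr_ge0.
    by rewrite mulr_ge0.
  have rv : `|y - X *m v^T| <= K + 1.
    apply/mxnorm_leP => [|i j]; first lra.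
    have -> : j = 0 by apply: ord1.
    (* [z ^+ 2 <= K] implies [`|z| <= K + 1], which avoids a square root *)
    move: ((y - X *m v^T) i 0) (sv i) => z zK.
    by rewrite ler_norml; apply/andP; split; nra.
  have -> : `|v| = `|v^T|.
    apply/eqP; rewrite eq_le; apply/andP; split; apply/mxnorm_leP => // i j.
      by have := mxnorm_entry v^T j i; rewrite mxE.
    by rewrite mxE mxnorm_entry.
  rewrite (le_trans _ (ltW Br))// -(fullrank_left_inverse v^T) (le_trans (mxnorm_mulmx _ _))//.
  rewrite ler_wpM2l ?mulr_ge0//.
  have -> : X *m v^T = y - (y - X *m v^T) by rewrite opprB addrCA subrr addr0.
  by rewrite (le_trans (ler_normB _ _))// lerD2l.
have [] := @compact_EVT_min _ _ f A _ cA.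
- by exists 0.
- exact: continuous_subspaceT.
move=> v vA minv; exists v^T => b'.
have [b'A|b'A] := leP (lasso_objective X lam y b') (f 0).
  by have := minv b'^T; rewrite !inE /A/= /f trmxK; apply.
apply/ltW/(le_lt_trans _ b'A).
by move: vA; rewrite inE.
Qed.

Lemma lasso_unique y b : lasso_kkt y b -> lasso X lam y = b.
Proof.
move=> kb; apply: xget_unique; first exact: lasso_kkt_min.
move=> b2 b2P; apply/eqP/negP => /negP b2b.
have := lasso_kkt_min kb b2b; rewrite ltNge => /negP; apply; apply/ltW.
by apply: b2P; rewrite eq_sym.
Qed.

Lemma lassoP y : lasso_kkt y (lasso X lam y).
Proof.
have [b /lasso_min_kkt kb] := lasso_min_exists y.
by rewrite (lasso_unique kb).
Qed.

(** Monotonicity of the subdifferential of the penalty makes the fitted values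
    a contraction of the data, hence the estimator a Lipschitz function. *)
Lemma lasso_fit_contraction y y' (h := lasso X lam y - lasso X lam y') :
  dot (X *m h) (X *m h) <= dot (y - y') (y - y').
Proof.
apply: dot_self_le.
set b := lasso X lam y in h *; set b' := lasso X lam y' in h *.
have kb : lasso_kkt y b by exact: lassoP.
have kb' : lasso_kkt y' b' by exact: lassoP.
have mono : 0 <= dot h (lasso_score y b - lasso_score y' b').
  apply: sumr_ge0 => j _; have [g1 g2] := kb j; have [g1' g2'] := kb' j.
  have hE : h j 0 = b j 0 - b' j 0 by rewrite !mxE.
  have -> : (lasso_score y b - lasso_score y' b') j 0 =
    lasso_score y b j 0 - lasso_score y' b' j 0 by rewrite !mxE.
  by rewrite hE; exact: subgradient_monotone g1 g2 g1' g2'.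
rewrite -subr_ge0 -dotBr dot_mulmx; move: mono; congr (0 <= dot h _).
rewrite /lasso_score -mulmxBr; congr (_ *m _).
rewrite /h mulmxBr; move: (X *m b) (X *m b') => f f'.
by apply/matrixP => i k; rewrite !mxE; ring.
Qed.

(** This is what makes coverage an event. *)
Lemma lasso_continuous (y : 'cV[R]_n) :
  lasso X lam y' @[y' --> y] --> lasso X lam y.
Proof.
have FF : Filter (nbhs y) by exact: nbhs_filter.
apply/cvgrPdist_le => /= eps eps0.
pose K := n%:R * `|invmx (X^T *m X) *m X^T| + 1.
have K0 : 0 < K by rewrite ltr_wpDl// mulr_ge0.
pose d := eps / K; have d0 : 0 < d by rewrite divr_gt0.
pose d1 := d / (n%:R + 1); have d10 : 0 < d1 by rewrite divr_gt0// ltr_wpDl.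
have nb : nbhs y [set y' | `|y - y'| <= d1].
  by apply/nbhs_ballP; exists d1 => //= z; rewrite mx_norm_ball => /ltW.
apply: filterS nb => y' /= yy.
set h := _ - _.
have Xh : `|X *m h| <= d.
  apply/mxnorm_leP => [|i j]; first exact: ltW.
  have -> : j = 0 by apply: ord1.
  have := le_trans (sqr_le_dot (X *m h) i) (lasso_fit_contraction y y').
  have : dot (y - y') (y - y') <= d ^+ 2.
    apply: (@le_trans _ _ (\sum_(k < n) d1 ^+ 2)).
      apply: ler_sum => k _; rewrite -expr2 -real_normK ?num_real//.
      by rewrite lerXn2r ?nnegrE ?(ltW d10)// (le_trans _ yy)// mxnorm_entry.
    rewrite sumr_const card_ord -mulr_natl.
    have -> : d ^+ 2 = (n%:R + 1) ^+ 2 * d1 ^+ 2.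
      by rewrite -exprMn mulrC divfK// gt_eqF// ltr_wpDl.
    rewrite ler_wpM2r ?sqr_ge0//.
    by have := ler0n R n; nra.
  move=> /[swap] /le_trans /[apply].
  by rewrite -[_ ^+ 2 <= _]ler_sqrt ?sqr_ge0// !sqrtr_sqr (gtr0_norm d0).
rewrite -(fullrank_left_inverse h) (le_trans (mxnorm_mulmx _ _))//.
rewrite (@le_trans _ _ (K * d))//; first by rewrite ler_pM ?mulr_ge0// /K; lra.
by rewrite /d mulrC divfK// gt_eqF.
Qed.

End lasso.

(** * The Lasso error against the error under a linear penalty *)

Section signed_lasso.
Context {R : realType} {n p : nat} (X : 'M[R]_(n, p)) (lam : 'cV[R]_p).
Hypothesis rkX : \rank X = p.
Hypothesis lam_ge0 : forall j, 0 <= lam j 0.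

(** The estimation error when the penalty is replaced by the linear functional
    [b |-> 2 * \sum_j lam_j d_j b_j]. *)
Definition signed_error (d : 'cV[R]_p) (eps : 'cV[R]_n) : 'cV[R]_p :=
  invmx (X^T *m X) *m (X^T *m eps - diag_mx lam^T *m d).

Lemma sign_vectorE (s : {ffun 'I_p -> bool}) j :
  sign_vector R s j 0 = (-1) ^+ s j.
Proof. by rewrite mxE. Qed.

Lemma gram_signed_error d eps :
  X^T *m X *m signed_error d eps = X^T *m eps - diag_mx lam^T *m d.
Proof. by rewrite mulKVmx// fullrank_gram_unit. Qed.

Lemma penalty_score (d : 'cV[R]_p) j : (diag_mx lam^T *m d) j 0 = lam j 0 * d j 0.
Proof. by rewrite mul_diag_mx !mxE. Qed.

(** Where no component of the candidate has the wrong sign, the linear penalty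
    and the Lasso penalty have the same optimality conditions. *)
Lemma lasso_signed (s : {ffun 'I_p -> bool}) (beta : 'cV[R]_p) (eps : 'cV[R]_n) :
  (forall j, 0 <= (-1) ^+ s j * (beta + signed_error (sign_vector R s) eps) j 0) ->
  lasso X lam (X *m beta + eps) = beta + signed_error (sign_vector R s) eps.
Proof.
set d := sign_vector R s; set b := beta + _ => db; apply: lasso_unique => // j.
have -> : lasso_score X (X *m beta + eps) b = diag_mx lam^T *m d.
  rewrite /lasso_score /b mulmxBr mulmxDr [X *m (_ + _)]mulmxDr mulmxDr.
  rewrite [X^T *m (X *m signed_error _ _)]mulmxA gram_signed_error.
  move: (X^T *m (X *m beta)) (X^T *m eps) (diag_mx _ *m _) => u v w.
  by apply/matrixP => i k; rewrite !mxE; ring.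
rewrite penalty_score sign_vectorE normrM normr_sign mulr1 ger0_norm//.
by split => //; rewrite -mulrA -(ger0_norm (db j)) normrM normr_sign mul1r.
Qed.

(** Here [k] stands for [sqrt n], so [k ^- 2 *: (X^T *m X)] is the Gram matrix
    [C_n]. In the proof [w] is the difference of the two penalty gradients; it
    points in the direction of [d] and vanishes in the coordinates where the
    error has the sign [d_j], which is why the orthant [s'] with these signs
    flipped serves in Condition A. *)
Lemma conditionA_ball (C : 'M[R]_p) (M : set 'cV[R]_p) (k r : R)
    (s : {ffun 'I_p -> bool}) (beta : 'cV[R]_p) (eps : 'cV[R]_n) :
  C \in unitmx -> conditionA C M -> 0 < k ->
  (forall j, 0 <= (-1) ^+ s j * beta j 0) ->
  p%:R * `|invmx (k ^- 2 *: (X^T *m X)) - invmx C| * (k^-1 * (2 * `|lam|)) <= r ->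
  (forall z, `|z - k *: signed_error (sign_vector R s) eps| <= r -> M z) ->
  M (k *: (lasso X lam (X *m beta + eps) - beta)).
Proof.
move=> uC condA k0 sbeta rle HM.
set b := lasso _ _ _; set h := b - beta; set d := sign_vector R s.
set e := signed_error d eps; pose g := lasso_score X (X *m beta + eps) b.
have kkt : lasso_kkt X lam (X *m beta + eps) b by exact: lassoP.
pose w : 'cV[R]_p := k^-1 *: (diag_mx lam^T *m d - g).
have uG : X^T *m X \in unitmx by exact: fullrank_gram_unit.
have wE : k^-1 *: (X^T *m X *m (h - e)) = w.
  congr (_ *: _); rewrite mulmxBr gram_signed_error.
  rewrite /g /lasso_score /h -mulmxA mulmxBr !mulmxBr mulmxDr.
  move: (X^T *m (X *m b)) (X^T *m (X *m beta)) (X^T *m eps) (diag_mx _ *m _) => u v z y.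
  by apply/matrixP => i j; rewrite !mxE; ring.
have gE j : g j 0 = lam j 0 * d j 0 - k * w j 0.
  by rewrite /w mxZE mxBE mulrA divff ?gt_eqF// mul1r penalty_score opprB addrC subrK.
have dd j : d j 0 * d j 0 = 1 by rewrite sign_vectorE -expr2 sqrr_sign.
have dw j : 0 <= d j 0 * w j 0.
  have [gl _] := kkt j; rewrite -(pmulr_rge0 _ k0).
  have : d j 0 * g j 0 <= lam j 0.
    by rewrite (le_trans (ler_norm _))// normrM sign_vectorE normr_sign mul1r.
  by rewrite gE mulrBr mulrCA dd mulr1 mulrCA; lra.
have dw0 j : 0 < d j 0 * h j 0 -> w j 0 = 0.
  move=> dh; have [gl gb] := kkt j.
  have hE : h j 0 = b j 0 - beta j 0 by rewrite mxBE.
  have db : 0 < d j 0 * b j 0.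
    have := sbeta j; rewrite -sign_vectorE -/d; move: dh.
    by rewrite hE mulrBr; lra.
  have bE : `|b j 0| = d j 0 * b j 0.
    by rewrite -(gtr0_norm db) normrM sign_vectorE normr_sign mul1r.
  have b0 : b j 0 != 0 by apply/eqP => b0; move: db; rewrite b0 mulr0 ltxx.
  move: gb; rewrite -/g bE mulrA => /(mulIf b0).
  rewrite gE => /eqP; rewrite -subr_eq0 addrAC subrr add0r oppr_eq0 mulf_eq0.
  by rewrite gt_eqF//= => /eqP.
have wle : `|w| <= k^-1 * (2 * `|lam|).
  rewrite normrZ gtr0_norm ?invr_gt0// ler_wpM2l ?invr_ge0 ?(ltW k0)//.
  apply/mxnorm_leP => [|i j]; first by rewrite mulr_ge0.
  have -> : j = 0 by apply: ord1.
  have -> : (diag_mx lam^T *m d - g) i 0 = (diag_mx lam^T *m d) i 0 - g i 0 by rewrite mxBE.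
  rewrite (le_trans (ler_normB _ _))// mulr2n mulrDl mul1r penalty_score lerD//.
    by rewrite normrM sign_vectorE normr_sign mulr1 mxnorm_entry.
  have [gl _] := kkt i; rewrite (le_trans gl)// (le_trans (ler_norm _))//.
  exact: mxnorm_entry.
(* [C m = C (k h) - w], so no [d_j (C z)_j] decreases from [m] to [k h] *)
pose m := k *: h - invmx C *m w.
pose s' := [ffun j => if d j 0 * h j 0 <= 0 then s j else ~~ s j].
have Mm : M m.
  apply: HM; apply: le_trans rle.
  have -> : m - k *: e = (invmx (k ^- 2 *: (X^T *m X)) - invmx C) *m w.
    rewrite mulmxBl addrAC -scalerBr; congr (_ - _).
    rewrite -wE invmxZ ?unitmxZ ?unitfE ?gt_eqF ?invr_gt0 ?exprn_gt0//.
    rewrite -scalemxAl -scalemxAr mulKmx// scalerA invrK expr2 -mulrA divff ?mulr1//.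
    by rewrite gt_eqF.
  rewrite (le_trans (mxnorm_mulmx _ _))// ler_wpM2l ?mulr_ge0//.
apply: (condA s' m Mm) => j _ /=.
have CE : C *m (k *: h) = C *m m + w.
  by rewrite /m mulmxBr mulKVmx// subrK.
have -> : (C *m (k *: h)) j 0 = (C *m m) j 0 + w j 0 by rewrite CE mxE.
have -> : (k *: h) j 0 = k * h j 0 by rewrite mxZE.
rewrite mulrDr lerDl sign_vectorE ffunE.
have [dh|dh] := leP (d j 0 * h j 0) 0.
  by rewrite -sign_vectorE; split; [exact: (dw j)|rewrite mulrCA pmulr_rle0].
rewrite (dw0 j dh) mulr0; split => //.
by rewrite signrN -sign_vectorE mulNr oppr_le0 mulrCA pmulr_rge0// ltW.
Qed.

End signed_lasso.

(** * Expectations of bounded functions *)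

Section bounded_measurable.
Context {d : measure_display} {T : measurableType d} {R : realType}.

(** These functions are integrable for every probability. *)
Definition bounded_measurable (f : T -> R) : Prop :=
  measurable_fun setT f /\ exists K : R, forall x, `|f x| <= K.

Lemma bmf_cst c : bounded_measurable (fun=> c).
Proof. by split; [exact: measurable_cst|exists `|c|]. Qed.

Lemma bmfM f g : bounded_measurable f -> bounded_measurable g ->
  bounded_measurable (fun x => f x * g x).
Proof.
move=> [mf [K fK]] [mg [L gL]]; split; first exact: measurable_funM.
by exists (K * L) => x; rewrite normrM ler_pM.
Qed.

Lemma bmfD f g : bounded_measurable f -> bounded_measurable g ->
  bounded_measurable (fun x => f x + g x).
Proof.
move=> [mf [K fK]] [mg [L gL]]; split; first exact: measurable_funD.
by exists (K + L) => x; rewrite (le_trans (ler_normD _ _))// lerD.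
Qed.

Lemma bmfZ c f : bounded_measurable f -> bounded_measurable (fun x => c * f x).
Proof. by apply: bmfM; exact: bmf_cst. Qed.

Lemma bmfN f : bounded_measurable f -> bounded_measurable (fun x => - f x).
Proof.
by move=> /(bmfZ (-1)); under [X in bounded_measurable X]eq_fun do rewrite mulN1r.
Qed.

Lemma bmfB f g : bounded_measurable f -> bounded_measurable g ->
  bounded_measurable (fun x => f x - g x).
Proof. by move=> bf /bmfN; exact: bmfD. Qed.

Lemma bmf_norm f : bounded_measurable f -> bounded_measurable (fun x => `|f x|).
Proof.
move=> [mf [K fK]]; split; first exact: measurableT_comp.
by exists K => x; rewrite normr_id.
Qed.

Lemma bmf_indic (A : set T) : measurable A -> bounded_measurable (\1_A : T -> R).
Proof.
move=> mA; split; first exact: measurable_indic.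
by exists 1 => x; rewrite indicE; case: (_ \in _); rewrite ?normr1 ?normr0.
Qed.

Lemma bmf_sum (I : Type) (s : seq I) (f : I -> T -> R) :
  (forall i, bounded_measurable (f i)) ->
  bounded_measurable (fun x => \sum_(i <- s) f i x).
Proof.
move=> bf; elim: s => [|i s IH].
  by under [X in bounded_measurable X]eq_fun do rewrite big_nil; exact: bmf_cst.
by under [X in bounded_measurable X]eq_fun do rewrite big_cons; exact: bmfD.
Qed.

Lemma bmf_prod (I : Type) (s : seq I) (Q : pred I) (f : I -> T -> R) :
  (forall i, bounded_measurable (f i)) ->
  bounded_measurable (fun x => \prod_(i <- s | Q i) f i x).
Proof.
move=> bf; elim: s => [|i s IH].
  by under [X in bounded_measurable X]eq_fun do rewrite big_nil; exact: bmf_cst.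
under [X in bounded_measurable X]eq_fun do rewrite big_cons.
by case: (Q i) => //; exact: bmfM.
Qed.

End bounded_measurable.

Lemma bmf_comp {d d'} {T : measurableType d} {T' : measurableType d'} {R : realType}
    (f : T' -> R) (Y : T -> T') : measurable_fun setT Y ->
  bounded_measurable f -> bounded_measurable (fun x => f (Y x)).
Proof.
move=> mY [mf [K fK]]; split; first exact: (measurableT_comp mf).
by exists K.
Qed.

Section mean.
Context {d : measure_display} {T : measurableType d} {R : realType}.
Variable P : probability T R.
Implicit Types f g : T -> R.

Definition mean f : R := \int[P]_w f w.

Lemma bmf_integrable f : bounded_measurable f -> P.-integrable setT (EFin \o f).
Proof.
move=> [mf [K fK]]; apply: measurable_bounded_integrable => //.
  by rewrite (@le_lt_trans _ _ 1%E) ?ltry ?probability_le1.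
by exists K; split; [exact: num_real|move=> r /ltW Kr x _; exact: le_trans Kr].
Qed.

Lemma meanD f g : P.-integrable setT (EFin \o f) -> P.-integrable setT (EFin \o g) ->
  mean (fun x => f x + g x) = mean f + mean g.
Proof. exact: RintegralD. Qed.

Lemma meanB f g : P.-integrable setT (EFin \o f) -> P.-integrable setT (EFin \o g) ->
  mean (fun x => f x - g x) = mean f - mean g.
Proof. exact: RintegralB. Qed.

Lemma meanZ c f : P.-integrable setT (EFin \o f) ->
  mean (fun x => c * f x) = c * mean f.
Proof. exact: RintegralZl. Qed.

Lemma mean_cst c : mean (fun=> c) = c.
Proof.
rewrite /mean Rintegral_cst// [X in fine X](_ : _ = 1%E) ?mulr1//.
exact: probability_setT.
Qed.

Lemma mean_ge0 f : (forall x, 0 <= f x) -> 0 <= mean f.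
Proof. by move=> f0; exact: Rintegral_ge0. Qed.

Lemma mean_le f g : P.-integrable setT (EFin \o f) -> P.-integrable setT (EFin \o g) ->
  (forall x, f x <= g x) -> mean f <= mean g.
Proof. by move=> *; exact: le_Rintegral. Qed.

Lemma mean_norm f : P.-integrable setT (EFin \o f) ->
  `|mean f| <= mean (fun x => `|f x|).
Proof. exact: le_normr_Rintegral. Qed.

Lemma mean_norm_le f c : bounded_measurable f -> (forall x, `|f x| <= c) ->
  `|mean f| <= c.
Proof.
move=> bf fc; rewrite (le_trans (mean_norm (bmf_integrable bf)))// -[leRHS]mean_cst.
by apply: mean_le => //; apply: bmf_integrable; [exact: bmf_norm|exact: bmf_cst].
Qed.

Lemma mean_indic (A : set T) : measurable A -> mean (\1_A) = fine (P A).
Proof. by move=> mA; rewrite /mean /Rintegral integral_indic// setIT. Qed.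

Lemma mean_sum (I : Type) (s : seq I) (f : I -> T -> R) :
  (forall i, P.-integrable setT (EFin \o f i)) ->
  mean (fun x => \sum_(i <- s) f i x) = \sum_(i <- s) mean (f i).
Proof.
move=> bf; elim: s => [|i s IH].
  by under [X in mean X]eq_fun do rewrite big_nil; rewrite big_nil mean_cst.
under [X in mean X]eq_fun do rewrite big_cons.
rewrite big_cons meanD ?IH//.
have -> : EFin \o (fun x : T => \sum_(j <- s) f j x) =
    (fun x => \sum_(j <- s) (EFin \o f j) x)%E by apply/funext => x /=; rewrite sumEFin.
by apply: integrable_sum.
Qed.

End mean.

(** Rounding the values down to multiples of [eps]. *)
Lemma bounded_uniform_simple {d} {T : measurableType d} {R : realType}
    (h : T -> R) (eps : R) : bounded_measurable h -> 0 < eps ->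
  exists n (a : 'I_n -> R) (B : 'I_n -> set T), (forall i, measurable (B i)) /\
    forall x, `|h x - \sum_i a i * \1_(B i) x| <= eps.
Proof.
move=> [mh [K hK]] e0.
have [m Km] : exists m : nat, K / eps < m%:R.
  by exists (Num.truncn (K / eps)).+1; exact: truncnS_gt.
pose B (i : nat) := h @^-1` `[(i%:R - m%:R) * eps, (i%:R - m%:R + 1) * eps[.
have mB i : measurable (B i).
  by rewrite /B -[X in measurable X]setTI; exact: mh.
exists (m + m)%N, (fun i => (i%:R - m%:R) * eps), B.
split => [//|x].
have {}Km : K < m%:R * eps by rewrite -ltr_pdivrMr.
have := hK x; rewrite ler_norml => /andP[hK1 hK2].
pose i := Num.truncn (h x / eps + m%:R).
have i0 : 0 <= h x / eps + m%:R.
  by rewrite -lerBlDr sub0r ler_pdivlMr// mulNr; lra.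
have /andP[i1 i2] := truncn_itv i0; rewrite -/i in i1 i2.
have xB j : (x \in B j) = (j == i).
  apply/idP/eqP => [|->]; rewrite inE /B/= in_itv/=.
    move=> /andP[]; rewrite -ler_pdivlMr// -ltr_pdivrMr// => j1 j2.
    apply/esym/truncn_def; rewrite -natr1; apply/andP; split; lra.
  rewrite -ler_pdivlMr// -ltr_pdivrMr//; apply/andP; split; first lra.
  by move: i2; rewrite -natr1; lra.
have im : (i < m + m)%N.
  by rewrite -(ltr_nat R) (le_lt_trans i1)// natrD ltrD2r ltr_pdivrMr//; lra.
rewrite (bigD1 (Ordinal im))//= big1 ?addr0; last first.
  move=> j ji; rewrite indicE xB; case: eqP => [jE|_]; last by rewrite mulr0.
  by move: ji; rewrite -val_eqE /= jE eqxx.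
have xBi : x \in B i by rewrite xB.
rewrite indicE xBi mulr1; move: xBi; rewrite inE /B/= in_itv/= => /andP[h1 h2].
by rewrite ger0_norm ?subr_ge0//; lra.
Qed.

(** * Products of functions of independent variables *)

Section independence.
Context {d : measure_display} {T : measurableType d} {R : realType}.
Variable P : probability T R.

(** The product rule passes from indicators to bounded functions by linearity
    and uniform approximation. *)
Lemma mean_mul_indep (G : T -> R) (Y : T -> R) :
  bounded_measurable G -> measurable_fun setT Y ->
  (forall B : set R, measurable B ->
     mean P (fun w => G w * \1_B (Y w)) = mean P G * mean P (fun w => \1_B (Y w))) ->
  forall h : R -> R, bounded_measurable h ->
    mean P (fun w => G w * h (Y w)) = mean P G * mean P (fun w => h (Y w)).
Proof.
move=> bG mY indep h bh.
have [K GK] := bG.2.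
have K0 : 0 <= K by rewrite (le_trans _ (GK point)).
have bhY : bounded_measurable (fun w => h (Y w)) by exact: bmf_comp.
apply/eqP; rewrite -subr_eq0 -normr_le0; apply/ler_addgt0Pr => eps e0; rewrite add0r.
pose e := eps / (2 * K + 1).
have e'0 : 0 < e by rewrite divr_gt0// ltr_wpDl// mulr_ge0.
have [n [a [B [mB hs]]]] := bounded_uniform_simple bh e'0.
pose g y := \sum_i a i * \1_(B i) y.
have bB i : bounded_measurable (\1_(B i) : R -> R) by exact: bmf_indic.
have bg : bounded_measurable g by apply: bmf_sum => i; exact: bmfZ.
have bBY i : bounded_measurable (fun w => \1_(B i) (Y w) : R).
  exact: bmf_comp mY (bB i).
have bgY : bounded_measurable (fun w => g (Y w)) by exact: bmf_comp.
have gE : mean P (fun w => G w * g (Y w)) = mean P G * mean P (fun w => g (Y w)).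
  rewrite /g mean_sum => [|i]; last by apply/bmf_integrable/bmfZ.
  rewrite (eq_bigr (fun i => a i * mean P (fun w => \1_(B i) (Y w)))) => [|i _]; last first.
    by rewrite meanZ//; exact: bmf_integrable.
  under [X in mean P X]eq_fun do rewrite big_distrr/=.
  rewrite mean_sum => [|i]; last by apply/bmf_integrable/bmfM => //; exact: bmfZ.
  rewrite big_distrr/=; apply: eq_bigr => i _.
  under [X in mean P X]eq_fun do rewrite mulrCA.
  rewrite meanZ; last by apply/bmf_integrable/bmfM.
  by rewrite indep// mulrCA.
have bhg : bounded_measurable (fun w => h (Y w) - g (Y w)) by exact: bmfB.
have -> : mean P (fun w => G w * h (Y w)) - mean P G * mean P (fun w => h (Y w)) =
    mean P (fun w => G w * (h (Y w) - g (Y w))) -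
    mean P G * mean P (fun w => h (Y w) - g (Y w)).
  rewrite (meanB (bmf_integrable P bhY) (bmf_integrable P bgY)).
  rewrite (_ : (fun w => G w * (h (Y w) - g (Y w))) = (fun w => G w * h (Y w) - G w * g (Y w)));
    last by apply/funext => w; rewrite mulrBr.
  rewrite meanB ?gE; [ring| |]; by apply/bmf_integrable/bmfM.
have hgY w : `|h (Y w) - g (Y w)| <= e by exact: hs.
rewrite (le_trans (ler_normB _ _))//.
have l1 : `|mean P (fun w => G w * (h (Y w) - g (Y w)))| <= K * e.
  by apply: mean_norm_le => [|w]; [exact: bmfM|rewrite normrM ler_pM].
have l2 : `|mean P G * mean P (fun w => h (Y w) - g (Y w))| <= K * e.
  by rewrite normrM ler_pM//; exact: mean_norm_le.
have eE : e * (2 * K + 1) = eps by rewrite divfK// gt_eqF// ltr_wpDl// mulr_ge0.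
by rewrite (le_trans (lerD l1 l2))//; lra.
Qed.

(** Indicators are replaced by the functions [f i] in one coordinate after the
    other. *)
Lemma mean_prod_indep (I : finType) (Y : I -> {RV P >-> R}) (f : I -> R -> R) :
  mutually_independent Y -> (forall i, bounded_measurable (f i)) ->
  mean P (fun w => \prod_i f i (Y i w)) = \prod_i mean P (fun w => f i (Y i w)).
Proof.
move=> indY bf.
(* the factors outside [s] are still indicators *)
suff H (s : seq I) : forall g : I -> R -> R, (forall i, bounded_measurable (g i)) ->
    (forall i, i \notin s -> exists2 B, measurable B & g i = \1_B) ->
    mean P (fun w => \prod_i g i (Y i w)) = \prod_i mean P (fun w => g i (Y i w)).
  by apply: (H (enum I)) => // i; rewrite mem_enum.
elim: s => [|a s IH] g bg gB.
  have /choice[B HB] : forall i, exists B, measurable B /\ g i = \1_B.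
    by move=> i; have [//|B mB gE] := gB i; exists B.
  have mYB i : measurable (Y i @^-1` B i).
    by rewrite -[X in measurable X]setTI; apply: measurable_funPT => //; case: (HB i).
  have -> : (fun w => \prod_i g i (Y i w)) = \1_(\bigcap_(i in [set: I]) (Y i @^-1` B i)).
    apply/funext => w; rewrite indicE; case: (boolP (w \in _)) => wB.
      apply: big1 => i _; rewrite (HB i).2 indicE mem_set//.
      by move: wB; rewrite inE => wB; exact: wB.
    have [i wi] : exists i, ~ B i (Y i w).
      by apply/existsNP => H; move/negP: wB; apply; rewrite inE => i _; exact: H.
    by rewrite (bigD1 i)//= (HB i).2 indicE memNset// mul0r.
  rewrite mean_indic; last by apply: fin_bigcap_measurable.
  rewrite indY => [|i]; last by case: (HB i).
  have PE i : P (Y i @^-1` B i) = (mean P (fun w => g i (Y i w)))%:E.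
    rewrite (HB i).2 (_ : (fun w => _) = \1_(Y i @^-1` B i)) ?mean_indic ?fineK//.
    exact: fin_num_measure.
  rewrite (eq_bigr (fun i => (mean P (fun w => g i (Y i w)))%:E)) => [|i _].
    by rewrite prodEFin.
  exact: PE.
pose G w := \prod_(i | i != a) g i (Y i w).
have bG : bounded_measurable G.
  by apply: bmf_prod => i; exact: bmf_comp.
have upd (h : R -> R) : bounded_measurable h -> (exists2 B, measurable B & h = \1_B) ->
    mean P (fun w => G w * h (Y a w)) =
    (\prod_(i | i != a) mean P (fun w => g i (Y i w))) * mean P (fun w => h (Y a w)).
  move=> bh hB; pose g' i := if i == a then h else g i.
  have g'a : g' a = h by rewrite /g' eqxx.
  have g'E i : i != a -> g' i = g i by rewrite /g' => /negbTE ->.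
  have bg' i : bounded_measurable (g' i) by rewrite /g'; case: eqP.
  have -> : \prod_(i | i != a) mean P (fun w => g i (Y i w)) =
      \prod_(i | i != a) mean P (fun w => g' i (Y i w)).
    by apply: eq_bigr => i ia; rewrite g'E.
  rewrite -g'a mulrC -(bigD1 a (P := xpredT) (F := fun i => mean P (fun w => g' i (Y i w))))//=.
  rewrite -IH// => [|i si]; last first.
    by rewrite /g'; case: eqP => // /eqP ia; apply: gB; rewrite inE negb_or ia.
  congr (mean P _); apply/funext => w; rewrite (bigD1 a)//= g'a mulrC.
  by congr (_ * _); apply: eq_bigr => i ia; rewrite g'E.
have GE : mean P G = \prod_(i | i != a) mean P (fun w => g i (Y i w)).
  have := upd (\1_[set: R]) (bmf_indic measurableT) (ex_intro2 _ _ _ measurableT erefl).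
  have i1 w : \1_[set: R] (Y a w) = 1 :> R by rewrite indicE in_setT.
  rewrite (_ : (fun w => G w * _) = G); last by apply/funext => w; rewrite i1 mulr1.
  by rewrite (_ : (fun w => \1__ _) = fun=> 1) ?mean_cst ?mulr1//; apply/funext => w; rewrite i1.
rewrite (bigD1 a)//= mulrC -GE -mean_mul_indep//; last first.
  by move=> B mB; rewrite upd ?GE//; [exact: bmf_indic|exists B].
by congr (mean P _); apply/funext => w; rewrite (bigD1 a)//= mulrC.
Qed.

End independence.

(** * Characteristic functions of sums, in real form *)

Lemma bmf_cos {d} {T : measurableType d} {R : realType} (f : T -> R) : measurable_fun setT f ->
  bounded_measurable (fun w => cos (f w)).
Proof.
move=> mf; split; last by exists 1 => x; rewrite ler_norml cos_geN1 cos_le1.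
by apply: (@measurableT_comp _ _ _ _ _ _ cos) => //; apply: continuous_measurable_fun; exact: continuous_cos.
Qed.

Lemma bmf_sin {d} {T : measurableType d} {R : realType} (f : T -> R) : measurable_fun setT f ->
  bounded_measurable (fun w => sin (f w)).
Proof.
move=> mf; split; last by exists 1 => x; rewrite ler_norml sin_geN1 sin_le1.
by apply: (@measurableT_comp _ _ _ _ _ _ sin) => //; apply: continuous_measurable_fun; exact: continuous_sin.
Qed.

Section cos_of_sum.
Context {d : measure_display} {T : measurableType d} {R : realType}.
Variables (P : probability T R) (I : finType) (Y : I -> {RV P >-> R}).
Variable g : I -> R -> R.
Hypothesis indY : mutually_independent Y.
Hypothesis mg : forall i, measurable_fun setT (g i).

Let mgY i : measurable_fun setT (fun w => g i (Y i w)).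
Proof. exact: (measurableT_comp (mg i)). Qed.

(** The phase [b] allows for the sines that the addition formula creates. *)
Definition cos_mean (s : seq I) (b : R) : R :=
  mean P (fun w => cos (\sum_(i <- s) g i (Y i w) + b)).

Let bcos s b : bounded_measurable (fun w => cos (\sum_(i <- s) g i (Y i w) + b)).
Proof.
apply: bmf_cos; apply: measurable_funD => //.
by apply: measurable_sum => i; exact: mgY.
Qed.

Let cos_addition (s : seq I) a b w :
  cos (\sum_(i <- a :: s) g i (Y i w) + b) =
  cos (\sum_(i <- s) g i (Y i w) + b) * cos (g a (Y a w)) -
  cos (\sum_(i <- s) g i (Y i w) + (b - pi / 2)) * sin (g a (Y a w)).
Proof. by rewrite big_cons -addrA addrC cosD (addrA _ b) cosBpihalf. Qed.

(** Independence of the trigonometric factor from the remaining variables, by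
    expanding one summand at a time. *)
Lemma cos_mean_factor (s : seq I) : uniq s ->
  forall (b : R) (f : I -> R -> R), (forall i, bounded_measurable (f i)) ->
  mean P (fun w => cos (\sum_(i <- s) g i (Y i w) + b) *
                   \prod_(i | i \notin s) f i (Y i w)) =
  cos_mean s b * \prod_(i | i \notin s) mean P (fun w => f i (Y i w)).
Proof.
elim: s => [_|a s IH /= /andP[nas us]] b f bf.
  rewrite /cos_mean.
  rewrite (_ : (fun w => cos (\sum_(i <- [::]) _ + b)) = fun=> cos b); last first.
    by apply/funext => w; rewrite big_nil add0r.
  rewrite mean_cst -mean_prod_indep// -meanZ; last first.
    by apply/bmf_integrable/bmf_prod => i; exact: bmf_comp.
  by congr (mean P _); apply/funext => w; rewrite big_nil add0r.
have bc : bounded_measurable (fun x => cos (g a x)) by exact: bmf_cos.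
have bs : bounded_measurable (fun x => sin (g a x)) by exact: bmf_sin.
have split_mean f' : (forall i, bounded_measurable (f' i)) ->
  mean P (fun w => cos (\sum_(i <- a :: s) g i (Y i w) + b) *
                   \prod_(i | i \notin a :: s) f' i (Y i w)) =
  (cos_mean s b * mean P (fun w => cos (g a (Y a w))) -
   cos_mean s (b - pi / 2) * mean P (fun w => sin (g a (Y a w)))) *
  \prod_(i | i \notin a :: s) mean P (fun w => f' i (Y i w)).
  move=> {f}{}bf.
  (* the summand [a] moves from the cosine to the product over the other variables *)
  pose upd (h : R -> R) i := if i == a then h else f' i.
  have updE h : \prod_(i | i \notin s) mean P (fun w => upd h i (Y i w)) =
      mean P (fun w => h (Y a w)) * \prod_(i | i \notin a :: s) mean P (fun w => f' i (Y i w)).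
    rewrite (bigD1 a)//= /upd eqxx; congr (_ * _).
    apply: eq_big => [i|i]; first by rewrite inE negb_or andbC.
    by move=> /andP[_ /negbTE ->].
  have updEw h w : \prod_(i | i \notin s) upd h i (Y i w) =
      h (Y a w) * \prod_(i | i \notin a :: s) f' i (Y i w).
    rewrite (bigD1 a)//= /upd eqxx; congr (_ * _).
    apply: eq_big => [i|i]; first by rewrite inE negb_or andbC.
    by move=> /andP[_ /negbTE ->].
  have bupd h : bounded_measurable h -> forall i, bounded_measurable (upd h i).
    by move=> bh i; rewrite /upd; case: eqP.
  rewrite mulrBl -!mulrA -(updE (cos \o g a)) -(updE (sin \o g a)).
  rewrite -!IH//; [|exact: bupd..].
  rewrite -meanB; last 2 first.
  - by apply/bmf_integrable/bmfM => //; apply: bmf_prod => i; apply: bmf_comp => //; exact: bupd.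
  - by apply/bmf_integrable/bmfM => //; apply: bmf_prod => i; apply: bmf_comp => //; exact: bupd.
  congr (mean P _); apply/funext => w.
  by rewrite cos_addition !updEw mulrBl -!mulrA.
rewrite split_mean//; congr (_ * _).
have := split_mean (fun _ _ => 1) (fun _ => bmf_cst _).
rewrite mean_cst big1_eq mulr1 => <-; congr (mean P _); apply/funext => w.
by rewrite mulr1.
Qed.

Lemma cos_mean_cons a s b : a \notin s -> uniq s ->
  cos_mean (a :: s) b = cos_mean s b * mean P (fun w => cos (g a (Y a w))) -
   cos_mean s (b - pi / 2) * mean P (fun w => sin (g a (Y a w))).
Proof.
move=> nas us; rewrite [LHS](_ : _ = mean P (fun w =>
    cos (\sum_(i <- s) g i (Y i w) + b) * cos (g a (Y a w)) -
    cos (\sum_(i <- s) g i (Y i w) + (b - pi / 2)) * sin (g a (Y a w)))); last first.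
  by congr (mean P _); apply/funext => w; exact: cos_addition.
have bca : bounded_measurable (fun w => cos (g a (Y a w))) by exact: bmf_cos.
have bsa : bounded_measurable (fun w => sin (g a (Y a w))) by exact: bmf_sin.
have factor h b' : bounded_measurable (fun x : R => h (g a x)) ->
    mean P (fun w => cos (\sum_(i <- s) g i (Y i w) + b') * h (g a (Y a w))) =
    cos_mean s b' * mean P (fun w => h (g a (Y a w))).
  move=> bh; pose f i x := if i == a then h (g a x) else 1.
  have fE w : \prod_(i | i \notin s) f i (Y i w) = h (g a (Y a w)).
    rewrite (bigD1 a)//= /f eqxx big1 ?mulr1// => i /andP[_ /negbTE ->//].
  have fE' : \prod_(i | i \notin s) mean P (fun w => f i (Y i w)) =
      mean P (fun w => h (g a (Y a w))).
    by rewrite (bigD1 a)//= /f eqxx big1 ?mulr1// => i /andP[_ /negbTE ->]; rewrite mean_cst.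
  rewrite -fE' -cos_mean_factor// => [|i]; last first.
    by rewrite /f; case: eqP => // _; exact: bmf_cst.
  by congr (mean P _); apply/funext => w; rewrite fE.
rewrite meanB; [|by apply/bmf_integrable/bmfM..].
by rewrite !factor//; [exact: bmf_sin|exact: bmf_cos].
Qed.

Lemma cos_mean_le1 s b : `|cos_mean s b| <= 1.
Proof. by apply: mean_norm_le => // w; rewrite ler_norml cos_geN1 cos_le1. Qed.

(** Each summand is traded for a factor [rho i], at a cost that does not depend
    on the phase, so that the errors add up. *)
Lemma cos_mean_approx (rho : I -> R) s b : uniq s ->
  (forall i, 0 <= rho i <= 1) ->
  `|cos_mean s b - (\prod_(i <- s) rho i) * cos b| <=
  \sum_(i <- s) (`|mean P (fun w => cos (g i (Y i w))) - rho i| +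
                 `|mean P (fun w => sin (g i (Y i w)))|).
Proof.
move=> + rho01; elim: s b => [b _|a s IH b /= /andP[nas us]].
  rewrite !big_nil mul1r /cos_mean (_ : (fun w => _) = fun=> cos b).
    by rewrite mean_cst subrr normr0.
  by apply/funext => w; rewrite big_nil add0r.
rewrite cos_mean_cons// !big_cons.
set c := mean P _; set si := mean P _; set F := cos_mean s b.
set G := cos_mean s _; set Pi := \prod_(i <- s) rho i.
have -> : F * c - G * si - rho a * Pi * cos b =
  F * (c - rho a) - G * si + rho a * (F - Pi * cos b) by ring.
rewrite (le_trans (ler_normD _ _))// lerD//.
  rewrite (le_trans (ler_normB _ _))// lerD// normrM ler_piMl//; exact: cos_mean_le1.
have /andP[r0 r1] := rho01 a.
by rewrite normrM (ger0_norm r0) (le_trans _ (IH b us))// ler_piMl.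
Qed.

End cos_of_sum.

(** * Characteristic functions near the origin *)

Section taylor.
Context {R : realType}.

(** Iterating this bound replaces the Taylor expansions of sine and cosine. *)
Lemma mvt_bound (f df : R -> R) (c x : R) :
  (forall y : R, is_derive y (1 : R) f (df y)) -> f 0 = 0 ->
  (forall y : R, `|y| <= `|x| -> `|df y| <= c) -> `|f x| <= c * `|x|.
Proof.
move=> fdf f0 dfc.
have cf : continuous f by move=> y; apply: differentiable_continuous; apply/derivable1_diffP.
have cfw (A : set R) : {within A, continuous f} by exact: continuous_subspaceT.
have [x0|/ltW x0] := leP 0 x.
  have [y] := MVT_segment x0 (fun y _ => fdf y) (cfw _).
  rewrite in_itv/= => /andP[y0 yx]; rewrite f0 !subr0 => ->.
  by rewrite normrM ler_wpM2r// dfc// !ger0_norm.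
have [y] := MVT_segment x0 (fun y _ => fdf y) (cfw _).
rewrite in_itv/= => /andP[y0 yx]; rewrite f0 !sub0r => fE.
by rewrite -normrN fE normrM normrN ler_wpM2r// dfc// !ler0_norm// lerN2.
Qed.

Lemma norm_sin_le (x : R) : `|sin x| <= `|x|.
Proof.
rewrite -[leRHS]mul1r; apply: (@mvt_bound sin cos); rewrite ?sin0// => y _.
by rewrite cos_max.
Qed.

Lemma norm_cosB1_le (x : R) : `|cos x - 1| <= x ^+ 2.
Proof.
rewrite -real_normK ?num_real// expr2; apply: (@mvt_bound (fun x => cos x - 1) (fun x => - sin x)).
- by move=> y; apply: is_derive_eq; rewrite subr0.
- by rewrite cos0 subrr.
- by move=> y yx; rewrite normrN (le_trans (norm_sin_le y)).
Qed.

Lemma norm_sinB_le (x : R) : `|sin x - x| <= `|x| ^+ 3.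
Proof.
rewrite exprSr; apply: (@mvt_bound (fun x => sin x - x) (fun x => cos x - 1)).
- by rewrite sin0 subrr.
- move=> y yx; rewrite (le_trans (norm_cosB1_le y))// -real_normK ?num_real//.
  by rewrite lerXn2r ?nnegrE.
Qed.

Lemma norm_cosB_le (x : R) : `|cos x - 1 + x ^+ 2 / 2| <= `|x| ^+ 4.
Proof.
rewrite [leRHS]exprSr; apply: (@mvt_bound (fun x => cos x - 1 + x ^+ 2 / 2) (fun x => x - sin x)).
- move=> y; apply: is_derive_eq; rewrite /GRing.scale/=.
  by rewrite !mulr0 mulr1; lra.
- by rewrite cos0 subrr expr0n/= mul0r addr0.
- by move=> y yx; rewrite distrC (le_trans (norm_sinB_le y))// lerXn2r ?nnegrE.
Qed.

(** The factor [Num.min 1 `|x|] tends to 0 with [x] yet is bounded, so a second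
    moment is enough to control the error. *)
Lemma sin_taylor (x : R) : `|sin x - x| <= 3 * (x ^+ 2 * Num.min 1 `|x|).
Proof.
have xx : x ^+ 2 = `|x| ^+ 2 by rewrite real_normK// num_real.
rewrite xx; have [x1|x1] := leP 1 `|x|.
  rewrite (le_trans (ler_normB _ _))// (le_trans (lerD (sin_max x) (lexx _)))//.
  by move: x1; set t := `|x| => t1; nra.
rewrite (le_trans (norm_sinB_le x))//.
rewrite [leLHS]exprSr; have : 0 <= `|x| ^+ 2 * `|x| by rewrite mulr_ge0// exprn_ge0.
lra.
Qed.

Lemma cos_taylor (x : R) :
  `|cos x - 1 + x ^+ 2 / 2| <= 3 * (x ^+ 2 * Num.min 1 `|x|).
Proof.
have xx : x ^+ 2 = `|x| ^+ 2 by rewrite real_normK// num_real.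
have [x1|x1] := leP 1 `|x|.
  have c1 : `|cos x - 1| <= 2.
    by rewrite (le_trans (ler_normB _ _))// normr1; have := cos_max x; lra.
  have : `|x ^+ 2 / 2| = x ^+ 2 / 2 by rewrite ger0_norm// divr_ge0// sqr_ge0.
  have := ler_normD (cos x - 1) (x ^+ 2 / 2).
  rewrite xx; move: x1; set t := `|x| => t1.
  have : 1 <= t ^+ 2 by rewrite expr_ge1// (le_trans _ t1).
  lra.
rewrite (le_trans (norm_cosB_le x))// xx.
move: (normr_ge0 x) x1; set t := `|x| => t0 t1; rewrite exprSr.
have : t ^+ 3 * t <= t ^+ 3 by rewrite ler_piMr ?exprn_ge0// ltW.
have : 0 <= t ^+ 3 by rewrite exprn_ge0.
by rewrite exprSr; lra.
Qed.

Lemma expRN_taylor (u : R) : 0 <= u -> `|expR (- u) - 1 + u| <= u ^+ 2.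
Proof.
move=> u0; have u1 : 0 < 1 + u by lra.
rewrite ger0_norm; last by have := expR_ge1Dx (- u); lra.
have : expR (- u) <= (1 + u)^-1.
  by rewrite expRN lef_pV2 ?posrE ?expR_gt0// expR_ge1Dx.
have : (1 + u)^-1 <= 1 - u + u ^+ 2.
  rewrite -[leLHS]mul1r ler_pdivrMr//.
  have : 0 <= u * (u * u) by rewrite !mulr_ge0.
  have -> : (1 - u + u ^+ 2) * (1 + u) = 1 + u * (u * u) by ring.
  lra.
lra.
Qed.

End taylor.

Lemma Rintegral_dominated {d} {T : measurableType d} {R : realType}
  (P : {measure set T -> \bar R}) (f_ : nat -> T -> R) (f g : T -> R) :
  (forall n, measurable_fun setT (f_ n)) -> measurable_fun setT f ->
  (forall x, f_ n x @[n --> \oo] --> f x) ->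
  P.-integrable setT (EFin \o g) -> (forall n x, `|f_ n x| <= g x) ->
  \int[P]_x f_ n x @[n --> \oo] --> \int[P]_x f x.
Proof.
move=> mf_ mf f_f ig fg.
have mE h : measurable_fun setT h -> measurable_fun setT (EFin \o h : T -> \bar R).
  by move=> mh; exact/measurable_EFinP.
have cE : {ae P, forall x, setT x -> (EFin \o f_ n) x @[n --> \oo] --> (EFin \o f) x}.
  by apply: aeW => x _; apply: cvg_EFin; [exact: nearW|exact: f_f].
have bE : {ae P, forall x n, setT x -> (`|(EFin \o f_ n) x| <= (EFin \o g) x)%E}.
  by apply: aeW => x n _ /=; rewrite lee_fin.
have [ift _ H] := @dominated_convergence _ _ _ P setT measurableT
  (fun n => EFin \o f_ n) (EFin \o f) (EFin \o g)
  (fun n => mE _ (mf_ n)) (mE _ mf) cE ig bE.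
apply: fine_cvg; move: H; rewrite /Rintegral fineK//.
exact: integrable_fin_num.
Qed.

Section second_moment.
Context {d : measure_display} {T : measurableType d} {R : realType}.
Variable P : probability T R.

Lemma integrableDr (f g : T -> R) : P.-integrable setT (EFin \o f) ->
  P.-integrable setT (EFin \o g) -> P.-integrable setT (EFin \o (fun w => f w + g w)).
Proof.
move=> i1 i2; have := integrableD measurableT i1 i2; congr (P.-integrable _ _).
Qed.

Lemma integrableZr c (f : T -> R) : P.-integrable setT (EFin \o f) ->
  P.-integrable setT (EFin \o (fun w => c * f w)).
Proof.
move=> /(integrableZl measurableT c); congr (P.-integrable _ _).
Qed.

Lemma integrable_dom (f g : T -> R) : measurable_fun setT f ->
  P.-integrable setT (EFin \o g) -> (forall x, `|f x| <= g x) ->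
  P.-integrable setT (EFin \o f).
Proof.
move=> mf ig fg; apply: (le_integrable _ _ _ ig) => //; first exact/measurable_EFinP.
by move=> x _ /=; rewrite lee_fin (le_trans (fg x))// ler_norm.
Qed.

Variable Y : T -> R.
Hypothesis mY : measurable_fun setT Y.
Hypothesis iY2 : P.-integrable setT (EFin \o (fun w => Y w ^+ 2)).

Lemma square_integrable : P.-integrable setT (EFin \o Y).
Proof.
apply: (integrable_dom mY (g := fun w => 1 + Y w ^+ 2)) => [|w].
  by apply: integrableDr => //; apply: bmf_integrable; exact: bmf_cst.
by rewrite ler_norml; apply/andP; split; nra.
Qed.

Lemma measurable_tail (K : R) : measurable [set w | K < `|Y w|].
Proof.
rewrite [X in measurable X](_ : _ = setT `&` (fun w => `|Y w|) @^-1` `]K, +oo[).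
  by have : measurable_fun setT (fun w => `|Y w|) by [exact: measurableT_comp]; apply.
by apply/seteqP; split => w; rewrite /= in_itv/= ?andbT//; case.
Qed.

(** Dominated convergence, with [Y^2] as the dominating function. *)
Lemma second_moment_tail (eta : R) : 0 < eta ->
  exists K : nat, mean P (fun w => Y w ^+ 2 * \1_[set w | K%:R < `|Y w|] w) <= eta.
Proof.
move=> eta0.
have mf K : measurable_fun setT (fun w => Y w ^+ 2 * \1_[set w | K%:R < `|Y w|] w : R).
  by apply: measurable_funM; [exact: measurable_funX|apply: measurable_indic; exact: measurable_tail].
have cf w : Y w ^+ 2 * \1_[set w | K%:R < `|Y w|] w @[K --> \oo] --> (0 : R).
  apply/cvgrPdist_le => e e0; near=> K.
  rewrite sub0r normrN indicE memNset ?mulr0 ?normr0 ?ltW//=.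
  apply/negP; rewrite -leNgt; near: K; exact: nbhs_infty_ger.
have bf (K : nat) w : `|Y w ^+ 2 * \1_[set w | K%:R < `|Y w|] w| <= Y w ^+ 2.
  rewrite normrM ger0_norm ?sqr_ge0// ler_piMr ?sqr_ge0// indicE.
  by case: (_ \in _); rewrite ?normr1 ?normr0.
have := Rintegral_dominated mf (measurable_cst (0 : R)) cf iY2 bf.
rewrite -!/(mean P _) mean_cst => /cvgrPdist_le/(_ eta eta0) [N _ /(_ N (leqnn N))] /=.
rewrite sub0r normrN => H; exists N; exact: le_trans (ler_norm _) H.
Unshelve. all: by end_near. Qed.

Hypothesis EY : mean P Y = 0.

(** The expansion to second order, with an error [o (a^2)] although there is no
    third moment: split [Y] at a level [K] with a small truncated second moment,
    and then let [a K] be small. *)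
Lemma trig_mean_taylor (eta : R) (s2 := mean P (fun w => Y w ^+ 2)) : 0 < eta ->
  exists2 delta, 0 < delta & forall a, `|a| <= delta ->
    `|mean P (fun w => cos (a * Y w)) - expR (- (s2 * a ^+ 2 / 2))| +
    `|mean P (fun w => sin (a * Y w))| <= eta * a ^+ 2.
Proof.
move=> eta0.
have e0 : 0 < eta / 24 by rewrite divr_gt0.
have [K HK] := second_moment_tail e0.
have s0 : 0 <= s2 by apply: mean_ge0 => w; exact: sqr_ge0.
(* the numbers are such that [6 E m] and [u^2 / a^2] are both below [eta / 2]
   when [`|a| * D <= eta] *)
pose D := K%:R * s2 * 24 + s2 ^+ 2 + 1.
have D0 : 0 < D by rewrite ltr_wpDl// addr_ge0 ?sqr_ge0// !mulr_ge0.
exists (Num.min 1 (eta / D)) => [|a]; first by rewrite lt_min ltr01 divr_gt0.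
rewrite le_min => /andP[a1 aD].
have {}aD : `|a| * D <= eta by rewrite -ler_pdivlMr.
pose m w := Y w ^+ 2 * Num.min 1 `|a * Y w|.
have maY : measurable_fun setT (fun w => a * Y w) by exact: measurable_funM.
have mm : measurable_fun setT m.
  apply: measurable_funM; first exact: measurable_funX.
  apply: measurable_minr => //; exact: measurableT_comp.
have m0 w : 0 <= m w by rewrite mulr_ge0 ?sqr_ge0// le_min ler01 normr_ge0.
have im : P.-integrable setT (EFin \o m).
  apply: (integrable_dom mm iY2) => w; rewrite ger0_norm//.
  by rewrite ler_piMr ?sqr_ge0// ge_min lexx.
have it : P.-integrable setT (EFin \o (fun w => Y w ^+ 2 * \1_[set w | K%:R < `|Y w|] w : R)).
  apply: (integrable_dom _ iY2) => [|w].
    by apply: measurable_funM; [exact: measurable_funX|apply: measurable_indic; exact: measurable_tail].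
  rewrite normrM ger0_norm ?sqr_ge0// ler_piMr ?sqr_ge0// indicE.
  by case: (_ \in _); rewrite ?normr1 ?normr0.
have mle : mean P m <= `|a| * K%:R * s2 + eta / 24.
  apply: (@le_trans _ _ (mean P (fun w => `|a| * K%:R * Y w ^+ 2 +
      Y w ^+ 2 * \1_[set w | K%:R < `|Y w|] w))).
    apply: mean_le => // [|w]; first by apply: integrableDr => //; exact: integrableZr.
    rewrite /m indicE; case: (boolP (w \in _)) => [_|].
      rewrite mulr1 (@le_trans _ _ (Y w ^+ 2))//.
        by rewrite ler_piMr ?sqr_ge0// ge_min lexx.
      by rewrite lerDr mulr_ge0 ?sqr_ge0// mulr_ge0.
    rewrite notin_setE /= mulr0 addr0 mulrC => /negP; rewrite -leNgt => YK.
    apply: ler_wpM2r; first exact: sqr_ge0.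
    by rewrite ge_min normrM ler_wpM2l ?orbT.
  by rewrite meanD ?meanZ// ?lerD//; exact: integrableZr.
have a2 : a ^+ 2 = `|a| ^+ 2 by rewrite real_normK// num_real.
have bcos := bmf_cos maY; have bsin := bmf_sin maY.
have taylorm w : (a * Y w) ^+ 2 * Num.min 1 `|a * Y w| = a ^+ 2 * m w.
  by rewrite /m exprMn -mulrA.
set u := s2 * a ^+ 2 / 2.
have u0 : 0 <= u by rewrite divr_ge0// mulr_ge0// sqr_ge0.
have Ecos : `|mean P (fun w => cos (a * Y w)) - expR (- u)| <=
    3 * (a ^+ 2 * mean P m) + u ^+ 2.
  have -> : mean P (fun w => cos (a * Y w)) - expR (- u) =
      mean P (fun w => cos (a * Y w) - 1 + (a * Y w) ^+ 2 / 2) - (expR (- u) - 1 + u).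
    under [X in _ = mean P X - _]eq_fun do rewrite exprMn mulrAC.
    rewrite meanD; last 2 first.
    - by apply: bmf_integrable; apply: bmfB => //; exact: bmf_cst.
    - exact: integrableZr.
    rewrite meanZ// meanB ?mean_cst; last 2 first.
    - exact: bmf_integrable.
    - by apply: bmf_integrable; exact: bmf_cst.
    by rewrite -/s2 /u; ring.
  rewrite (le_trans (ler_normB _ _))// lerD ?expRN_taylor//.
  have ic : P.-integrable setT (EFin \o (fun w => cos (a * Y w) - 1 + (a * Y w) ^+ 2 / 2)).
    apply: (@integrableDr (fun w => cos (a * Y w) - 1) (fun w => (a * Y w) ^+ 2 / 2)).
      by apply: bmf_integrable; apply: bmfB => //; exact: bmf_cst.
    by under [X in _ \o X]eq_fun do rewrite exprMn mulrAC; exact: integrableZr.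
  rewrite (le_trans (mean_norm ic))// -!meanZ//; last exact: integrableZr.
  apply: mean_le; [exact: integrable_norm|by do 2 apply: integrableZr|].
  by move=> w; rewrite -taylorm cos_taylor.
have Esin : `|mean P (fun w => sin (a * Y w))| <= 3 * (a ^+ 2 * mean P m).
  have iY := square_integrable.
  have -> : mean P (fun w => sin (a * Y w)) = mean P (fun w => sin (a * Y w) - a * Y w).
    by rewrite meanB ?meanZ ?EY ?mulr0 ?subr0//; [exact: bmf_integrable|exact: integrableZr].
  have is_ : P.-integrable setT (EFin \o (fun w => sin (a * Y w) - a * Y w)).
    apply: (@integrableDr (fun w => sin (a * Y w)) (fun w => - (a * Y w))).
      exact: bmf_integrable.
    by under [X in _ \o X]eq_fun do rewrite -mulNr; exact: integrableZr.
  rewrite (le_trans (mean_norm is_))// -!meanZ//; last exact: integrableZr.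
  apply: mean_le; [exact: integrable_norm|by do 2 apply: integrableZr|].
  by move=> w; rewrite -taylorm sin_taylor.
apply: (le_trans (lerD Ecos Esin)).
have uE : u ^+ 2 = a ^+ 2 * (s2 ^+ 2 * a ^+ 2 / 4) by rewrite /u; field.
have -> : 3 * (a ^+ 2 * mean P m) + u ^+ 2 + 3 * (a ^+ 2 * mean P m) =
  (6 * mean P m + s2 ^+ 2 * a ^+ 2 / 4) * a ^+ 2 by rewrite uE; field.
apply: ler_wpM2r; first exact: sqr_ge0.
have : s2 ^+ 2 * a ^+ 2 <= s2 ^+ 2 * `|a|.
  by rewrite ler_wpM2l ?sqr_ge0// a2 expr2 ler_piMr.
move: aD; rewrite /D !mulrDr mulr1.
have := normr_ge0 a.
have : 0 <= `|a| * (K%:R * s2 * 24) by rewrite !mulr_ge0.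
have : 0 <= `|a| * s2 ^+ 2 by rewrite !mulr_ge0// sqr_ge0.
move: mle; lra.
Qed.

End second_moment.

(** * The standard normal law *)

Section standard_normal.
Context {R : realType}.
Local Notation mu := (@lebesgue_measure R).
Local Notation phi := (normal_pdf 0 1 : R -> R).

Lemma std_pdfE (x : R) : phi x = normal_peak 1 * expR (- (x ^+ 2 / 2)).
Proof.
rewrite normal_pdfE ?oner_eq0// /normal_fun subr0 expr1n mulNr.
by rewrite -mulr_natl mulr1.
Qed.

Lemma std_pdf_gt0 (x : R) : 0 < phi x.
Proof. by rewrite std_pdfE mulr_gt0 ?expR_gt0// normal_peak_gt0// oner_eq0. Qed.

Lemma is_derive_std_pdf (x : R) : is_derive x (1 : R) phi (- x * phi x).
Proof.
have -> : phi = normal_peak 1 \*: (expR \o (fun y : R => - (y ^+ 2 / 2))).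
  by apply/funext => y; exact: std_pdfE.
have h1 : is_derive x (1 : R) (fun y : R => - (y ^+ 2 / 2)) (- x).
  by apply: is_derive_eq; rewrite /GRing.scale/=; lra.
have h2 := is_derive1_comp (is_derive_expR _) h1.
have h3 := is_deriveZ (normal_peak 1) h2.
rewrite (_ : - x * _ = normal_peak 1 *: (expR (- (x ^+ 2 / 2)) * - x))//.
by rewrite /GRing.scale/= mulrCA mulrC [in RHS]mulrC -mulrA [- x * _]mulrC; ring.
Qed.

Lemma integrable_mul_pdf (h : R -> R) : bounded_measurable h ->
  mu.-integrable setT (EFin \o (fun x => h x * phi x)).
Proof.
move=> [mh [K hK]].
have i0 : mu.-integrable setT (EFin \o (fun x => K * phi x)).
  have := integrableZl measurableT K (@integrable_normal_pdf R 0 1).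
  by congr (_.-integrable _ _).
apply: (le_integrable _ _ _ i0) => //.
  apply/measurable_EFinP; apply: measurable_funM => //; exact: measurable_normal_pdf.
move=> x _; rewrite /= lee_fin normrM (normrM K) ler_wpM2r//.
by rewrite (le_trans (hK x))// ler_norm.
Qed.

(** On indicators this is the definition of the normal law; bounded functions
    are uniform limits of step functions. *)
Lemma mean_std_normal {d} {T : measurableType d} (P : probability T R)
    (G : {RV P >-> R}) (h : R -> R) :
  has_law G (normal_prob 0 1) -> bounded_measurable h ->
  mean P (fun w => h (G w)) = \int[mu]_x (h x * phi x).
Proof.
move=> lawG bh.
have [K hK] := bh.2.
have bphi : mu.-integrable setT (EFin \o phi) by exact: integrable_normal_pdf.
have phi1 : \int[mu]_x phi x = 1.
  by rewrite /Rintegral integral_normal_pdf.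
apply/eqP; rewrite -subr_eq0 -normr_le0; apply/ler_addgt0Pr => eps e0; rewrite add0r.
have e20 : 0 < eps / 2 by rewrite divr_gt0.
have [n [a [B [mB hs]]]] := bounded_uniform_simple bh e20.
pose g y := \sum_i a i * \1_(B i) y.
have bB i : bounded_measurable (\1_(B i) : R -> R) by exact: bmf_indic.
have bBG i : bounded_measurable (fun w => \1_(B i) (G w) : R) by exact: bmf_comp (bB i).
have bg : bounded_measurable g by apply: bmf_sum => i; exact: bmfZ.
have gE : mean P (fun w => g (G w)) = \int[mu]_x (g x * phi x).
  rewrite /g mean_sum => [|i]; last exact: bmf_integrable (bmfZ (a i) (bBG i)).
  rewrite (_ : (fun x => _ * _) = (fun x => \sum_i (a i * \1_(B i) x) * phi x)); last first.
    by apply/funext => x; rewrite big_distrl.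
  rewrite (_ : Rintegral mu setT _ = \sum_i \int[mu]_x (a i * \1_(B i) x * phi x)); last first.
    have iB i : mu.-integrable setT (EFin \o (fun x => a i * \1_(B i) x * phi x)).
      by apply: integrable_mul_pdf; exact: bmfZ.
    rewrite /Rintegral; under eq_integral do rewrite -sumEFin.
    rewrite integral_sum//= -sum_fine// => i _.
    exact: (integrable_fin_num measurableT (iB i)).
  apply: eq_bigr => i _; rewrite meanZ; last exact: bmf_integrable.
  under [in RHS]eq_Rintegral do rewrite -mulrA.
  rewrite RintegralZl//; last exact: integrable_mul_pdf.
  congr (_ * _); rewrite (_ : (fun w => \1_(B i) (G w)) = \1_(G @^-1` B i))// mean_indic; last first.
    by rewrite -[X in measurable X]setTI; exact: measurable_funPT.
  have -> : P (G @^-1` B i) = normal_prob 0 1 (B i) := lawG (B i) (mB i).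
  rewrite -/(Rintegral mu (B i) phi) Rintegral_mkcond.
  apply: eq_Rintegral => x _; rewrite patchE [X in _ = X * _]indicE.
  by case: ifP => _; rewrite ?mul1r ?mul0r.
have bhg : bounded_measurable (fun x => h x - g x) by exact: bmfB.
have bhG : bounded_measurable (fun w => h (G w)) by exact: bmf_comp bh.
have bgG : bounded_measurable (fun w => g (G w)) by exact: bmf_comp bg.
have -> : mean P (fun w => h (G w)) - \int[mu]_x (h x * phi x) =
    mean P (fun w => h (G w) - g (G w)) - \int[mu]_x ((h x - g x) * phi x).
  rewrite (meanB (bmf_integrable _ bhG) (bmf_integrable _ bgG)) gE.
  under [X in _ = _ - X]eq_Rintegral do rewrite mulrBl.
  by rewrite RintegralB//; [ring|exact: integrable_mul_pdf..].
have -> : eps = eps / 2 + eps / 2 by field.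
rewrite (le_trans (ler_normB _ _))// lerD//; first by apply: mean_norm_le => [|w]; [exact: bmfB|exact: hs].
rewrite (le_trans (le_normr_Rintegral _ (integrable_mul_pdf bhg)))//.
apply: (@le_trans _ _ (\int[mu]_x (eps / 2 * phi x))); last first.
  by rewrite RintegralZl// phi1 mulr1.
apply: le_Rintegral => //.
- exact: integrable_norm (integrable_mul_pdf bhg).
- by apply: (integrable_mul_pdf (bmf_cst (eps / 2))).
- by move=> x _; rewrite normrM (gtr0_norm (std_pdf_gt0 x)) ler_wpM2r ?(ltW (std_pdf_gt0 x)).
Qed.

(** The linear factor is absorbed by half of the exponent, which leaves a
    multiple of the normal density of variance 2. *)
Lemma integrable_id_pdf : mu.-integrable setT (EFin \o (fun x => `|x| * phi x)).
Proof.
pose s : R := Num.sqrt 2.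
have s0 : s != 0 by rewrite gt_eqF// sqrtr_gt0.
pose K : R := normal_peak 1 / normal_peak s.
have i0 : mu.-integrable setT (EFin \o (fun x => K * normal_pdf 0 s x)).
  have := integrableZl measurableT K (@integrable_normal_pdf R 0 s).
  by congr (_.-integrable _ _).
apply: (le_integrable _ _ _ i0) => //.
  apply/measurable_EFinP; apply: measurable_funM; first exact: normr_measurable.
  exact: measurable_normal_pdf.
move=> x _; rewrite /= lee_fin ger0_norm ?mulr_ge0 ?(ltW (std_pdf_gt0 x))//.
apply: le_trans (ler_norm _).
have -> : K * normal_pdf 0 s x = normal_peak 1 * expR (- (x ^+ 2 / 4)).
  rewrite normal_pdfE// /K mulrA divfK ?gt_eqF ?normal_peak_gt0//.
  rewrite /normal_fun subr0 sqr_sqrtr// mulNr -mulr_natl; congr (_ * expR (- (_ / _))).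
  by rewrite -natrM.
rewrite std_pdfE mulrCA ler_wpM2l ?normal_peak_ge0//.
have -> : x ^+ 2 / 2 = x ^+ 2 / 4 + x ^+ 2 / 4 by field.
rewrite opprD expRD mulrA ler_piMl ?expR_ge0// expRN ler_pdivrMr ?expR_gt0// mul1r.
apply: le_trans (expR_ge1Dx _).
rewrite -(real_normK (num_real x)); have := sqr_ge0 (`|x| / 2 - 1); nra.
Qed.

Lemma bmf_cos_affine (u b : R) : bounded_measurable (fun x : R => cos (u * x + b)).
Proof.
apply: bmf_cos; apply: measurable_funD => //; exact: mulrl_measurable.
Qed.

Lemma is_derive_affine (u b x : R) : is_derive x (1 : R) (fun x : R => u * x + b) u.
Proof. by apply: is_derive_eq; rewrite /GRing.scale/=; lra. Qed.

Lemma std_pdf_cvg0 : phi n.+1%:R @[n --> \oo] --> (0 : R).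
Proof.
apply: (@squeeze_cvgr _ _ _ _ (cst 0) (fun n => normal_peak 1 * (2 * harmonic n))).
- apply: nearW => n; rewrite ltW ?std_pdf_gt0//= std_pdfE ler_wpM2l ?normal_peak_ge0//.
  rewrite expRN -[leRHS]invrK lef_pV2 ?posrE ?expR_gt0//.
  rewrite /harmonic/= invfM invrK (le_trans _ (expR_ge1Dx _))// mulrC.
  have : 1 <= n.+1%:R :> R by rewrite ler1n.
  nra.
- exact: cvg_cst.
- rewrite -(mulr0 (normal_peak 1)); apply: cvgM; first exact: cvg_cst.
  by rewrite -(mulr0 2); apply: cvgM; [exact: cvg_cst|exact: cvg_harmonic].
Qed.

(** The function [sin (t x + b) phi x] vanishes at infinity, so the integral of
    its derivative is 0; its two terms are the two sides. *)
Lemma integral_std_pdf_byparts (t b : R) :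
  \int[mu]_x (- x * sin (t * x + b) * phi x) = - t * \int[mu]_x (cos (t * x + b) * phi x).
Proof.
pose H x := sin (t * x + b) * phi x.
pose h1 x := - x * sin (t * x + b) * phi x.
pose h2 x := t * (cos (t * x + b) * phi x).
have Hder x : is_derive x (1 : R) H (h1 x + h2 x).
  have d1 := @is_derive1_comp R sin (fun x => t * x + b) x _ _ (is_derive_sin (t * x + b)) (is_derive_affine t b x).
  have d2 := is_deriveM d1 (is_derive_std_pdf x).
  rewrite (_ : h1 x + h2 x = sin (t * x + b) *: (- x * phi x) + phi x *: (cos (t * x + b) * t))//.
  by rewrite /h1 /h2 /GRing.scale/=; ring.
have ih2 : mu.-integrable setT (EFin \o h2).
  have := integrable_mul_pdf (bmfZ t (bmf_cos_affine t b)).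
  by congr (_.-integrable _ _); apply/funext => x; rewrite /h2 /= mulrA.
have caff x : {for x, continuous (fun x : R => t * x + b)}.
  by apply: differentiable_continuous; apply/derivable1_diffP; case: (is_derive_affine t b x).
have cphi x : {for x, continuous phi} by apply: continuous_normal_pdf; rewrite oner_eq0.
have ch1 : continuous h1.
  move=> x; apply: cvgM; last exact: cphi.
  apply: cvgM; first by apply: cvgN; exact: cvg_id.
  by apply: continuous_comp; [exact: caff|exact: continuous_sin].
have ch2 : continuous h2.
  move=> x; apply: cvgM; first exact: cvg_cst.
  apply: cvgM; last exact: cphi.
  by apply: continuous_comp; [exact: caff|exact: continuous_cos].
have ch : continuous (fun x => h1 x + h2 x).
  by move=> x; apply: cvgD; [exact: ch1|exact: ch2].
have ih1 : mu.-integrable setT (EFin \o h1).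
  apply: (le_integrable _ _ _ integrable_id_pdf) => //.
    by apply/measurable_EFinP; exact: continuous_measurable_fun.
  move=> x _; rewrite /= lee_fin !normrM normr_id normrN (gtr0_norm (std_pdf_gt0 x)).
  rewrite ler_wpM2r ?(ltW (std_pdf_gt0 x))//.
  by rewrite ler_piMr// sin_max.
have ih : mu.-integrable setT (EFin \o (fun x => h1 x + h2 x)).
  by have := integrableD measurableT ih1 ih2; congr (_.-integrable _ _).
pose I n : set R := `[- n.+1%:R, n.+1%:R]%classic.
have cH : continuous H.
  by move=> x; apply: differentiable_continuous; apply/derivable1_diffP; case: (Hder x).
have FTC n : \int[mu]_(x in I n) (h1 x + h2 x) = H n.+1%:R - H (- n.+1%:R).
  have nn : - n.+1%:R < n.+1%:R :> R by have : 0 < n.+1%:R :> R by []; lra.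
  rewrite /Rintegral (@continuous_FTC2 _ _ H)//.
  - exact: continuous_subspaceT.
  - split; first by move=> x _; case: (Hder x).
      by apply: cvg_at_right_filter; exact: cH.
    by apply: cvg_at_left_filter; exact: cH.
  - by move=> x _; rewrite derive1E; case: (Hder x).
have lim1 : \int[mu]_(x in I n) (h1 x + h2 x) @[n --> \oo] --> \int[mu]_x (h1 x + h2 x).
  rewrite (_ : (fun n => \int[mu]_(x in I n) (h1 x + h2 x)) =
      fun n => \int[mu]_x ((fun x => h1 x + h2 x) \_ (I n)) x); last first.
    by apply/funext => n; rewrite Rintegral_mkcond.
  apply: (@Rintegral_dominated _ (measurableTypeR R) R mu
    (fun n => (fun x => h1 x + h2 x) \_ (I n)) (fun x => h1 x + h2 x)
    (fun x => `|h1 x + h2 x|)); last 2 first.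
  - exact: integrable_norm ih.
  - by move=> n x; rewrite patchE; case: ifP => // _; rewrite normr0.
  - move=> n; have mI : measurable (I n) by exact: measurable_itv.
    have mh := measurable_funTS (D := I n) (continuous_measurable_fun ch).
    exact: (measurable_restrictT (fun x => h1 x + h2 x) mI).1 mh.
  - exact: continuous_measurable_fun.
  - move=> x; apply: cvg_near_cst; near=> n.
    rewrite patchE mem_set// /I /= in_itv/= -ler_norml.
    have : `|x| <= n%:R by near: n; exact: nbhs_infty_ger.
    by move=> /le_trans; apply; rewrite ler_nat.
have Hle x : `|H x| <= phi x.
  by rewrite normrM (gtr0_norm (std_pdf_gt0 x)) ler_piMl ?sin_max// ltW// std_pdf_gt0.
have phiN x : phi (- x) = phi x by rewrite !std_pdfE sqrrN.
have lim2 : \int[mu]_(x in I n) (h1 x + h2 x) @[n --> \oo] --> (0 : R).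
  rewrite (_ : (fun n => \int[mu]_(x in I n) (h1 x + h2 x)) =
      fun n => H n.+1%:R - H (- n.+1%:R)); last exact/funext.
  rewrite -(subr0 0); apply: cvgB.
    apply: norm_cvg0; apply: (@squeeze_cvgr _ _ _ _ (cst 0) (fun n => phi n.+1%:R)).
    - by apply: nearW => n; rewrite normr_ge0/= Hle.
    - exact: cvg_cst.
    - exact: std_pdf_cvg0.
  apply: norm_cvg0; apply: (@squeeze_cvgr _ _ _ _ (cst 0) (fun n => phi n.+1%:R)).
  - by apply: nearW => n; rewrite normr_ge0/= -phiN Hle.
  - exact: cvg_cst.
  - exact: std_pdf_cvg0.
have : \int[mu]_x (h1 x + h2 x) = 0.
  exact: (cvg_unique _ lim1 lim2).
rewrite RintegralD// /h2 RintegralZl//; last exact: integrable_mul_pdf (bmf_cos_affine t b).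
by move/eqP; rewrite addr_eq0 mulNr => /eqP.
Unshelve. all: by end_near. Qed.

(** Differentiation under the integral sign, followed by Stein's identity above. *)
Lemma std_normal_ode (b t : R) (F := fun t => \int[mu]_x (cos (t * x + b) * phi x)) :
  is_derive t (1 : R) F (- t * F t).
Proof.
pose f (u x : R) := cos (u * x + b) * phi x.
have f' u x : is_derive u (1 : R) (f ^~ x) (- x * sin (u * x + b) * phi x).
  have d0 : is_derive u (1 : R) (fun u : R => u * x + b) x.
    by apply: is_derive_eq; rewrite /GRing.scale/=; lra.
  have d1 := @is_derive1_comp R cos (fun u => u * x + b) u _ _ (is_derive_cos (u * x + b)) d0.
  have d2 := is_deriveM d1 (is_derive_cst (phi x) u (1 : R)).
  rewrite (_ : - x * sin _ * _ = cos (u * x + b) *: 0 + phi x *: (- sin (u * x + b) * x))//.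
  by rewrite /GRing.scale/=; ring.
have fder u x : derivable (f ^~ x) u (1 : R) by case: (f' u x).
have intf u : mu.-integrable setT (EFin \o f u).
  exact: integrable_mul_pdf (bmf_cos_affine u b).
have df u x : partial1of2 f u x = - x * sin (u * x + b) * phi x.
  by rewrite partial1of2E derive_val.
have tI : `]t - 1, t + 1[%classic t by rewrite /= in_itv/=; apply/andP; split; lra.
have Gub u x : `|partial1of2 f u x| <= `|x| * phi x.
  rewrite df normrM (gtr0_norm (std_pdf_gt0 x)) ler_wpM2r ?(ltW (std_pdf_gt0 x))//.
  by rewrite normrM normrN ler_piMr// sin_max.
have G0 x : 0 <= `|x| * phi x by rewrite mulr_ge0// ltW// std_pdf_gt0.
have dF := @derivable_under_integral R _ _ mu f setT measurableT t _ _ tI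
  (fun u _ => intf u) (fun u x _ _ => fder u x) _ G0 integrable_id_pdf (fun u x _ _ => Gub u x).
have FE := @differentiation_under_integral R _ _ mu f setT measurableT t _ _ tI
  (fun u _ => intf u) (fun u x _ _ => fder u x) _ G0 integrable_id_pdf (fun u x _ _ => Gub u x).
apply: DeriveDef => //.
rewrite -derive1E FE -integral_std_pdf_byparts.
by apply: eq_Rintegral => x _; rewrite df.
Qed.

(** By the differential equation, [F t * exp (t^2 / 2)] is constant. The phase
    [b = - pi / 2] gives the corresponding sine. *)
Lemma std_normal_cos (b t : R) :
  \int[mu]_x (cos (t * x + b) * phi x) = expR (- (t ^+ 2 / 2)) * cos b.
Proof.
pose F t := \int[mu]_x (cos (t * x + b) * phi x).
pose K t := F t * expR (t ^+ 2 / 2) - cos b.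
have K' u : is_derive u (1 : R) K 0.
  have h1 : is_derive u (1 : R) (fun y : R => y ^+ 2 / 2) u.
    by apply: is_derive_eq; rewrite /GRing.scale/=; lra.
  have h2 := is_derive1_comp (is_derive_expR _) h1.
  have h3 := is_deriveM (std_normal_ode b u) h2.
  have h4 := is_deriveB h3 (is_derive_cst (cos b) u (1 : R)).
  rewrite (_ : 0 = F u *: (expR (u ^+ 2 / 2) * u) + expR (u ^+ 2 / 2) *: (- u * F u) - 0) //.
  by rewrite /GRing.scale/=; ring.
have F0 : F 0 = cos b.
  rewrite /F; under eq_Rintegral do rewrite mul0r add0r.
  rewrite RintegralZl//; last exact: integrable_normal_pdf.
  by rewrite /Rintegral integral_normal_pdf mulr1.
have K0 : K 0 = 0 by rewrite /K F0 expr0n/= mul0r expR0 mulr1 subrr.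
have le0 (y : R) : `|y| <= `|t| -> `|0 : R| <= 0 by rewrite normr0.
have := @mvt_bound R K (fun=> 0) 0 t K' K0 le0.
rewrite mul0r normr_le0 subr_eq0 => /eqP KE.
by rewrite -/(F t) -KE mulrC -mulrA -expRD subrr expR0 mulr1.
Qed.

End standard_normal.

Section normal_shift.
Context {R : realType}.
Local Notation mu := (@lebesgue_measure R).
Local Notation phi := (normal_pdf 0 1 : R -> R).

Lemma integral_std_pdf_shift (a b s : R) : a < b ->
  (\int[mu]_(x in `[(a - s)%R, (b - s)%R]) (phi x)%:E = \int[mu]_(x in `[a, b]) (phi (x - s)%R)%:E)%E.
Proof.
move=> ab.
have d (x : R) : is_derive x (1 : R) (fun x : R => x - s) 1.
  by apply: is_derive_eq; rewrite subr0.
have dE : (fun x : R => x - s)^`()%classic = cst 1.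
  by apply/funext => x; rewrite derive1E; case: (d x).
have cf (x : R) : {for x, continuous (fun x : R => x - s)}.
  by apply: differentiable_continuous; apply/derivable1_diffP; case: (d x).
rewrite (@integration_by_substitution_increasing _ (fun x => x - s) phi a b) ?(ltW ab)//.
- by apply: eq_integral => x _; rewrite dE; congr (_%:E); rewrite -[RHS]mulr1.
- by move=> x y _ _ xy; rewrite ltrD2r.
- by move=> x _; rewrite dE; exact: cst_continuous.
- by rewrite dE; exact: is_cvg_cst.
- by rewrite dE; exact: is_cvg_cst.
- split; first by move=> x _; case: (d x).
    by apply: cvg_at_right_filter; exact: cf.
  by apply: cvg_at_left_filter; exact: cf.
- by apply: continuous_subspaceT => x; apply: continuous_normal_pdf; rewrite oner_eq0.
Qed.

(** The density ratio is [exp (x s - s^2 / 2)]. *)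
Lemma std_pdf_shift (L s x : R) : `|x| <= L -> phi (x - s) <= expR (L * `|s|) * phi x.
Proof.
move=> xL; rewrite !std_pdfE mulrCA ler_wpM2l ?normal_peak_ge0// -expRD ler_expR.
have : x * s <= L * `|s|.
  by rewrite (le_trans (ler_norm _))// normrM ler_wpM2r.
by have := sqr_ge0 s; nra.
Qed.

(** The density ratio of a shifted standard normal law is close to 1 on bounded
    sets when the shift is small. *)
Lemma normal_shift {d} {T : measurableType d} (P : probability T R)
    (G : {RV P >-> R}) (L s a b : R) : has_law G (normal_prob 0 1) ->
  - L <= a -> a < b -> b <= L ->
  fine (P [set w | a <= G w + s < b]) <=
  expR (L * `|s|) * fine (P [set w | a <= G w < b]).
Proof.
move=> lawG La ab bL.
have PE (u v : R) : u < v -> P [set w | u <= G w < v] = (\int[mu]_(x in `[u, v]) (phi x)%:E)%E.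
  move=> uv; have -> : [set w | u <= G w < v] = G @^-1` `[u, v[.
    by apply/seteqP; split => w /=; rewrite in_itv.
  rewrite -[LHS]/(distribution P G `[u, v[) lawG//.
  rewrite /normal_prob integral_itv_bndo_bndc//.
  by apply/measurable_EFinP/measurable_funTS; exact: measurable_normal_pdf.
have -> : [set w | a <= G w + s < b] = [set w | a - s <= G w < b - s].
  by apply/seteqP; split => w /=; rewrite lerBlDr ltrBrDr.
rewrite !PE ?ltrD2r// integral_std_pdf_shift//.
have iphi : mu.-integrable `[a, b] (EFin \o phi).
  by apply: integrableS (@integrable_normal_pdf R 0 1).
have iphis : mu.-integrable `[a, b] (EFin \o (fun x => phi (x - s))).
  apply: continuous_compact_integrable; first exact: segment_compact.
  apply: continuous_subspaceT => x.
  apply: (@continuous_comp _ _ _ (fun x : R => x - s) phi); last first.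
    by apply: continuous_normal_pdf; rewrite oner_eq0.
  by apply: cvgB; [exact: cvg_id|exact: cvg_cst].
rewrite -!/(Rintegral mu _ _) -RintegralZl//.
apply: le_Rintegral => //.
  apply: (@integrableS _ _ _ mu setT) => //.
  exact: (integrable_mul_pdf (bmf_cst (expR (L * `|s|)))).
move=> x; rewrite /= in_itv/= => /andP[ax xb]; apply: std_pdf_shift.
by rewrite ler_norml; apply/andP; split; lra.
Qed.

End normal_shift.

(** * Real-valued probabilities *)

Section real_probability.
Context {d : measure_display} {T : measurableType d} {R : realType}.
Variable P : probability T R.
Implicit Types A B : set T.

Definition pr A : R := fine (P A).

Lemma prE A : measurable A -> P A = (pr A)%:E.
Proof. by move=> mA; rewrite fineK// fin_num_measure. Qed.

Lemma pr_ge0 A : 0 <= pr A.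
Proof. exact: fine_ge0. Qed.

Lemma pr_le1 A : measurable A -> pr A <= 1.
Proof. by move=> mA; rewrite -lee_fin -prE// probability_le1. Qed.

Lemma pr_le A B : measurable A -> measurable B -> A `<=` B -> pr A <= pr B.
Proof. by move=> mA mB AB; rewrite -lee_fin -!prE// le_measure ?inE. Qed.

Lemma prU_le A B : measurable A -> measurable B -> pr (A `|` B) <= pr A + pr B.
Proof.
move=> mA mB; rewrite -lee_fin EFinD -!prE//; last exact: measurableU.
exact: measureU2.
Qed.

Lemma prC A : measurable A -> pr (~` A) = 1 - pr A.
Proof.
move=> mA; apply/EFin_inj; rewrite EFinB -!prE//; last exact: measurableC.
exact: probability_setC.
Qed.

Lemma pr_mean A : measurable A -> pr A = mean P \1_A.
Proof. by move=> mA; rewrite mean_indic. Qed.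

Lemma pr_finU (I : finType) (Q : pred I) (F : I -> set T) :
  (forall i, measurable (F i)) -> trivIset setT F ->
  pr (\bigcup_(i in [set i | Q i]) F i) = \sum_(i | Q i) pr (F i).
Proof.
move=> mF tF; have mU : measurable (\bigcup_(i in [set i | Q i]) F i).
  by apply: fin_bigcup_measurable.
rewrite pr_mean// (eq_bigr (fun i => mean P \1_(F i))) => [|i _]; last by rewrite pr_mean.
rewrite -big_filter -mean_sum => [|i]; last by apply/bmf_integrable/bmf_indic.
congr (mean P _); apply/funext => w; rewrite big_filter indicE.
case: (boolP (w \in _)) => [|wU].
  rewrite inE => -[i /= Qi Fiw]; rewrite (bigD1 i)//= indicE mem_set// big1 ?addr0//.
  move=> j /andP[_ ji]; rewrite indicE memNset// => Fjw; move/eqP: ji; apply.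
  by apply: (tF j i) => //; exists w.
rewrite big1// => i Qi; rewrite indicE memNset// => Fiw.
by move: wU; rewrite notin_setE; apply; exists i.
Qed.

Lemma pr_bigcup_approx (F : nat -> set T) (eps : R) :
  (forall n, measurable (F n)) -> (forall n, F n `<=` F n.+1) -> 0 < eps ->
  exists N, pr (\bigcup_n F n) <= pr (F N) + eps.
Proof.
move=> mF incF e0.
have ndF : nondecreasing_seq F.
  by apply/nondecreasing_seqP => n; apply/subsetPset; exact: incF.
have mU : measurable (\bigcup_n F n) by exact: bigcupT_measurable.
have : P \o F @ \oo --> P (\bigcup_n F n) by exact: nondecreasing_cvg_mu.
rewrite (prE mU) => /fine_cvg /cvgrPdist_le/(_ _ e0)[N _ /(_ N (leqnn N))] /= H.
by exists N; rewrite -lerBlDl; apply: le_trans H; rewrite ler_norm.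
Qed.

End real_probability.

(** * Dyadic cubes and open sets *)

Section dyadic_cells.
Context {R : realType} {p : nat}.

(** The half-open dyadic cubes of level [N] that tile [[-N, N)^p]; the bounds
    are strict on the right so that the cubes are disjoint. *)
Definition grid_index (N : nat) := {ffun 'I_p -> 'I_(2 * N * 2 ^ N)}.

Definition grid_corner N (k : grid_index N) : 'cV[R]_p :=
  \col_j ((k j)%:R / 2 ^+ N - N%:R).

Definition grid_cell N (k : grid_index N) : set 'cV[R]_p :=
  [set z | forall j, grid_corner k j 0 <= z j 0 < grid_corner k j 0 + 2 ^- N].

(** The ball is larger than the cube, which leaves room for a bump that is close
    to 1 on the cube and to 0 outside [E]. *)
Definition good_cell N (E : set 'cV[R]_p) (k : grid_index N) : bool :=
  `[< ball (grid_corner k) (2 * 2 ^- N) `<=` E >].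

Definition inner_grid N (E : set 'cV[R]_p) : set 'cV[R]_p :=
  \bigcup_(k in [set k | good_cell E k]) @grid_cell N k.

Lemma grid_cell_ball N (k : grid_index N) z : grid_cell k z ->
  ball (grid_corner k) (2 ^- N) z.
Proof.
move=> kz; apply/mx_ballP => [|i j]; first by rewrite invr_gt0 exprn_gt0.
have -> : j = 0 by exact: ord1.
by have /andP[k1 k2] := kz i; rewrite ltr_norml; apply/andP; split; lra.
Qed.

Lemma grid_cell_trivIset N : trivIset setT (@grid_cell N).
Proof.
move=> k l _ _ [z [kz lz]]; apply/ffunP => j; apply/val_inj => /=.
have tr (m : grid_index N) : grid_cell m z -> m j = Num.truncn ((z j 0 + N%:R) * 2 ^+ N) :> nat.
  move=> /(_ j); rewrite mxE => /andP[m1 m2]; apply/esym/truncn_def.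
  have p2 : 0 < 2 ^+ N :> R by exact: exprn_gt0.
  apply/andP; split; first by rewrite -ler_pdivrMr//; lra.
  have -> : (m j).+1%:R = ((m j)%:R / 2 ^+ N + 2 ^- N) * 2 ^+ N :> R.
    by rewrite mulrDl divfK ?gt_eqF// mulVf ?gt_eqF// natr1.
  by rewrite ltr_pM2r//; lra.
by rewrite (tr k)// (tr l).
Qed.

Lemma inner_grid_sub N E : inner_grid N E `<=` E.
Proof.
move=> z [k /= /asboolP kE kz]; apply: kE; apply: le_ball (grid_cell_ball kz).
by have : 0 <= 2 ^- N :> R; [rewrite invr_ge0 exprn_ge0|lra].
Qed.

Lemma grid_cover N (z : 'cV[R]_p) : (forall j, - N%:R <= z j 0 < N%:R) ->
  exists k : grid_index N, grid_cell k z.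
Proof.
move=> zN; have p2 : 0 < 2 ^+ N :> R by exact: exprn_gt0.
have k0 j : 0 <= (z j 0 + N%:R) * 2 ^+ N.
  by rewrite mulr_ge0 ?(ltW p2)//; have /andP[] := zN j; lra.
have kN j : (Num.truncn ((z j 0 + N%:R) * 2 ^+ N)%R < 2 * N * 2 ^ N)%N.
  rewrite -(ltr_nat R) (le_lt_trans (proj1 (andP (truncn_itv (k0 j)))))//.
  rewrite !natrM natrX ltr_pM2r// mulrDl mul1r.
  by have /andP[] := zN j; lra.
exists [ffun j => Ordinal (kN j)] => j; rewrite mxE ffunE/=.
have /andP[t1 t2] := truncn_itv (k0 j).
rewrite lerBlDr ler_pdivrMr// t1/=; move: t2.
set t := Num.truncn _; have -> : t.+1%:R = (t%:R / 2 ^+ N + 2 ^- N) * 2 ^+ N :> R.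
  by rewrite mulrDl divfK ?gt_eqF// mulVf ?gt_eqF// natr1.
by rewrite ltr_pM2r//; lra.
Qed.

Lemma inner_grid_nondec N E : inner_grid N E `<=` inner_grid N.+1 E.
Proof.
move=> z [k /= /asboolP kE kz].
have p2 : 0 < 2 ^- N :> R by rewrite invr_gt0 exprn_gt0.
have zN j : - N.+1%:R <= z j 0 < N.+1%:R.
  have /andP[k1 k2] := kz j; move: k1 k2; rewrite mxE -natr1.
  have kl : (k j)%:R / 2 ^+ N + 2 ^- N <= 2 * N%:R :> R.
    rewrite -[X in _ + X]mul1r -mulrDl ler_pdivrMr ?exprn_gt0// natr1.
    by rewrite -natrX -!natrM ler_nat ltn_ord.
  have kg : 0 <= (k j)%:R / 2 ^+ N :> R by rewrite divr_ge0// exprn_ge0.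
  by move=> k1 k2; apply/andP; split; lra.
have [l lz] := grid_cover zN; exists l => //=; apply/asboolP => y ly; apply: kE.
have dE : 2 * 2 ^- N.+1 = 2 ^- N :> R by rewrite exprS invfM mulVKf.
rewrite dE in ly.
have q2 : 0 < 2 * 2 ^- N :> R by rewrite mulr_gt0.
apply/mx_ballP => // i j.
have -> : j = 0 by exact: ord1.
have := (mx_ballP _ _ p2).1 ly i 0.
have /andP[k1 k2] := kz i; have /andP[l1 l2] := lz i.
have d2 : 2 ^- N.+1 <= 2 ^- N :> R by have : 0 <= 2 ^- N.+1 :> R; [rewrite invr_ge0 exprn_ge0|lra].
by rewrite !ltr_norml => /andP[y1 y2]; apply/andP; split; lra.
Qed.

Lemma open_inner_grid E : open E -> E = \bigcup_N inner_grid N E.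
Proof.
move=> oE; apply/seteqP; split => [z Ez|z [N _]]; last exact: inner_grid_sub.
have /nbhs_ballP[e /= e0 eE] : nbhs z E by exact: oE.
pose N := (Num.truncn (3 / e + `|z|)).+1.
have NE : 3 / e + `|z| < N%:R by exact: truncnS_gt.
have e30 : 0 < 3 / e by rewrite divr_gt0.
have zN j : - N%:R <= z j 0 < N%:R.
  have := mxnorm_entry z j 0; rewrite ler_norml => /andP[z1 z2].
  by apply/andP; split; lra.
have [k kz] := grid_cover zN; exists N => //; exists k => //=; apply/asboolP => y ky.
apply: eE.
(* the point is within [2^-N] of the corner, and the ball around the corner has
   twice this radius *)
have d3 : 3 * 2 ^- N <= e.
  rewrite ler_pdivrMr ?exprn_gt0// mulrC -ler_pdivrMr//.
  apply: le_trans (ltW (le_lt_trans _ NE)) _; first by rewrite lerDl.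
  by rewrite -natrX ler_nat ltnW// ltn_expl.
apply: le_ball d3 _ _; have -> : 3 * 2 ^- N = 2 ^- N + 2 * 2 ^- N :> R by ring.
by apply: ball_triangle ky; apply: ball_sym; exact: grid_cell_ball.
Qed.

End dyadic_cells.

Section random_vector.
Context {d : measure_display} {T : measurableType d} {R : realType} {p : nat}.
Variable Y : T -> 'cV[R]_p.
Hypothesis mY : forall j, measurable_fun setT (fun w => Y w j 0).

Lemma measurable_grid_cell N (k : grid_index N) : measurable (Y @^-1` grid_cell k).
Proof.
have -> : Y @^-1` grid_cell k = \bigcap_(j in [set: 'I_p])
    ((fun w => Y w j 0) @^-1` `[grid_corner k j 0, grid_corner k j 0 + 2 ^- N[).
  apply/seteqP; split => w /= H j; first by move=> _; rewrite /= in_itv/=; exact: H.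
  by have := H j I; rewrite /= in_itv.
apply: fin_bigcap_measurable => // j _.
by rewrite -[X in measurable X]setTI; exact: mY.
Qed.

Lemma measurable_inner_grid N E : measurable (Y @^-1` inner_grid N E).
Proof.
rewrite /inner_grid preimage_bigcup; apply: fin_bigcup_measurable => [|k _]; first exact: finite_finset.
exact: measurable_grid_cell.
Qed.

(** An open set is a countable union of cubes, and these are defined by
    conditions on the single coordinates. *)
Lemma measurable_open_preimage (E : set 'cV[R]_p) : open E -> measurable (Y @^-1` E).
Proof.
move=> oE; rewrite (open_inner_grid oE) preimage_bigcup.
by apply: bigcupT_measurable => N; exact: measurable_inner_grid.
Qed.

Lemma measurable_borel_preimage (M : set 'cV[R]_p) : borel_set M -> measurable (Y @^-1` M).
Proof.
move=> hM; apply: (hM [set A | measurable (Y @^-1` A)]); split; last first.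
  by move=> U; exact: measurable_open_preimage.
split => /=.
- by rewrite preimage_set0.
- by move=> A mA; rewrite setTD preimage_setC; exact: measurableC.
- by move=> F mF; rewrite preimage_bigcup; exact: bigcupT_measurable.
Qed.

Lemma inner_grid_approx (P : probability T R) (E : set 'cV[R]_p) (eps : R) :
  open E -> 0 < eps ->
  exists N, pr P (Y @^-1` E) <= pr P (Y @^-1` inner_grid N E) + eps.
Proof.
move=> oE e0; rewrite {1}(open_inner_grid oE) preimage_bigcup.
apply: (pr_bigcup_approx P (F := fun N => Y @^-1` inner_grid N E)) => // n.
  exact: measurable_inner_grid.
by apply: preimage_subset; exact: inner_grid_nondec.
Qed.

Lemma pr_inner_grid (P : probability T R) N E :
  pr P (Y @^-1` inner_grid N E) =
  \sum_(k : grid_index N | good_cell E k) pr P (Y @^-1` grid_cell k).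
Proof.
rewrite /inner_grid preimage_bigcup pr_finU//; first by move=> k; exact: measurable_grid_cell.
move=> k l _ _ [w [kw lw]]; apply: (@grid_cell_trivIset R p N) => //.
by exists (Y w).
Qed.

End random_vector.

(** * Gaussian vectors: translation and hyperplanes *)

Section pr_independent.
Context {d : measure_display} {T : measurableType d} {R : realType}.
Variable P : probability T R.

Lemma pr_indep (I : finType) (Y : I -> {RV P >-> R}) (A : I -> set R) :
  mutually_independent Y -> (forall i, measurable (A i)) ->
  pr P (\bigcap_(i in [set: I]) (Y i @^-1` A i)) = \prod_i pr P (Y i @^-1` A i).
Proof.
move=> indY mA; apply/EFin_inj; rewrite -prE; last first.
  apply: fin_bigcap_measurable => [|i _]; first exact: finite_finset.
  by rewrite -[X in measurable X]setTI; exact: measurable_funPT.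
rewrite -prodEFin indY//; apply: eq_bigr => i _; rewrite -prE//.
by rewrite -[X in measurable X]setTI; exact: measurable_funPT.
Qed.

Lemma pr_finU_le (I : finType) (F : I -> set T) : (forall i, measurable (F i)) ->
  pr P (\bigcup_(i in [set: I]) F i) <= \sum_i pr P (F i).
Proof.
move=> mF.
have bI (s : seq I) : pr P (\bigcup_(i in [set i | i \in s]) F i) <= \sum_(i <- s) pr P (F i).
  elim: s => [|i s IH].
    rewrite big_nil (_ : [set i | i \in [::]] = set0) ?bigcup_set0 /pr ?measure0//.
    by apply/seteqP; split.
  rewrite big_cons (_ : [set j | j \in i :: s] = i |` [set j | j \in s]).
    rewrite bigcup_setU1 (le_trans (prU_le _ _ _))// ?lerD2l//.
    by apply: fin_bigcup_measurable => // ; exact: finite_finset.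
  apply/seteqP; split => j /=; rewrite inE; first by case/orP => [/eqP|]; [left|right].
  by case=> [->|->]; rewrite ?eqxx ?orbT.
have := bI (enum I); rewrite big_enum/=; congr (pr P (\bigcup_(_ in _) _) <= _).
by apply/seteqP; split => // i _ /=; rewrite mem_enum.
Qed.

End pr_independent.

Lemma affine_continuous {R : realType} {p q : nat} (m : 'cV[R]_q) (A : 'M[R]_(q, p))
    (E : set 'cV[R]_q) : open E -> open [set g : 'cV[R]_p | E (m + A *m g)].
Proof.
move=> oE; rewrite openE => g /= Eg.
have /nbhs_ballP[e /= e0 eE] : nbhs (m + A *m g) E by exact: oE.
pose K := p%:R * `|A| + 1; have K0 : 0 < K by rewrite ltr_wpDl// mulr_ge0.
apply/nbhs_ballP; exists (e / K) => /= [|y]; first by rewrite divr_gt0.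
rewrite mx_norm_ball /ball_/= => gy; apply: eE; rewrite mx_norm_ball /ball_/=.
have -> : m + A *m g - (m + A *m y) = A *m (g - y).
  by rewrite mulmxBr; move: (A *m g) (A *m y) => a b; apply/matrixP => i j; rewrite !mxE; ring.
rewrite (le_lt_trans (mxnorm_mulmx _ _))//.
have := normr_ge0 (g - y); move: gy; rewrite ltr_pdivlMr// /K.
set x := `|_|; set c := _ * `|A|; have : 0 <= c by rewrite mulr_ge0.
by move=> c0 xe x0; rewrite (le_lt_trans _ xe)// mulrC ler_wpM2l// lerDl.
Qed.

Section gaussian_shift.
Context {d : measure_display} {U : measurableType d} {R : realType} {p : nat}.
Variables (Q : probability U R) (G : 'I_p -> {RV Q >-> R}).
Hypothesis indG : mutually_independent G.
Hypothesis lawG : forall j, has_law (G j) (normal_prob 0 1).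

Let Gv w : 'cV[R]_p := \col_j G j w.

Let mGh (h : 'cV[R]_p) j : measurable_fun setT (fun w => (Gv w + h) j 0).
Proof.
by under eq_fun do rewrite !mxE; apply: measurable_funD.
Qed.

(** Coordinate by coordinate, the standard normal density changes at most by the
    factor [exp (L |h_j|)] on [[- L, L]]. *)
Lemma gauss_shift_cell N (k : @grid_index p N) (L : R) (h : 'cV[R]_p) :
  (forall j, - L <= grid_corner k j 0 /\ grid_corner k j 0 + 2 ^- N <= L) ->
  pr Q [set w | grid_cell k (Gv w + h)] <=
  expR (L * \sum_j `|h j 0|) * pr Q [set w | grid_cell k (Gv w)].
Proof.
move=> kL; pose c j : R := grid_corner k j 0.
have d0 : 0 < 2 ^- N :> R by rewrite invr_gt0 exprn_gt0.
pose A (h : 'cV[R]_p) j := [set x : R | c j <= x + h j 0 < c j + 2 ^- N].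
have mA g j : measurable (A g j).
  have -> : A g j = `[c j - g j 0, c j - g j 0 + 2 ^- N[%classic.
    apply/seteqP; split => x; rewrite /A /= in_itv/= => /andP[x1 x2];
      by apply/andP; split; lra.
  exact: measurable_itv.
have GvE w g j : (Gv w + g) j 0 = G j w + g j 0 by rewrite !mxE.
have cellE g : [set w | grid_cell k (Gv w + g)] = \bigcap_(j in [set: 'I_p]) (G j @^-1` A g j).
  apply/seteqP; split => w H j.
    by move=> _; have := H j; rewrite GvE.
  by rewrite GvE; exact: (H j Logic.I).
have -> : [set w | grid_cell k (Gv w)] = [set w | grid_cell k (Gv w + 0)].
  by apply/seteqP; split => w; rewrite /= addr0.
rewrite !cellE !pr_indep// mulr_sumr expR_sum -big_split/=.
apply: ler_prod => j _; rewrite pr_ge0/=.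
have [k1 k2] := kL j.
have := normal_shift (h j 0) (lawG j) k1 _ k2; rewrite ltrDl => /(_ d0).
have -> : [set w | c j <= G j w < c j + 2 ^- N] = G j @^-1` A 0 j.
  by apply/seteqP; split => w; rewrite /A /= mxE addr0.
exact.
Qed.

(** The bound for cubes passes to open sets by exhaustion, but only within a
    bounded region; what lies outside is kept as a remainder. *)
Lemma gauss_shift_open (E : set 'cV[R]_p) (L : R) (h : 'cV[R]_p) : open E -> 0 < L ->
  pr Q [set w | E (Gv w + h)] <=
  expR (L * \sum_j `|h j 0|) * pr Q [set w | E (Gv w)] + pr Q [set w | ~ ball 0 L (Gv w + h)].
Proof.
move=> oE L0; pose E' := E `&` ball (0 : 'cV[R]_p) L.
have oE' : open E' by apply: openI => //; exact: ball_open.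
have mo h' F : open F -> measurable [set w | F (Gv w + h')].
  by move=> oF; apply: (measurable_open_preimage (mGh h') oF).
have mnb : measurable [set w | ~ ball 0 L (Gv w + h)].
  have := measurableC (mo h _ (ball_open (0 : 'cV[R]_p) L)).
  by congr (measurable _).
have Gv0 : (fun w => Gv w + 0) = Gv by apply/funext => w; rewrite addr0.
have mG F : open F -> measurable [set w | F (Gv w)].
  by move=> /(mo 0); rewrite -[X in measurable X -> _]/((fun w => Gv w + 0) @^-1` F) Gv0.
have mGj j : measurable_fun setT (fun w => Gv w j 0) 
  by have := mGh 0 j; congr (measurable_fun _ _); apply/funext => w; rewrite addr0.
apply: (@le_trans _ _ (pr Q [set w | E' (Gv w + h)] + pr Q [set w | ~ ball 0 L (Gv w + h)])).
  rewrite (le_trans _ (prU_le _ _ _))//; last exact: mo.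
  apply: pr_le; [exact: mo|by apply: measurableU => //; exact: mo|].
  move=> w Ew; have [b|nb] := pselect (ball (0 : 'cV[R]_p) L (Gv w + h)).
    by left; split.
  by right.
rewrite lerD2r; apply/ler_addgt0Pr => eps e0.
have [N] := inner_grid_approx (mGh h) Q oE' e0.
rewrite (pr_inner_grid (mGh h)) => /le_trans; apply; rewrite lerD2r.
apply: (@le_trans _ _ (expR (L * \sum_j `|h j 0|) * pr Q (Gv @^-1` inner_grid N E'))); last first.
  rewrite ler_wpM2l ?expR_ge0// pr_le//; [exact: measurable_inner_grid|exact: mG|].
  by move=> w /inner_grid_sub[].
rewrite (pr_inner_grid mGj) big_distrr/=; apply: ler_sum => k kE.
apply: gauss_shift_cell => j.
have d0 : 0 < 2 ^- N :> R by rewrite invr_gt0 exprn_gt0.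
have inL z : ball (grid_corner k) (2 * 2 ^- N) z -> `|z j 0| < L.
  move: kE => /asboolP /[apply] -[_]; move=> /(mx_ballP _ _ L0)/(_ j 0).
  by rewrite mxE sub0r normrN.
split.
  have /inL : ball (grid_corner k : 'cV[R]_p) (2 * 2 ^- N) (grid_corner k).
    by apply: ballxx; rewrite mulr_gt0.
  by rewrite ltr_norml => /andP[/ltW].
have /inL : ball (grid_corner k : 'cV[R]_p) (2 * 2 ^- N) (grid_corner k + const_mx (2 ^- N)).
  apply/mx_ballP => [|i l]; first by rewrite mulr_gt0.
  by rewrite !mxE opprD addrA subrr sub0r normrN ger0_norm ?ltW//; lra.
by rewrite !mxE ltr_norml => /andP[_ /ltW].
Qed.

(** Translates of a Gaussian law are close in total variation: the bound is
    uniform over the open sets. *)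
Lemma gauss_shift (v : 'cV[R]_p) (eps : R) : 0 < eps ->
  exists2 t0 : R, 0 < t0 & forall t : R, `|t| <= t0 -> forall E : set 'cV[R]_p, open E ->
    pr Q [set w | E (Gv w + t *: v)] <= pr Q [set w | E (Gv w)] + eps.
Proof.
move=> e0; have e20 : 0 < eps / 2 by rewrite divr_gt0.
have mo h F : open F -> measurable [set w | F (Gv w + h)].
  by move=> oF; apply: (measurable_open_preimage (mGh h) oF).
have mG F : open F -> measurable [set w | F (Gv w)].
  by move=> /(mo 0); congr (measurable _); apply/seteqP; split => w; rewrite /= addr0.
pose F n := [set w | ball (0 : 'cV[R]_p) n.+1%:R (Gv w)].
have mF n : measurable (F n) by apply: mG; exact: ball_open.
have incF n : F n `<=` F n.+1.
  by move=> w; apply: le_ball; rewrite ler_nat.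
have [N] := pr_bigcup_approx Q mF incF e20.
have -> : \bigcup_n F n = setT.
  apply/seteqP; split => // w _; exists (Num.truncn `|Gv w|) => //.
  by rewrite /F /= mx_norm_ball /ball_/= sub0r normrN truncnS_gt.
have prT : pr Q setT = 1 by rewrite /pr probability_setT.
rewrite prT => FN.
pose L : R := N.+1%:R + `|v| + 1.
have L0 : 0 < L by rewrite ltr_wpDl// addr_ge0.
pose S := \sum_j `|v j 0|.
have S0 : 0 <= S by apply: sumr_ge0.
pose t0 := ln (1 + eps / 2) / (L * S + 1).
have LS0 : 0 < L * S + 1 by rewrite ltr_wpDl// mulr_ge0// ltW.
have l0 : 0 < ln (1 + eps / 2) by rewrite ln_gt0// ltrDl.
exists (Num.min 1 t0) => [|t]; first by rewrite lt_min ltr01 divr_gt0.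
rewrite le_min => /andP[t1 tt0] E oE.
apply: (le_trans (gauss_shift_open (t *: v) oE L0)).
have -> : \sum_j `|(t *: v) j 0| = `|t| * S.
  by rewrite /S big_distrr/=; apply: eq_bigr => j _; rewrite mxE normrM.
have exle : expR (L * (`|t| * S)) <= 1 + eps / 2.
  rewrite -[leRHS]lnK ?posrE ?addr_gt0// ler_expR.
  move: tt0; rewrite ler_pdivlMr// => tt0; rewrite (le_trans _ tt0)//.
  by rewrite mulrCA ler_wpM2l// lerDl.
have pE0 := pr_ge0 Q [set w | E (Gv w)].
have pE1 : pr Q [set w | E (Gv w)] <= 1 by apply: pr_le1; exact: mG.
have tail : pr Q [set w | ~ ball 0 L (Gv w + t *: v)] <= eps / 2.
  apply: (@le_trans _ _ (pr Q (~` F N))); last by rewrite prC//; lra.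
  have mnb : measurable [set w | ~ ball 0 L (Gv w + t *: v)].
    have := measurableC (mo (t *: v) _ (ball_open (0 : 'cV[R]_p) L)).
    by congr (measurable _).
  apply: pr_le => //; first exact: measurableC.
  move=> w /= nb Fw; apply: nb; move: Fw.
  rewrite /F /= mx_norm_ball /ball_/= !sub0r !normrN => Fw.
  rewrite (le_lt_trans (ler_normD _ _))// normrZ.
  have : `|t| * `|v| <= `|v| by rewrite ler_piMl.
  by rewrite /L; lra.
have : expR (L * (`|t| * S)) * pr Q [set w | E (Gv w)] <= (1 + eps / 2) * pr Q [set w | E (Gv w)].
  exact: ler_wpM2r.
nra.
Qed.

End gaussian_shift.

Section gaussian_boundary.
Context {d : measure_display} {U : measurableType d} {R : realType} {p : nat}.
Variables (Q : probability U R) (Z : U -> 'cV[R]_p) (m : 'cV[R]_p) (S : 'M[R]_p).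
Hypothesis gZ : gaussian_vector Q Z m S.
Hypothesis uS : S \in unitmx.

Lemma gaussian_measurable j : measurable_fun setT (fun w => Z w j 0).
Proof.
have [A [G [_ _ _ ZE]]] := gZ.
under eq_fun do rewrite ZE !mxE.
apply: measurable_funD => //; apply: measurable_sum => i.
by under eq_fun do rewrite mxE; apply: measurable_funM.
Qed.

(** With [Z = m + A G] and [A] invertible, moving [Z] by [v] amounts to moving
    [G] by [A^-1 v]. *)
Lemma gaussian_shift (v : 'cV[R]_p) (eps : R) : 0 < eps ->
  exists2 t0 : R, 0 < t0 & forall t : R, `|t| <= t0 -> forall E : set 'cV[R]_p, open E ->
    pr Q [set w | E (Z w + t *: v)] <= pr Q [set w | E (Z w)] + eps.
Proof.
have [A [G [AS indG lawG ZE]]] := gZ.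
have uA : A \in unitmx.
  by move: uS; rewrite -AS unitmxE det_mulmx det_tr unitrM => /andP[].
move=> e0; have [t0 t00 H] := gauss_shift indG lawG (invmx A *m v) e0.
exists t0 => // t tt0 E oE.
have := H t tt0 _ (@affine_continuous _ _ _ m A E oE).
congr (pr Q _ <= pr Q _ + _); apply/seteqP; split => w /=; rewrite ZE.
- by rewrite mulmxDr -scalemxAr mulKVmx// addrA.
- by rewrite mulmxDr -scalemxAr mulKVmx// addrA.
- by [].
- by [].
Qed.

Let mo E : open E -> measurable [set w | E (Z w)].
Proof. by move=> oE; apply: (measurable_open_preimage gaussian_measurable oE). Qed.

Lemma open_coord_itv (j : 'I_p) (a b : R) : open [set z : 'cV[R]_p | a < z j 0 < b].
Proof.
have -> : [set z : 'cV[R]_p | a < z j 0 < b] = (fun z : 'cV[R]_p => z j 0) @^-1` `]a, b[%classic.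
  by apply/seteqP; split => z /=; rewrite in_itv.
by apply: open_comp => [z _|]; [exact: coord_continuous|exact: itv_open].
Qed.

Let mitv (j : 'I_p) (a b : R) : measurable [set w | a < Z w j 0 < b].
Proof.
have -> : [set w | a < Z w j 0 < b] = setT `&` (fun w => Z w j 0) @^-1` `]a, b[%classic.
  by apply/seteqP; split => w /=; rewrite in_itv/=; [|case].
by apply: (gaussian_measurable j measurableT); exact: measurable_itv.
Qed.

Lemma measurable_coord_eq0 (j : 'I_p) : measurable [set w | Z w j 0 = 0].
Proof.
have -> : [set w | Z w j 0 = 0] = setT `&` (fun w => Z w j 0) @^-1` [set 0].
  by apply/seteqP; split => w //=; case.
by apply: (gaussian_measurable j measurableT); exact: measurable_set1.
Qed.

(** If the hyperplane had mass, then so would its translate within a thin slab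
    next to it; but the mass of [{0 < z_j < 1/n}] tends to 0. *)
Lemma gaussian_coord_null j : pr Q [set w | Z w j 0 = 0] = 0.
Proof.
apply/eqP; rewrite eq_le pr_ge0 andbT; apply/ler_addgt0Pr => eps e0; rewrite add0r.
have e20 : 0 < eps / 2 by rewrite divr_gt0.
have [t0 t00 H] := gaussian_shift (delta_mx j 0) e20.
pose F n := ~` [set w | 0 < Z w j 0 < n.+1%:R^-1].
have mF n : measurable (F n) by apply: measurableC; exact: mitv.
have incF n : F n `<=` F n.+1.
  move=> w; apply: contra_not => /= /andP[-> /lt_le_trans]; apply.
  by rewrite lef_pV2 ?posrE// ler_nat.
have [N] := pr_bigcup_approx Q mF incF e20.
have -> : \bigcup_n F n = setT.
  apply/seteqP; split => // w _.
  have [z0|z0] := leP (Z w j 0) 0.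
    by exists 0%N => //; rewrite /F /= ltNge z0.
  exists (Num.truncn (Z w j 0)^-1) => //; rewrite /F /= => /andP[_].
  rewrite ltNge => /negP; apply.
  by rewrite invf_ple ?posrE// ltW// truncnS_gt.
have -> : pr Q setT = 1 by rewrite /pr probability_setT.
rewrite prC; last by exact: mitv.
move=> FN; pose t := Num.min t0 (N.+1%:R^-1 / 2).
have t0' : 0 < t by rewrite lt_min t00 divr_gt0.
have tN : t <= N.+1%:R^-1 / 2 by rewrite ge_min lexx orbT.
have oE := @open_coord_itv j (t / 2) (3 * t / 2).
have := H t _ _ oE; rewrite gtr0_norm// ge_min lexx => /(_ isT).
have : pr Q [set w | Z w j 0 = 0] <=
    pr Q [set w | [set z : 'cV[R]_p | t / 2 < z j 0 < 3 * t / 2] (Z w + t *: delta_mx j 0)].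
  apply: pr_le.
  - exact: measurable_coord_eq0.
  - have -> : [set w | [set z : 'cV[R]_p | t / 2 < z j 0 < 3 * t / 2] (Z w + t *: delta_mx j 0)] =
      [set w | [set z : 'cV[R]_p | - t / 2 < z j 0 < t / 2] (Z w)].
      apply/seteqP; split => w; rewrite /= !mxE !eqxx/= mulr1 => /andP[z1 z2];
        by apply/andP; split; lra.
    exact: mitv.
  - by move=> w /= z0; rewrite !mxE !eqxx z0/=; apply/andP; split; lra.
have : pr Q [set w | [set z : 'cV[R]_p | t / 2 < z j 0 < 3 * t / 2] (Z w)] <=
    pr Q [set w | 0 < Z w j 0 < N.+1%:R^-1].
  apply: pr_le; [exact: (mitv j (t / 2) (3 * t / 2))|exact: mitv|].
  move=> w /=; move: tN t0' {FN}; move: (t) (N.+1%:R^-1 : R) => t' a tN t0' /andP[z1 z2].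
  by apply/andP; split; lra.
lra.
Qed.

End gaussian_boundary.

(** * The boundary of a set that satisfies Condition A *)

(** Finite intersections of open half-spaces are open. *)
Lemma near_halfspaces {R : realType} {p q : nat} (A : 'M[R]_(q, p)) (c b : 'I_q -> R)
    (z : 'cV[R]_p) : (forall j, c j * (A *m z) j 0 < b j) ->
  \forall y \near z, forall j, c j * (A *m y) j 0 < b j.
Proof.
move=> zb; have FF : Filter (nbhs z) by exact: nbhs_filter.
pose H j (y : 'cV[R]_p) := c j * (A *m y) j 0 < b j.
suff Hz j : \forall y \near z, H j y by exact: (@filter_forall _ _ H _ FF Hz).
have cvk k : A j k * y k 0 @[y --> z] --> A j k * z k 0.
  by apply: cvgMr; exact: coord_continuous.
have cv : c j * (A *m y) j 0 @[y --> z] --> c j * (A *m z) j 0.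
  apply: cvgMr; rewrite mxE.
  have -> : (fun y : 'cV[R]_p => (A *m y) j 0) = (fun y : 'cV[R]_p => \sum_k A j k * y k 0).
    by apply/funext => y; rewrite mxE.
  exact: (@cvg_sumr _ _ _ _ _ _ _ _ _ (fun k _ => cvk k)).
exact: cvgr_lt cv _ (zb j).
Qed.

(** Moving by [invmx C *m d] raises every [d_j (C z)_j], so a short move in
    this direction takes a limit of points [m] of [M] into the interior of the
    set [A^d(m)] of one of these points. *)
Lemma conditionA_interior {R : realType} {p : nat} (C : 'M[R]_p) (M : set 'cV[R]_p)
    (s : {ffun 'I_p -> bool}) (z : 'cV[R]_p) (t : R) :
  C \in unitmx -> conditionA C M -> closure M z -> 0 < t ->
  let z' := z + t *: (invmx C *m sign_vector R s) in
  (forall j, (-1) ^+ s j * z' j 0 < 0) -> interior M z'.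
Proof.
move=> uC cA clz t0 z' z'0.
have sC j : (-1) ^+ s j * (C *m z') j 0 = (-1) ^+ s j * (C *m z) j 0 + t.
  have -> : C *m z' = C *m z + t *: sign_vector R s.
    by rewrite mulmxDr -scalemxAr mulKVmx.
  by rewrite !mxE mulrDr mulrCA -expr2 sqrr_sign mulr1.
have FF : Filter (nbhs z') by exact: nbhs_filter.
have nz : \forall y \near z, forall j, (-1) ^+ s j * (C *m y) j 0 < (-1) ^+ s j * (C *m z) j 0 + t / 2.
  by apply: near_halfspaces => j; rewrite ltrDl divr_gt0.
have [m [Mm zm]] := clz _ nz.
have nz' : \forall y \near z', forall j, - (-1) ^+ s j * (C *m y) j 0 < - ((-1) ^+ s j * (C *m z) j 0 + t / 2).
  by apply: near_halfspaces => j; rewrite mulNr sC ltrN2 ltrD2l ltr_pdivrMr// mulr_natr mulr2n ltrDl.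
have nz'' : \forall y \near z', forall j, (-1) ^+ s j * (1%:M *m y) j 0 < 0.
  by apply: near_halfspaces => j; rewrite mul1mx.
apply: filterS (filterI nz' nz'') => y /= [y1 y2]; apply: (cA s m Mm) => j _ /=.
rewrite /sign_vector mxE; split; last by have := y2 j; rewrite mul1mx => /ltW.
have := y1 j; rewrite mulNr ltrN2 => /ltW/(le_trans _); apply; exact/ltW/zm.
Qed.

(** The coordinate hyperplanes have no mass. In each open orthant the points of
    the closure that keep some distance from the hyperplanes move into the
    interior, inside the same orthant, under a small multiple of [C^-1 d]. *)
Lemma gaussian_closure_le {d : measure_display} {U : measurableType d} {R : realType} {p : nat}
    (Q : probability U R) (Z : U -> 'cV[R]_p) (m : 'cV[R]_p) (S C : 'M[R]_p)
    (M : set 'cV[R]_p) :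
  gaussian_vector Q Z m S -> S \in unitmx -> C \in unitmx -> conditionA C M ->
  pr Q [set w | closure M (Z w)] <= pr Q [set w | interior M (Z w)].
Proof.
move=> gZ uS uC cA.
pose O (b : R) (s : {ffun 'I_p -> bool}) := [set z : 'cV[R]_p | forall j, (-1) ^+ s j * (1%:M *m z) j 0 < b].
have OE b s z : O b s z = forall j, (-1) ^+ s j * z j 0 < b by rewrite /O/= mul1mx.
have oO b s : open (O b s) by rewrite openE => z; exact: near_halfspaces.
have mo E : open E -> measurable [set w | E (Z w)].
  by move=> oE; apply: (measurable_open_preimage (gaussian_measurable gZ) oE).
have mcl : measurable [set w | closure M (Z w)].
  have := measurableC (mo _ (closed_openC (@closed_closure _ M))).
  by congr (measurable _); apply/seteqP; split => w /=; [exact: contrapT|move=> ? ?].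
have mcO b s : measurable [set w | (closure M `&` O b s) (Z w)].
  exact: (measurableI _ _ mcl (mo _ (oO b s))).
have oiO s : open (interior M `&` O 0 s) by apply: openI => //; exact: open_interior.
have orth s : pr Q [set w | (closure M `&` O 0 s) (Z w)] <=
    pr Q [set w | (interior M `&` O 0 s) (Z w)].
  apply/ler_addgt0Pr => eps e0; have e20 : 0 < eps / 2 by rewrite divr_gt0.
  pose F n := [set w | (closure M `&` O (- n.+1%:R^-1) s) (Z w)].
  have incF n : F n `<=` F n.+1.
    move=> w [clw]; rewrite OE => Ow; split => //; rewrite OE => j.
    by rewrite (lt_le_trans (Ow j))// lerN2 lef_pV2 ?posrE// ler_nat.
  have [N] := pr_bigcup_approx Q (fun n => mcO _ s) incF e20.
  have -> : \bigcup_n F n = [set w | (closure M `&` O 0 s) (Z w)].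
    apply/seteqP; split => w.
      by case=> n _ [clw]; rewrite OE => Ow; split => //; rewrite OE => j; rewrite (lt_trans (Ow j))// oppr_lt0.
    case=> clw; rewrite OE => Ow.
    have n0 : 0 < \sum_j (- ((-1) ^+ s j * Z w j 0))^-1 + 1.
      by rewrite ltr_wpDl// sumr_ge0// => j _; rewrite invr_ge0 oppr_ge0 ltW.
    exists (Num.truncn (\sum_j (- ((-1) ^+ s j * Z w j 0))^-1)) => //; split => //; rewrite OE => j.
    rewrite ltrNr invf_plt ?posrE ?oppr_gt0//.
    apply: (le_lt_trans _ (truncnS_gt _)); rewrite (bigD1 j)//= lerDl.
    by rewrite sumr_ge0// => i _; rewrite invr_ge0 oppr_ge0 ltW.
  move=> FN; pose v := invmx C *m sign_vector R s.
  have [t0 t00 H] := gaussian_shift gZ uS v e20.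
  pose t := Num.min t0 (N.+1%:R^-1 / (`|v| + 1)).
  have v10 : 0 < `|v| + 1 by rewrite ltr_wpDl.
  have t1 : 0 < t by rewrite lt_min t00 divr_gt0.
  have tt0 : t <= t0 by rewrite ge_min lexx.
  have tv : t * `|v| <= N.+1%:R^-1.
    have : t <= N.+1%:R^-1 / (`|v| + 1) by rewrite ge_min lexx orbT.
    rewrite ler_pdivlMr// => /(le_trans _); apply.
    by rewrite ler_pM2l// lerDl.
  have mE : measurable [set w | (interior M `&` O 0 s) (Z w + t *: v)].
    apply: (@measurable_open_preimage _ _ _ _ (fun w => Z w + t *: v) _ _ (oiO s)) => j.
    under eq_fun do rewrite mxE.
    by apply: measurable_funD => //; exact: (gaussian_measurable gZ).
  have sub : pr Q (F N) <= pr Q [set w | (interior M `&` O 0 s) (Z w + t *: v)].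
    apply: pr_le; [exact: mcO|exact: mE|move=> w [clw]; rewrite OE => Ow].
    have z'0 j : (-1) ^+ s j * (Z w + t *: v) j 0 < 0.
      have -> : (Z w + t *: v) j 0 = Z w j 0 + t * v j 0 by rewrite !mxE.
      rewrite mulrDr -ltrBrDr sub0r (lt_le_trans (Ow j))// lerN2.
      have //: (-1) ^+ s j * (t * v j 0) <= N.+1%:R^-1.
        rewrite (le_trans (ler_norm _))// normrM normr_sign mul1r normrM gtr0_norm//.
        by rewrite (le_trans _ tv)// ler_pM2l//; exact: mxnorm_entry.
    by split; [exact: conditionA_interior|rewrite OE].
  have := H t _ _ (oiO s); rewrite gtr0_norm// => /(_ tt0).
  lra.
have mlo s : measurable [set w | (interior M `&` O 0 s) (Z w)] by exact: mo.
apply: (@le_trans _ _ (\sum_s pr Q [set w | (interior M `&` O 0 s) (Z w)])); last first.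
  rewrite -pr_finU//.
    apply: pr_le; last by move=> w [s _ []].
      by apply: fin_bigcup_measurable => // ; exact: finite_finset.
    exact/mo/open_interior.
  move=> s s' _ _ [w [[_ +] [_ +]]]; rewrite !OE => w1 w2.
  apply/ffunP => j; have := w1 j; have := w2 j.
  by case: (s j); case: (s' j) => //=; rewrite ?expr1 ?expr0 ?mulN1r ?mul1r ?oppr_lt0; lra.
apply: (@le_trans _ _ (pr Q (\bigcup_(s in [set: {ffun 'I_p -> bool}]) [set w | (closure M `&` O 0 s) (Z w)]) +
   pr Q (\bigcup_(j in [set: 'I_p]) [set w | Z w j 0 = 0]))).
  apply: (le_trans _ (prU_le _ _ _)); last first.
  - by apply: fin_bigcup_measurable => [|j _]; [exact: finite_finset|exact: (measurable_coord_eq0 gZ)].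
  - by apply: fin_bigcup_measurable => [|j _]; [exact: finite_finset|exact: mcO].
  apply: pr_le => //.
    apply: measurableU.
    + by apply: fin_bigcup_measurable => [|j _]; [exact: finite_finset|exact: mcO].
    + by apply: fin_bigcup_measurable => [|j _]; [exact: finite_finset|exact: (measurable_coord_eq0 gZ)].
  move=> w clw; have [/existsP[j /eqP j0]|/existsPn n0] := boolP [exists j, Z w j 0 == 0].
    by right; exists j.
  left; exists [ffun j => 0 < Z w j 0] => //; split => //; rewrite OE => j; rewrite ffunE.
  have [Zj|Zj|Zj] := ltgtP 0 (Z w j 0); last by have := n0 j; rewrite -Zj eqxx.
    by rewrite expr1 mulN1r oppr_lt0.
  by rewrite expr0 mul1r.
rewrite -[leRHS]addr0 lerD//.
  apply: (le_trans (pr_finU_le _ _)) => [s|]; first exact: mcO.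
  by apply: ler_sum => s _; exact: orth.
apply: (le_trans (pr_finU_le _ _)) => [j|]; first exact: (measurable_coord_eq0 gZ).
by rewrite big1// => j _; exact: (gaussian_coord_null gZ uS).
Qed.

(** * Trigonometric approximation and the portmanteau theorem *)

Section trig_polynomials.
Context {R : realType} {p : nat}.
Implicit Types f g : 'cV[R]_p -> R.

(** The phase [b] accounts for the sines. *)
Inductive trig_poly : ('cV[R]_p -> R) -> Prop :=
| trig_poly_cos c t b : trig_poly (fun x => c * cos (dot t x + b))
| trig_polyD f g : trig_poly f -> trig_poly g -> trig_poly (fun x => f x + g x).

Lemma trig_poly_cst c : trig_poly (fun=> c).
Proof.
rewrite (_ : (fun=> c) = (fun x => c * cos (dot 0 x + 0))); first exact: trig_poly_cos.
by apply/funext => x; rewrite -(scale0r (0 : 'cV[R]_p)) dotZl mul0r addr0 cos0 mulr1.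
Qed.

Lemma trig_polyM f g : trig_poly f -> trig_poly g -> trig_poly (fun x => f x * g x).
Proof.
move=> tf; elim: tf g => {f} [c t b|f f' _ IHf _ IHf'] g tg; last first.
  rewrite (_ : (fun x => _) = (fun x => f x * g x + f' x * g x)); last first.
    by apply/funext => x; rewrite mulrDl.
  by apply: trig_polyD; [exact: IHf|exact: IHf'].
elim: tg => {g} [c' t' b'|g g' _ IHg _ IHg']; last first.
  rewrite (_ : (fun x => _) = (fun x => c * cos (dot t x + b) * g x +
                                       c * cos (dot t x + b) * g' x)); last first.
    by apply/funext => x; rewrite mulrDr.
  exact: trig_polyD.
rewrite (_ : (fun x => _) = (fun x => (c * c' / 2) * cos (dot (t + t') x + (b + b')) +
                                     (c * c' / 2) * cos (dot (t - t') x + (b - b')))).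
  by apply: trig_polyD; exact: trig_poly_cos.
apply/funext => x; rewrite dotDl dotBl addrACA.
have -> : dot t x - dot t' x + (b - b') = (dot t x + b) - (dot t' x + b') by ring.
move: (dot t x + b) (dot t' x + b') => y y'.
by rewrite !cosD cosN sinN; field.
Qed.

Lemma trig_polyB f g : trig_poly f -> trig_poly g -> trig_poly (fun x => f x - g x).
Proof.
move=> tf tg; apply: trig_polyD => //.
rewrite (_ : (fun x => _) = (fun x => -1 * g x)); last by apply/funext => x; rewrite mulN1r.
by apply: trig_polyM => //; exact: trig_poly_cst.
Qed.

Lemma trig_poly_prod (I : Type) (s : seq I) (Q : pred I) (f : I -> 'cV[R]_p -> R) :
  (forall i, trig_poly (f i)) -> trig_poly (fun x => \prod_(i <- s | Q i) f i x).
Proof.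
move=> tf; elim: s => [|i s IH].
  under [X in trig_poly X]funext do rewrite big_nil; exact: trig_poly_cst.
under [X in trig_poly X]funext do rewrite big_cons.
by case: (Q i) => //; apply: trig_polyM.
Qed.

Lemma trig_polyX f n : trig_poly f -> trig_poly (fun x => f x ^+ n).
Proof.
move=> tf; elim: n => [|n IH]; first exact: trig_poly_cst.
by under [X in trig_poly X]funext do rewrite exprS; exact: trig_polyM.
Qed.

End trig_polynomials.

Section bump.
Context {R : realType}.
Implicit Types x y eta : R.

Lemma bernoulli_ge x m : 0 <= x <= 1 -> 1 - m%:R * x <= (1 - x) ^+ m.
Proof.
move=> /andP[x0 x1]; elim: m => [|m IH]; first by rewrite mul0r subr0.
rewrite exprS -natr1; have : (1 - x) * (1 - m%:R * x) <= (1 - x) * (1 - x) ^+ m.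
  by rewrite ler_wpM2l// subr_ge0.
apply: le_trans; have : 0 <= m%:R * (x * x) by rewrite !mulr_ge0.
by move: (m%:R : R) => M h; nra.
Qed.

Lemma bernoulli_le x m : 0 <= x <= 1 -> (1 - x) ^+ m * (1 + m%:R * x) <= 1.
Proof.
move=> /andP[x0 x1]; elim: m => [|m IH]; first by rewrite mul0r addr0 mulr1.
rewrite exprSr -natr1 (le_trans _ IH)// -mulrA ler_wpM2l ?exprn_ge0 ?subr_ge0//.
have : 0 <= m%:R * (x * x) by rewrite !mulr_ge0.
have : 0 <= x * x by rewrite mulr_ge0.
by move: (m%:R : R) => M h h'; nra.
Qed.

(** The polynomial [(1 - x^n)^m] imitates a step between [x1] and [x2] when
    [m] is about [x2^-n / eta], because [(x1 / x2)^n] is small. *)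
Lemma polynomial_step x1 x2 eta : 0 <= x1 < x2 -> x2 <= 1 -> 0 < eta <= 1 ->
  exists n m, (forall x, 0 <= x <= x1 -> 1 - eta <= (1 - x ^+ n) ^+ m) /\
    (forall x, x2 <= x <= 1 -> (1 - x ^+ n) ^+ m <= eta).
Proof.
move=> /andP[x10 x12] x21 /andP[e0 e1].
have x20 : 0 < x2 by exact: le_lt_trans x12.
have q1 : `|x1 / x2| < 1 by rewrite ger0_norm ?divr_ge0 ?(ltW x20)// ltr_pdivrMr// mul1r.
have e2 : 0 < eta ^+ 2 / 2 by rewrite divr_gt0// exprn_gt0.
have /cvgr0_norm_le/(_ _ e2)[n _ /(_ n (leqnn n))] /= := cvg_expr q1.
rewrite ger0_norm ?exprn_ge0 ?divr_ge0 ?(ltW x20)// expr_div_n => qn.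
have xn0 : 0 < x2 ^+ n by exact: exprn_gt0.
have xn1 : x2 ^+ n <= 1 by rewrite exprn_ile1// ltW.
have d0 : 0 < eta * x2 ^+ n by rewrite mulr_gt0.
pose m := (Num.truncn (eta * x2 ^+ n)^-1).+1.
have m1 : (eta * x2 ^+ n)^-1 <= m%:R by apply/ltW/truncnS_gt.
have m2 : m%:R <= (eta * x2 ^+ n)^-1 + 1.
  by rewrite -natr1 lerD2r truncn_le// invr_ge0 ltW.
exists n, m; split => x /andP[xl xr].
  have x01 : 0 <= x <= 1 by rewrite xl (le_trans xr)// ltW// (lt_le_trans x12).
  have xn : 0 <= x ^+ n <= 1 by rewrite exprn_ge0// exprn_ile1//; case/andP: x01.
  apply: le_trans (bernoulli_ge m xn); rewrite lerD2l lerN2.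
  have xx1 : x ^+ n <= x1 ^+ n by apply: lerXn2r => //; rewrite ?nnegrE.
  rewrite (@le_trans _ _ (m%:R * x1 ^+ n))// ?ler_wpM2l//.
  rewrite (@le_trans _ _ (2 * (eta * x2 ^+ n)^-1 * x1 ^+ n))//.
    rewrite ler_wpM2r ?exprn_ge0// (le_trans m2)// mulr_natl mulr2n lerD2l.
    by rewrite invf_ge1// mulr_ile1// ltW.
  move: qn; rewrite ler_pdivrMr// => qn.
  have -> : 2 * (eta * x2 ^+ n)^-1 * x1 ^+ n = 2 * x1 ^+ n / (eta * x2 ^+ n) by rewrite mulrAC.
  rewrite ler_pdivrMr//; nra.
have x01 : 0 <= x <= 1 by rewrite xr (le_trans _ xl)// ltW.
have xn : 0 <= x ^+ n <= 1 by case/andP: x01 => ? ?; rewrite exprn_ge0// exprn_ile1.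
have B := bernoulli_le m xn.
have xx2 : x2 ^+ n <= x ^+ n by apply: lerXn2r => //; rewrite ?nnegrE ?(ltW x20)//; case/andP: x01.
have A0 : 0 <= (1 - x ^+ n) ^+ m by rewrite exprn_ge0// subr_ge0; case/andP: xn.
have h : eta^-1 <= 1 + m%:R * x ^+ n.
  have : m%:R * x2 ^+ n <= m%:R * x ^+ n by rewrite ler_wpM2l.
  have : eta^-1 <= m%:R * x2 ^+ n.
    by move: m1; rewrite invfM ler_pdivrMr.
  by move=> h1 h2; rewrite (le_trans h1)// (le_trans h2)// lerDr.
have := le_trans (ler_wpM2l A0 h) B.
by rewrite ler_pdivrMr// mul1r.
Qed.

(** A trigonometric bump: close to [1] on [[-r, r]] and to [0] on the two sides
    up to [2 * L]. Being periodic, it comes back to [1] further out. *)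
Lemma trig_bump (r L eta : R) : 0 < r <= L -> 0 < eta <= 1 ->
  exists q : R -> R, [/\ forall y, 0 <= q y <= 1,
    forall y, `|y| <= r -> 1 - eta <= q y,
    forall y, 2 * r <= `|y| <= 2 * L -> q y <= eta &
    forall (p : nat) (j : 'I_p) c, trig_poly (fun z : 'cV[R]_p => q (z j 0 - c))].
Proof.
move=> /andP[r0 rL] eta01; have L0 : 0 < L by exact: lt_le_trans rL.
(* [(1 - cos (v y)) / 2] increases with [`|y|] up to [2 L]; a polynomial step
   between its values at [r] and [2 r] is applied to it *)
pose v : R := pi / (2 * L); have pi0 : 0 < pi :> R := pi_gt0 R.
have v0 : 0 < v by rewrite divr_gt0// mulr_gt0.
have vL : v * (2 * L) = pi by rewrite divfK// gt_eqF// mulr_gt0.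
pose h y := (1 - cos y) / 2.
have h01 y : 0 <= h y <= 1.
  have := cos_geN1 y; have := cos_le1 y; rewrite /h => ? ?; apply/andP; split; lra.
have hmono y y' : 0 <= y -> y <= y' -> y' <= pi -> h y <= h y'.
  move=> y0 yy' y'pi; rewrite /h ler_pM2r ?invr_gt0// lerD2l lerN2.
  move: yy'; rewrite le_eqVlt => /predU1P[->//|yy'].
  by rewrite ltW// ltr_cos ?in_itv/= ?y0 ?y'pi ?(le_trans (ltW yy'))// (le_trans y0)// ltW.
have hlt : h (v * r) < h (v * (2 * r)).
  have a1 : 0 <= v * r by rewrite mulr_ge0// ltW.
  have a2 : v * r < v * (2 * r) by rewrite ltr_pM2l//; lra.
  have a3 : v * (2 * r) <= pi by rewrite -vL ler_pM2l//; lra.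
  rewrite /h ltr_pM2r ?invr_gt0// ltrD2l ltrN2 ltr_cos ?in_itv/= ?a1 ?a3//.
    by rewrite (le_trans _ a3)// ltW.
  by rewrite (le_trans a1)// ltW.
have [n [m [H1 H2]]] := polynomial_step (x1 := h (v * r)) (x2 := h (v * (2 * r)))
  (eta := eta) ltac:(by rewrite hlt andbT; case/andP: (h01 (v * r)))
  ltac:(by case/andP: (h01 (v * (2 * r)))) eta01.
have hnorm y : h (v * y) = h (v * `|y|).
  by rewrite /h -cos_norm normrM gtr0_norm.
exists (fun y => (1 - h (v * y) ^+ n) ^+ m); split => [y|y yr|y /andP[yr yL]|p j c].
- have /andP[h0 h1] := h01 (v * y).
  have hn1 : h (v * y) ^+ n <= 1 by exact: exprn_ile1.
  have hn0 : 0 <= h (v * y) ^+ n by exact: exprn_ge0.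
  by rewrite exprn_ge0 ?subr_ge0// exprn_ile1 ?subr_ge0// gerBl.
- apply: H1; case/andP: (h01 (v * y)) => -> _ /=; rewrite (hnorm y); apply: hmono.
  + by rewrite mulr_ge0// ltW.
  + by rewrite ler_pM2l.
  + by rewrite -vL ler_pM2l//; lra.
- apply: H2; case/andP: (h01 (v * y)) => _ ->; rewrite andbT (hnorm y); apply: hmono.
  + by rewrite mulr_ge0 ?(ltW v0)// mulr_ge0 ?ltW.
  + by rewrite ler_pM2l.
  + by rewrite -vL ler_pM2l.
apply: trig_polyX; apply: trig_polyB; first exact: trig_poly_cst.
apply: trig_polyX; rewrite /h.
rewrite (_ : (fun z : 'cV[R]_p => _) = (fun z : 'cV[R]_p =>
    2^-1 - 2^-1 * cos (dot (v *: delta_mx j 0) z + (- v * c)))).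
  by apply: trig_polyB; [exact: trig_poly_cst|exact: trig_poly_cos].
apply/funext => z; have -> : dot (v *: delta_mx j 0) z = v * z j 0.
  rewrite dotZl /dot (bigD1 j)//= big1 => [|i ij]; first by rewrite mxE !eqxx mul1r addr0.
  by rewrite mxE (negbTE ij)/= mul0r.
by rewrite mulrBr mulNr; field.
Qed.

End bump.

Section products.
Context {R : realType}.

Lemma one_minus_prod_le (I : Type) (s : seq I) (Q : pred I) (a : I -> R) :
  (forall i, 0 <= a i <= 1) ->
  1 - \prod_(i <- s | Q i) a i <= \sum_(i <- s | Q i) (1 - a i).
Proof.
move=> a01; suff: 1 - \prod_(i <- s | Q i) a i <= \sum_(i <- s | Q i) (1 - a i) /\
    0 <= \prod_(i <- s | Q i) a i <= 1 by case.
elim: s => [|i s [IH /andP[p0 p1]]]; first by rewrite !big_nil subrr; split; rewrite ?ler01 ?lexx.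
rewrite !big_cons; case: (Q i); last by rewrite p0.
have /andP[i0 i1] := a01 i; split; first nra.
by rewrite mulr_ge0//= mulr_ile1.
Qed.

Lemma prod01 (I : Type) (s : seq I) (Q : pred I) (a : I -> R) :
  (forall i, 0 <= a i <= 1) -> 0 <= \prod_(i <- s | Q i) a i <= 1.
Proof.
move=> a01; elim: s => [|i s /andP[p0 p1]]; first by rewrite big_nil lexx ler01.
rewrite big_cons; case: (Q i); last by rewrite p0.
by have /andP[i0 i1] := a01 i; rewrite mulr_ge0//= mulr_ile1.
Qed.

Lemma prod_le_factor (I : finType) (Q : pred I) (a : I -> R) (i : I) :
  (forall i, 0 <= a i <= 1) -> Q i -> \prod_(i | Q i) a i <= a i.
Proof.
move=> a01 Qi; rewrite (bigD1 i)//= ler_piMr//; first by case/andP: (a01 i).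
by case/andP: (prod01 (index_enum I) (fun j => Q j && (j != i)) a01).
Qed.

End products.

(** A trigonometric polynomial that separates the grid approximation of an open
    set from its complement within a large cube: one minus the probability
    that all the bumps around the good cells fail, were they independent. *)
Lemma trig_urysohn {R : realType} {p : nat} (E : set 'cV[R]_p) (N : nat) (L eps : R) :
  0 < eps ->
  exists f : 'cV[R]_p -> R, [/\ trig_poly f, forall z : 'cV[R]_p, 0 <= f z <= 1,
    forall z : 'cV[R]_p, inner_grid N E z -> 1 - eps <= f z &
    forall z : 'cV[R]_p, (forall j, `|z j 0| <= L) -> ~ E z -> f z <= eps].
Proof.
move=> e0; pose r : R := 2 ^- N; have r0 : 0 < r by rewrite invr_gt0 exprn_gt0.
pose K : R := (#|{: @grid_index p N}| + p + 1)%:R.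
have K0 : 0 < K by rewrite ltr0n addn1.
pose eta : R := Num.min 1 (eps / K).
have eta0 : 0 < eta by rewrite lt_min ltr01 divr_gt0.
have eta1 : eta <= 1 by rewrite ge_min lexx.
have etaK : eta * K <= eps by rewrite -ler_pdivlMr// ge_min lexx orbT.
have etak (k : nat) : (k <= #|{: @grid_index p N}| + p)%N -> k%:R * eta <= eps.
  by move=> kK; rewrite (le_trans _ etaK)// mulrC ler_pM2l// ler_nat addn1 leqW.
(* the corners have coordinates of modulus at most [N], so distances to them
   within the cube stay below [2 L'] *)
pose L' : R := r + N%:R + `|L|.
have rL' : 0 < r <= L' by rewrite r0 /L' -addrA lerDl addr_ge0.
have [q [q01 q1 q2 tq]] := trig_bump rL' (introT andP (conj eta0 eta1)).
pose b (k : @grid_index p N) (z : 'cV[R]_p) := \prod_(j : 'I_p) q (z j 0 - grid_corner k j 0).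
have b01 k z : 0 <= b k z <= 1 by exact: prod01.
have b01' z k : 0 <= 1 - b k z <= 1.
  by have /andP[? ?] := b01 k z; rewrite subr_ge0 gerBl; apply/andP.
exists (fun z => 1 - \prod_(k : @grid_index p N | good_cell E k) (1 - b k z)); split.
- apply: trig_polyB; first exact: trig_poly_cst.
  apply: trig_poly_prod => k; apply: trig_polyB; first exact: trig_poly_cst.
  by apply: trig_poly_prod => j; exact: tq.
- move=> z; have /andP[? ?] := prod01 (index_enum _) (good_cell E) (b01' z).
  by rewrite subr_ge0 gerBl; apply/andP.
- move=> z [k kE kz]; rewrite lerD2l lerN2.
  apply: (le_trans (prod_le_factor (b01' z) kE)).
  apply: (le_trans (one_minus_prod_le _ _ (fun j => q01 _))).
  apply: (@le_trans _ _ (\sum_(j : 'I_p) eta)).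
    apply: ler_sum => j _; rewrite lerBlDr -lerBlDl; apply: q1.
    have /(mx_ballP _ _ r0)/(_ j 0) := grid_cell_ball kz.
    by rewrite distrC => /ltW.
  by rewrite sumr_const card_ord -mulr_natl etak// leq_addl.
move=> z zL nEz.
have bk k : good_cell E k -> b k z <= eta.
  move=> /asboolP kE; have : ~ (forall j, `|grid_corner k j 0 - z j 0| < 2 * r).
    move=> H; apply: nEz; apply: kE; apply/mx_ballP => [|i j]; first by rewrite mulr_gt0.
    have -> : j = 0 by exact: ord1.
    exact: H.
  move=> /existsNP[j /negP]; rewrite -leNgt distrC => zj.
  apply: (le_trans (prod_le_factor (Q := predT) (fun j => q01 _) (erefl true : predT j))).
  apply: q2; rewrite zj /= (le_trans (ler_normB _ _))//.
  have kN : `|grid_corner k j 0| <= N%:R :> R.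
    rewrite mxE ler_norml; have := ltn_ord (k j).
    have p2 : 0 < 2 ^+ N :> R by exact: exprn_gt0.
    rewrite -(ltr_nat R) natrM natrM natrX => kl.
    have : (k j)%:R / 2 ^+ N <= 2 * N%:R :> R by rewrite ler_pdivrMr// ltW.
    have : 0 <= (k j)%:R / 2 ^+ N :> R by rewrite divr_ge0// ltW.
    by move=> h1 h2; apply/andP; split; lra.
  have := zL j; have := ler_norm L; have := normr_ge0 L; rewrite /L'.
  have := ltW r0; have := normr_ge0 (@grid_corner R p N k j 0); move: kN; rewrite -/r.
  by move: (N%:R : R) `|L| `|z j 0| `|grid_corner k j 0| (r) => a1 a2 a3 a4 a5; lra.
apply: (le_trans (one_minus_prod_le _ _ (b01' z))).
apply: (@le_trans _ _ (\sum_(k : @grid_index p N | good_cell E k) eta)).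
  by apply: ler_sum => k kE; rewrite opprB addrCA subrr addr0 bk.
apply: (@le_trans _ _ (\sum_(k : @grid_index p N) eta)).
  by rewrite big_mkcond; apply: ler_sum => k _; case: ifP => // _; exact: ltW.
by rewrite sumr_const -[leLHS]mulr_natl etak// leq_addr.
Qed.

(** The lower half of the portmanteau theorem. Characteristic functions
    determine the limits of the expectations of trigonometric polynomials, and
    tightness makes up for the failure of these to vanish at infinity. *)
Lemma portmanteau_open {R : realType} {p : nat}
    (dT : nat -> measure_display) (T : forall n, measurableType (dT n))
    (P : forall n, probability (T n) R) (V : forall n, T n -> 'cV[R]_p)
    (dU : measure_display) (U : measurableType dU) (Q : probability U R)
    (Z : U -> 'cV[R]_p) :
  (forall n j, measurable_fun setT (fun w => V n w j 0)) ->
  (forall j, measurable_fun setT (fun w => Z w j 0)) ->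
  (forall t b, mean (P n) (fun w => cos (dot t (V n w) + b)) @[n --> \oo] -->
     mean Q (fun w => cos (dot t (Z w) + b))) ->
  (forall eps, 0 < eps -> exists L, \forall n \near \oo,
     pr (P n) [set w | exists j, L < `|V n w j 0|] <= eps) ->
  forall E eps, open E -> 0 < eps -> \forall n \near \oo,
    pr Q [set w | E (Z w)] <= pr (P n) [set w | E (V n w)] + eps.
Proof.
move=> mV mZ cvgV tightV E eps oE e0.
have e5 : 0 < eps / 5 by rewrite divr_gt0.
have [N EN] := inner_grid_approx mZ Q oE e5.
have [L tL] := tightV _ e5.
have [f [tf f01 f1 f0]] := trig_urysohn E N L e5.
have mdot (d' : measure_display) (T' : measurableType d') (Y : T' -> 'cV[R]_p) t :
    (forall j, measurable_fun setT (fun w => Y w j 0)) ->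
    measurable_fun setT (fun w => dot t (Y w)).
  move=> mY; rewrite /dot.
  by apply: measurable_sum => j; apply: measurable_funM.
have bf (d' : measure_display) (T' : measurableType d') (Y : T' -> 'cV[R]_p) g :
    (forall j, measurable_fun setT (fun w => Y w j 0)) -> trig_poly g ->
    bounded_measurable (fun w => g (Y w)).
  move=> mY; elim=> [c t b|g1 g2 _ IH1 _ IH2]; last exact: bmfD.
  by apply: bmfZ; apply: bmf_cos; apply: measurable_funD => //; exact: mdot.
have cvgf : mean (P n) (fun w => f (V n w)) @[n --> \oo] --> mean Q (fun w => f (Z w)).
  elim: tf => [c t b|g1 g2 t1 IH1 t2 IH2].
    have bc (d' : measure_display) (T' : measurableType d') (Y : T' -> 'cV[R]_p) :
        (forall j, measurable_fun setT (fun w => Y w j 0)) ->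
        bounded_measurable (fun w => cos (dot t (Y w) + b)).
      by move=> mY; apply: bmf_cos; apply: measurable_funD => //; exact: mdot.
    rewrite meanZ; last exact/bmf_integrable/bc.
    rewrite (_ : (fun n => _) = (fun n => c * mean (P n) (fun w => cos (dot t (V n w) + b)))).
      exact: cvgMr.
    by apply/funext => n; rewrite meanZ//; exact/bmf_integrable/bc.
  rewrite meanD; [|exact/bmf_integrable/bf..].
  rewrite (_ : (fun n => _) = (fun n => mean (P n) (fun w => g1 (V n w)) + mean (P n) (fun w => g2 (V n w)))).
    exact: cvgD.
  by apply/funext => n; rewrite meanD//; exact/bmf_integrable/bf.
have mE : measurable [set w | E (Z w)] by exact: (measurable_open_preimage mZ oE).
have mEn n : measurable [set w | E (V n w)] by exact: (measurable_open_preimage (mV n) oE).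
have mI : measurable (Z @^-1` inner_grid N E) by exact: measurable_inner_grid.
have lowZ : pr Q (Z @^-1` inner_grid N E) - eps / 5 <= mean Q (fun w => f (Z w)).
  rewrite pr_mean// -[X in _ - X](mean_cst Q) -meanB; [|exact/bmf_integrable/bmf_indic|exact/bmf_integrable/bmf_cst].
  apply: mean_le; [exact/bmf_integrable/bmfB/bmf_cst/bmf_indic|exact/bmf_integrable/bf|].
  move=> w; rewrite indicE; case: (boolP (w \in _)) => [|_]; first by rewrite inE => /f1.
  by rewrite sub0r (@le_trans _ _ 0)// ?oppr_le0 ?(ltW e5)//; case/andP: (f01 (Z w)).
have mL n : measurable [set w | exists j, L < `|V n w j 0|].
  rewrite (_ : [set w | _] = \bigcup_(j in [set: 'I_p]) (setT `&` (fun w => `|V n w j 0|) @^-1` `]L, +oo[)).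
    apply: fin_bigcup_measurable => [|j _]; first exact: finite_finset.
    have mn : measurable_fun setT (fun w => `|V n w j 0|) by apply: measurableT_comp.
    by apply: mn => //; exact: measurable_itv.
  apply/seteqP; split => w; first by case=> j jL; exists j => //; split => //=; rewrite in_itv/= jL.
  by case=> j _ [_] /=; rewrite in_itv/= andbT => jL; exists j.
have upV n : mean (P n) (fun w => f (V n w)) <= pr (P n) [set w | E (V n w)] +
    pr (P n) [set w | exists j, L < `|V n w j 0|] + eps / 5.
  rewrite !pr_mean// -[X in _ + X](mean_cst (P n)) -!meanD;
    try by apply: bmf_integrable; repeat first [exact: bmf_cst|exact: bmf_indic|apply: bmfD].
  apply: mean_le; [exact/bmf_integrable/bf|by apply/bmf_integrable/bmfD/bmf_cst/bmfD; exact: bmf_indic|].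
  move=> w; rewrite !indicE.
  have /andP[fw0 fw1] := f01 (V n w).
  case: (boolP (w \in _)) => /= [_|nE]; first by rewrite (le_trans fw1)// -addrA lerDl addr_ge0// ltW.
  case: (boolP (w \in _)) => /= [_|nL]; first by rewrite add0r (le_trans fw1)// lerDl ltW.
  rewrite !add0r f0//.
    move=> j; rewrite leNgt; apply/negP => jL; move: nL; rewrite notin_setE; apply.
    by exists j.
  by move: nE; rewrite notin_setE.
have cf : \forall n \near \oo, `|mean Q (fun w => f (Z w)) - mean (P n) (fun w => f (V n w))| <= eps / 5.
  by move/cvgrPdist_le : cvgf; apply.
have [n0 _ H] : \forall n \near \oo, `|mean Q (fun w => f (Z w)) - mean (P n) (fun w => f (V n w))| <= eps / 5 /\
   pr (P n) [set w | exists j, L < `|V n w j 0|] <= eps / 5.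
  exact: filterI cf tL.
exists n0 => // n /H[h1 h2].
have := upV n; have := ler_norm (mean Q (fun w => f (Z w)) - mean (P n) (fun w => f (V n w))).
move: EN lowZ h1 h2; rewrite -!/(pr _ _); lra.
Qed.

(** * Weighted sums of independent errors *)

Section moments.
Context {d : measure_display} {T : measurableType d} {R : realType}.
Variables (P : probability T R) (Y : {RV P >-> R}) (s2 : R).
Hypothesis EY : ('E_P[Y] = 0)%E.
Hypothesis VY : ('V_P[Y] = s2%:E)%E.

Let EY2 : (\int[P]_w (Y w ^+ 2)%:E = s2%:E)%E.
Proof.
rewrite -VY /variance unlock EY/= unlock; apply: eq_integral => w _.
by rewrite -[RHS]/(((Y w - 0) * (Y w - 0))%:E) subr0.
Qed.

Lemma centered_square_integrable : P.-integrable setT (EFin \o (fun w => Y w ^+ 2)).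
Proof.
apply/integrableP; split.
  by apply/measurable_EFinP; apply: measurable_funX.
under eq_integral => w _ do rewrite /= ger0_norm ?sqr_ge0//.
by rewrite EY2 ltry.
Qed.

Lemma centered_mean_square : mean P (fun w => Y w ^+ 2) = s2.
Proof. by rewrite /mean /Rintegral EY2. Qed.

Lemma centered_mean : mean P Y = 0.
Proof. by rewrite /mean /Rintegral -expectation_def EY. Qed.

End moments.

(** This transfers the computations from one error variable to all of them,
    whatever space they live on. *)
Lemma has_law_mean {d d'} {T : measurableType d} {T' : measurableType d'} {R : realType}
    (P : probability T R) (P' : probability T' R) (Y : {RV P >-> R}) (Y' : {RV P' >-> R})
    (mu : set R -> \bar R) (h : R -> R) :
  has_law Y mu -> has_law Y' mu -> bounded_measurable h ->
  mean P (fun w => h (Y w)) = mean P' (fun w => h (Y' w)).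
Proof.
move=> lawY lawY' bh; have mh := bh.1.
have mE : measurable_fun setT (EFin \o h) by apply/measurable_EFinP.
rewrite /mean /Rintegral; congr fine.
rewrite -[LHS](integral_distribution (P := P) (X := Y) mE); last first.
  by apply: bmf_integrable; apply: bmf_comp.
rewrite -[RHS](integral_distribution (P := P') (X := Y') mE); last first.
  by apply: bmf_integrable; apply: bmf_comp.
by apply: eq_measure_integral => A mA _; apply: (etrans (lawY A mA)); exact/esym/lawY'.
Qed.

Section weighted_sums.
Context {d : measure_display} {T : measurableType d} {R : realType}.
Variables (P : probability T R) (Y : {RV P >-> R}) (s2 : R) (mu : set R -> \bar R).
Hypothesis EY : ('E_P[Y] = 0)%E.
Hypothesis VY : ('V_P[Y] = s2%:E)%E.
Hypothesis lawY : has_law Y mu.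

(** The central limit theorem for triangular arrays [a_i e_i], with a rate that
    does not depend on the array; the law of the errors enters only through
    its common copy [Y]. *)
Lemma weighted_cos eta : 0 < eta ->
  exists2 delta : R, 0 < delta &
  forall (d' : measure_display) (T' : measurableType d') (P' : probability T' R)
    (n : nat) (e : 'I_n -> {RV P' >-> R}) (a : 'I_n -> R) (b : R),
  mutually_independent e -> (forall i, has_law (e i) mu) ->
  (forall i, `|a i| <= delta) ->
  `|mean P' (fun w => cos (\sum_i a i * e i w + b)) -
    expR (- (s2 * (\sum_i a i ^+ 2) / 2)) * cos b| <= eta * \sum_i a i ^+ 2.
Proof.
move=> eta0; have s20 : 0 <= s2.
  by rewrite -(centered_mean_square EY VY); apply: mean_ge0 => w; exact: sqr_ge0.
have [delta d0 H] := trig_mean_taylor (measurable_funPT Y)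
  (centered_square_integrable EY VY) (centered_mean EY) eta0.
exists delta => // d' T' P' n e a b inde lawe ad.
have mg i : measurable_fun setT (fun y : R => a i * y) by exact: measurable_funM.
pose rho i := expR (- (s2 * a i ^+ 2 / 2)).
have rho01 i : 0 <= rho i <= 1.
  rewrite expR_ge0/= -[leRHS]expR0 ler_expR oppr_le0.
  by rewrite divr_ge0// mulr_ge0// sqr_ge0.
have := cos_mean_approx inde mg b (index_enum_uniq 'I_n) rho01.
have -> : \prod_i rho i = expR (- (s2 * (\sum_i a i ^+ 2) / 2)).
  rewrite /rho -expR_sum; congr expR; rewrite sumrN; congr (- _).
  by rewrite mulr_sumr mulr_suml.
move=> /le_trans; apply.
rewrite mulr_sumr; apply: ler_sum => i _.
have bmfcs (k : R -> R) : k = cos \/ k = sin -> bounded_measurable (fun y => k (a i * y)).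
  by case=> ->; [exact: bmf_cos|exact: bmf_sin].
rewrite (has_law_mean (lawe i) lawY (bmfcs cos _)); last by left.
rewrite (has_law_mean (lawe i) lawY (bmfcs sin _)); last by right.
by have := H (a i) (ad i); rewrite (centered_mean_square EY VY).
Qed.

(** Near the origin [1 - cos (t S)] controls [t^2 S^2], so that the tail of a
    weighted sum can be read off its characteristic function. *)
Lemma weighted_tail (d' : measure_display) (T' : measurableType d') (P' : probability T' R)
    (n : nat) (e : 'I_n -> {RV P' >-> R}) (a : 'I_n -> R) (L : R) :
  mutually_independent e -> (forall i, has_law (e i) mu) -> 0 < L ->
  pr P' [set w | L < `|\sum_i a i * e i w| ] <= (2 * s2 + 4) * (\sum_i a i ^+ 2) / L ^+ 2.
Proof.
move=> inde lawe L0; pose S w := \sum_i a i * e i w.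
have [delta d0 H] := weighted_cos ltr01.
have mS : measurable_fun setT S.
  by apply: measurable_sum => i; apply: measurable_funM.
have mnS : measurable_fun setT (fun w => `|S w|) by exact: measurableT_comp.
pose V := \sum_i a i ^+ 2; have V0 : 0 <= V by apply: sumr_ge0 => i _; exact: sqr_ge0.
pose F (k : nat) := [set w | L < `|S w| <= k%:R].
have mF k : measurable (F k).
  have := mnS measurableT `]L, k%:R]%classic (measurable_itv _).
  by rewrite setTI; congr (measurable _); apply/seteqP; split => w; rewrite /F/= in_itv.
have incF k : F k `<=` F k.+1.
  by move=> w; rewrite /F /= => /andP[-> /le_trans]; apply; rewrite ler_nat.
suff FS k : pr P' (F k) <= (2 * s2 + 4) * V / L ^+ 2.
  apply/ler_addgt0Pr => eps e0; have [k] := pr_bigcup_approx P' mF incF e0.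
  have -> : \bigcup_k F k = [set w | L < `|S w|].
    apply/seteqP; split => w; first by case=> k' _ /= /andP[].
    move=> /= Lw; exists (Num.truncn `|S w|).+1 => //=.
    by rewrite /F/= Lw ltW// truncnS_gt.
  by move=> /le_trans; apply; rewrite lerD2r.
have A0 : 0 <= \sum_i `|a i| by apply: sumr_ge0.
(* so small that [u S] is at most 1/2 on the event [F k], and that the expansion
   applies to the weights [u a_i] *)
pose u : R := Num.min (2^-1 / (k%:R + 1)) (delta / (\sum_i `|a i| + 1)).
have k10 : 0 < k%:R + 1 :> R by rewrite ltr_wpDl.
have A10 : 0 < \sum_i `|a i| + 1 by rewrite ltr_wpDl.
have u0 : 0 < u by rewrite lt_min !divr_gt0.
have uk : u * k%:R <= 2^-1.
  have : u * (k%:R + 1) <= 2^-1 by rewrite -ler_pdivlMr// ge_min lexx.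
  by rewrite mulrDr mulr1; move: (ltW u0); lra.
have ua i : `|u * a i| <= delta.
  have : u * (\sum_i `|a i| + 1) <= delta by rewrite -ler_pdivlMr// ge_min lexx orbT.
  apply: le_trans; rewrite normrM gtr0_norm// ler_pM2l//.
  by rewrite (bigD1 i)//= -addrA lerDl addr_ge0// sumr_ge0.
have := H _ _ _ _ _ _ 0 inde lawe ua.
have -> : \sum_i (u * a i) ^+ 2 = u ^+ 2 * V.
  by rewrite /V mulr_sumr; apply: eq_bigr => i _; rewrite exprMn.
have -> : (fun w => cos (\sum_i u * a i * e i w + 0)) = (fun w => cos (u * S w)).
  apply/funext => w; rewrite addr0 mulr_sumr; congr cos.
  by apply: eq_bigr => i _; rewrite mulrA.
rewrite cos0 mulr1 mul1r ler_distl => /andP[Hl _].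
have bc : bounded_measurable (fun w => cos (u * S w)).
  by apply: bmf_cos; exact: measurable_funM.
have lowF : (u * L) ^+ 2 / 4 * pr P' (F k) <= 1 - mean P' (fun w => cos (u * S w)).
  rewrite pr_mean// -[X in X - _](mean_cst P') -meanB; [|exact/bmf_integrable/bmf_cst|exact/bmf_integrable].
  rewrite -meanZ; last exact/bmf_integrable/bmf_indic.
  apply: mean_le; [exact/bmf_integrable/bmfZ/bmf_indic|exact/bmf_integrable/bmfB/bc/bmf_cst|].
  move=> w; rewrite indicE; case: (boolP (w \in _)) => [|_]; last first.
    by rewrite mulr0 subr_ge0 cos_le1.
  rewrite inE mulr1 => /andP[Lw wk].
  have := norm_cosB_le (u * S w); rewrite ler_norml => /andP[_].
  have uS : `|u * S w| <= 2^-1.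
    by rewrite normrM gtr0_norm// (le_trans _ uk)// ler_pM2l.
  have uL : u * L <= `|u * S w| by rewrite normrM gtr0_norm// ler_pM2l// ltW.
  rewrite -(real_normK (num_real (u * S w))).
  have uL0 : 0 <= u * L by rewrite mulr_ge0 ?ltW.
  move: uS uL uL0; move: `|_| (u * L) (cos _) => y z c y1 zy z0 h.
  have zz : z ^+ 2 <= y ^+ 2 by apply: lerXn2r; rewrite ?nnegrE// (le_trans z0).
  have yy : y ^+ 2 <= 4^-1 by nra.
  have y4 : y ^+ 4 <= y ^+ 2 / 4.
    by rewrite -[4%N]/(2 + 2)%N exprD ler_wpM2l// sqr_ge0.
  by lra.
have ex := expR_ge1Dx (- (s2 * (u ^+ 2 * V) / 2)).
have u2 : 0 < u ^+ 2 by rewrite exprn_gt0.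
have fin : (u * L) ^+ 2 / 4 * pr P' (F k) <= (s2 / 2 + 1) * (u ^+ 2 * V) by lra.
rewrite ler_pdivlMr ?exprn_gt0//.
rewrite -(ler_pM2l u2).
move: fin; rewrite exprMn; move: (pr _ _) (u ^+ 2) (L ^+ 2) => x U LL; lra.
Qed.

End weighted_sums.

(** * Limits of matrices *)

Section matrix_limits.
Context {R : realType}.

Lemma cvg_entry (m n : nat) (A_ : nat -> 'M[R]_(m, n)) (A : 'M[R]_(m, n)) :
  A_ k @[k --> \oo] --> A -> forall i j, A_ k i j @[k --> \oo] --> A i j.
Proof.
by move=> cA i j; apply: (@cvg_comp _ _ _ A_ (fun B : 'M[R]_(m, n) => B i j) _ _ _ cA); exact: coord_continuous.
Qed.

Lemma cvg_norm_entry (m n : nat) (A_ : nat -> 'M[R]_(m, n)) (A : 'M[R]_(m, n)) :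
  (forall i j, A_ k i j @[k --> \oo] --> A i j) -> `|A_ k - A| @[k --> \oo] --> (0 : R).
Proof.
move=> cA; apply/cvgr0Pnorm_le => e e0.
pose H (q : 'I_m * 'I_n) k := `|A q.1 q.2 - A_ k q.1 q.2| <= e.
have Hk q : \forall k \near \oo, H q k.
  by have /cvgrPdist_le := cA q.1 q.2; apply.
have [k0 _ HH] := @filter_forall _ _ H _ _ Hk.
exists k0 => // k /HH kH; rewrite normr_id; apply/(mxnorm_leP _ (ltW e0)) => i j.
by rewrite mxBE distrC; exact: (kH (i, j)).
Qed.

Lemma cvg_mulmx (m n l : nat) (A_ : nat -> 'M[R]_(m, n)) (A : 'M[R]_(m, n))
    (B_ : nat -> 'M[R]_(n, l)) (B : 'M[R]_(n, l)) :
  (forall i j, A_ k i j @[k --> \oo] --> A i j) ->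
  (forall i j, B_ k i j @[k --> \oo] --> B i j) ->
  forall i j, (A_ k *m B_ k) i j @[k --> \oo] --> (A *m B) i j.
Proof.
move=> cA cB i j; rewrite mxE.
rewrite (_ : (fun k => _) = (fun k => \sum_q A_ k i q * B_ k q j)).
  by apply: cvg_sumr => q _; apply: cvgM.
by apply/funext => k; rewrite mxE.
Qed.

Lemma cvg_det (n : nat) (A_ : nat -> 'M[R]_n) (A : 'M[R]_n) :
  (forall i j, A_ k i j @[k --> \oo] --> A i j) -> \det (A_ k) @[k --> \oo] --> \det A.
Proof.
move=> cA; apply: cvg_sumr => s _; apply: cvgMr; apply: cvg_prodr => i _; exact: cA.
Qed.

(** By Cramer's rule the entries of the inverse are rational functions of those
    of the matrix. *)
Lemma cvg_invmx (n : nat) (A_ : nat -> 'M[R]_n) (A : 'M[R]_n) : A \in unitmx ->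
  (forall i j, A_ k i j @[k --> \oo] --> A i j) ->
  forall i j, invmx (A_ k) i j @[k --> \oo] --> invmx A i j.
Proof.
move=> uA cA i j; have dA0 : \det A != 0 by move: uA; rewrite unitmxE unitfE.
have cdet := cvg_det cA.
have cinv : (\det (A_ k))^-1 * cofactor (A_ k) j i @[k --> \oo] --> invmx A i j.
  rewrite /invmx uA !mxE; apply: cvgM; first exact: cvgV.
  apply: cvgMr; apply: cvg_det => q r.
  rewrite !mxE (_ : (fun k => _) = (fun k => A_ k (lift j q) (lift i r))); first exact: cA.
  by apply/funext => k; rewrite !mxE.
apply: cvg_trans cinv; apply: near_eq_cvg.
have [k0 _ H] : \forall k \near \oo, \det (A_ k) != 0 by exact: cvgr_neq0 cdet dA0.
exists k0 => // k /H dk.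
by rewrite /invmx unitmxE unitfE dk !mxE.
Qed.

Lemma cvg_dot (n : nat) (t : 'cV[R]_n) (A_ : nat -> 'cV[R]_n) (A : 'cV[R]_n) :
  (forall i j, A_ k i j @[k --> \oo] --> A i j) -> dot t (A_ k) @[k --> \oo] --> dot t A.
Proof. by move=> cA; apply: cvg_sumr => i _; apply: cvgMr; exact: cA. Qed.

(** A vector in the kernel would have a vanishing quadratic form. *)
Lemma positive_definite_unit (n : nat) (A : 'M[R]_n) : positive_definite A -> A \in unitmx.
Proof.
move=> [_ pA]; rewrite -row_free_unit -kermx_eq0; apply/rowV0P => v /sub_kermxP vA.
apply/eqP/negPn/negP => v0; have := pA v^T.
by rewrite trmx_eq0 v0 trmxK vA mul0mx mxE ltxx => /(_ isT).
Qed.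

(** Terms of smaller order than their index stay small against [n] all at once:
    finitely many of them are bounded, the others are small by assumption. *)
Lemma max_negligible (y : nat -> R) : (forall n, 0 <= y n) ->
  y n / n.+1%:R @[n --> \oo] --> 0 -> forall eps, 0 < eps ->
  \forall n \near \oo, forall i, (i < n)%N -> y i <= eps * n%:R.
Proof.
move=> y0 cy eps e0; have /cvgr0_norm_le/(_ _ e0)[N _ HN] := cy.
pose B := \sum_(i < N) y i / eps; exists (Num.truncn B).+1 => // n /= Bn i iin.
have Bn' : B <= n%:R.
  by rewrite (le_trans (ltW (truncnS_gt B)))// ler_nat.
have [iN|Ni] := ltnP i N.
  rewrite mulrC -ler_pdivrMr// (le_trans _ Bn')// /B (bigD1 (Ordinal iN))//= lerDl.
  by rewrite sumr_ge0// => j _; rewrite divr_ge0// ltW.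
have := HN i Ni; rewrite /= ger0_norm ?divr_ge0// ler_pdivrMr// => /le_trans; apply.
by rewrite ler_pM2l// ler_nat.
Qed.

End matrix_limits.

(** * The limit law of the scaled error *)

Section gaussian_cos.
Context {d : measure_display} {U : measurableType d} {R : realType} {p : nat}.

(** An exact instance of the expansion of the cosine: for normal variables with
    [rho] the characteristic function all error terms vanish. *)
Lemma gaussian_cos (Q : probability U R) (Z : U -> 'cV[R]_p) (m : 'cV[R]_p) (S : 'M[R]_p)
    (t : 'cV[R]_p) (b : R) : gaussian_vector Q Z m S ->
  mean Q (fun w => cos (dot t (Z w) + b)) = expR (- (dot t (S *m t) / 2)) * cos (dot t m + b).
Proof.
move=> [A [G [AS indG lawG ZE]]]; pose a : 'cV[R]_p := A^T *m t.
have mg i : measurable_fun setT (fun y : R => a i 0 * y) by exact: measurable_funM.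
pose rho i := expR (- ((a i 0) ^+ 2 / 2)).
have rho01 i : 0 <= rho i <= 1.
  by rewrite expR_ge0/= -[leRHS]expR0 ler_expR oppr_le0 divr_ge0// sqr_ge0.
have := cos_mean_approx indG mg (dot t m + b) (index_enum_uniq 'I_p) rho01.
rewrite [X in _ <= X]big1 => [|i _]; last first.
  rewrite (mean_std_normal (h := fun y => cos (a i 0 * y)) (lawG i)); last exact: bmf_cos.
  rewrite (mean_std_normal (h := fun y => sin (a i 0 * y)) (lawG i)); last exact: bmf_sin.
  have := std_normal_cos 0 (a i 0); have := std_normal_cos (- (pi / 2)) (a i 0).
  rewrite cos0 cosN cos_pihalf mulr1 mulr0.
  under eq_Rintegral => x _ do rewrite cosBpihalf.
  move=> ->; under eq_Rintegral => x _ do rewrite addr0.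
  by move=> ->; rewrite subrr normr0 addr0.
rewrite normr_le0 subr_eq0 => /eqP; rewrite /cos_mean /rho -expR_sum => H.
have -> : dot t (S *m t) / 2 = \sum_i (a i 0) ^+ 2 / 2.
  rewrite -mulr_suml -AS; congr (_ / 2).
  have -> : A *m A^T *m t = A *m a by rewrite mulmxA.
  by rewrite dotC dot_mulmx /dot; apply: eq_bigr => i _; rewrite expr2.
rewrite -sumrN -H; congr (mean Q _); apply/funext => w; congr cos.
rewrite addrA; congr (_ + b); rewrite ZE dotDr addrC; congr (_ + _).
by rewrite dotC dot_mulmx dotC /dot; apply: eq_bigr => i _; rewrite [X in _ * X]mxE.
Qed.

End gaussian_cos.

Section design_limits.
Context {R : realType} {p : nat}.
Variables (x : nat -> 'rV[R]_p) (C : 'M[R]_p).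
Hypothesis hX : forall n, (p <= n)%N -> \rank (design x n) = p.
Hypothesis hgram : gram x n @[n --> \oo] --> C.
Hypothesis uC : C \in unitmx.

Lemma gram_diag n j : n%:R * gram x n j j = \sum_(k < n) x k 0 j ^+ 2.
Proof.
case: n => [|n]; first by rewrite mul0r big_ord0.
rewrite /gram !mxE mulVKf ?pnatr_eq0//.
by apply: eq_bigr => k _; rewrite !mxE expr2.
Qed.

(** One new row changes the Gram matrix by its square over [n + 1], and the
    Gram matrices converge. *)
Lemma design_row_negligible j : x n 0 j ^+ 2 / n.+1%:R @[n --> \oo] --> 0.
Proof.
have cg : gram x n j j @[n --> \oo] --> C j j by exact: (@cvg_entry R p p (gram x) C hgram j j).
have cgS : gram x n.+1 j j @[n --> \oo] --> C j j.
  by have := cvg_shiftS (fun n => gram x n j j) (nbhs (C j j)) => /= ->.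
have c1 : 1 - n.+1%:R^-1 @[n --> \oo] --> (1 : R).
  by rewrite -[X in _ --> X]subr0; apply: cvgB; [exact: cvg_cst|exact: cvg_harmonic].
rewrite -(subrr (C j j)) -{2}[C j j]mul1r.
rewrite (_ : (fun n => _) = (fun n => gram x n.+1 j j - (1 - n.+1%:R^-1) * gram x n j j)).
  by apply: cvgB => //; apply: cvgM.
apply/funext => n; have n0 : n.+1%:R != 0 :> R by rewrite pnatr_eq0.
have := gram_diag n.+1 j; rewrite big_ord_recr/= -gram_diag => H.
apply: (mulIf n0); rewrite divfK// mulrBl -mulrA [gram x n j j * _]mulrC mulrA mulrBl mulVf// mul1r.
by rewrite [gram x n.+1 j j * _]mulrC H -natr1; ring.
Qed.

Lemma design_gram n : (0 < n)%N -> (design x n)^T *m design x n = n%:R *: gram x n.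
Proof. by move=> n0; rewrite /gram scalerA divff ?scale1r// pnatr_eq0 -lt0n. Qed.

Lemma gram_unit n : (p <= n)%N -> (0 < n)%N -> gram x n \in unitmx.
Proof.
move=> pn n0; rewrite /gram unitmxZ ?fullrank_gram_unit ?hX//.
by rewrite unitfE invr_eq0 pnatr_eq0 -lt0n.
Qed.

Lemma gram_inv_sym n : (invmx (gram x n))^T = invmx (gram x n).
Proof. by rewrite trmx_inv /gram linearZ/= trmx_mul trmxK. Qed.

Lemma invmx_design_gram n : (p <= n)%N -> (0 < n)%N ->
  invmx ((design x n)^T *m design x n) = n%:R^-1 *: invmx (gram x n).
Proof.
move=> pn n0; rewrite design_gram// invmxZ// unitmxZ ?gram_unit//.
by rewrite unitfE pnatr_eq0 -lt0n.
Qed.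

Lemma cvg_gram_inv i j : invmx (gram x n) i j @[n --> \oo] --> invmx C i j.
Proof. exact: (@cvg_invmx R p (gram x) C uC (@cvg_entry R p p (gram x) C hgram) i j). Qed.

(** The component of the scaled error in the direction [t] is a weighted sum of
    the errors [eps i] plus a constant; these are the weights and the constant. *)
Definition score_weight n (t : 'cV[R]_p) : 'cV[R]_n :=
  (Num.sqrt n%:R)^-1 *: (design x n *m (invmx (gram x n) *m t)).

Definition score_bias n (t d lam : 'cV[R]_p) : R :=
  - dot t (invmx (gram x n) *m (diag_mx ((Num.sqrt n%:R)^-1 *: lam)^T *m d)).

Lemma dot_scaled_error n t d lam (eps : 'cV[R]_n) : (p <= n)%N -> (0 < n)%N ->
  dot t (Num.sqrt n%:R *: signed_error (design x n) lam d eps) =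
  \sum_i score_weight n t i 0 * eps i 0 + score_bias n t d lam.
Proof.
move=> pn n0; have sn0 : Num.sqrt n%:R != 0 :> R by rewrite sqrtr_eq0 -ltNge ltr0n.
have sn : Num.sqrt n%:R * n%:R^-1 = (Num.sqrt n%:R)^-1 :> R.
  by rewrite -{2}(sqr_sqrtr (ler0n R n)) expr2 invfM mulVKf.
rewrite /signed_error invmx_design_gram// -scalemxAl scalerA sn.
rewrite -[\sum_i _]/(dot (score_weight n t) eps) /score_weight /score_bias.
rewrite dotZr mulmxBr dotBr mulrBr; congr (_ + _).
  by rewrite dotZl !dot_mulmx gram_inv_sym.
congr (- _); rewrite -dotZr scalemxAr scalemxAl; congr (dot t (_ *m (_ *m d))).
by rewrite -linearZ/= -linearZ.
Qed.

Lemma dot_score_weight n t : (p <= n)%N -> (0 < n)%N ->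
  \sum_i score_weight n t i 0 ^+ 2 = dot t (invmx (gram x n) *m t).
Proof.
move=> pn n0; have -> : \sum_i score_weight n t i 0 ^+ 2 = dot (score_weight n t) (score_weight n t).
  by apply: eq_bigr => i _; rewrite expr2.
rewrite /score_weight dotZl dotZr mulrA -invfM -expr2 sqr_sqrtr ?ler0n//.
rewrite dot_mulmx mulmxA design_gram// -scalemxAl dotZr mulKf ?pnatr_eq0 -?lt0n//.
by rewrite mulKVmx ?gram_unit// dotC.
Qed.

Lemma cvg_score_square t : dot t (invmx (gram x n) *m t) @[n --> \oo] --> dot t (invmx C *m t).
Proof.
apply: cvg_dot; apply: cvg_mulmx => i j; [exact: cvg_gram_inv|exact: cvg_cst].
Qed.

(** The Lindeberg condition: the largest weight is of the order of the largest
    design entry over [sqrt n]. *)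
Lemma score_weight_small t (delta : R) : 0 < delta ->
  \forall n \near \oo, forall i, `|score_weight n t i 0| <= delta.
Proof.
move=> d0; pose v := invmx C *m t; pose v_ n := invmx (gram x n) *m t.
have cv j : v_ n j 0 @[n --> \oo] --> v j 0.
  by apply: cvg_mulmx => *; [exact: cvg_gram_inv|exact: cvg_cst].
pose K := \sum_j (`|v j 0| + 1); have K0 : 0 < K + 1.
  by rewrite ltr_wpDl// sumr_ge0// => j _; rewrite addr_ge0.
pose eps := delta / (K + 1); have e0 : 0 < eps by rewrite divr_gt0.
pose H1 j n := `|v j 0 - v_ n j 0| <= 1.
have H1n j : \forall n \near \oo, H1 j n.
  by have /cvgrPdist_le := cv j; apply.
pose H2 j n := forall i, (i < n)%N -> x i 0 j ^+ 2 <= eps ^+ 2 * n%:R.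
have H2n j : \forall n \near \oo, H2 j n.
  apply: max_negligible; [by move=> n; exact: sqr_ge0|exact: design_row_negligible|exact: exprn_gt0].
have [n1 _ HH1] := @filter_forall _ _ H1 _ _ H1n.
have [n2 _ HH2] := @filter_forall _ _ H2 _ _ H2n.
exists (maxn 1 (maxn n1 n2)) => // n /=; rewrite !geq_max => /and3P[n0 /HH1 nH1 /HH2 nH2] i.
have sn0 : 0 < Num.sqrt n%:R :> R by rewrite sqrtr_gt0 ltr0n.
rewrite mxZE normrM gtr0_norm ?invr_gt0// mulrC ler_pdivrMr//.
have es0 : 0 <= eps * Num.sqrt n%:R by rewrite ltW// mulr_gt0.
rewrite [(_ *m _) i 0]mxE (le_trans (ler_norm_sum _ _ _))//.
apply: (@le_trans _ _ (\sum_j (eps * Num.sqrt n%:R) * (`|v j 0| + 1))).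
  apply: ler_sum => j _; rewrite normrM ler_pM//.
    rewrite [design x n i j]mxE -(@ler_pXn2r _ 2) ?nnegrE//.
    by rewrite real_normK ?num_real// exprMn sqr_sqrtr ?ler0n//; exact: nH2.
  have := nH1 j; rewrite /H1 distrC -/(v_ n) => h.
  have -> : v_ n j 0 = v j 0 + (v_ n j 0 - v j 0) by rewrite addrCA subrr addr0.
  by rewrite (le_trans (ler_normD _ _))// lerD2l.
rewrite -mulr_sumr -/K mulrAC ler_pM2r// /eps mulrAC ler_pdivrMr// ler_pM2l//.
by rewrite lerDl.
Qed.

End design_limits.

Section scaled_error_limit.
Context {R : realType} {p : nat}.
Variables (x : nat -> 'rV[R]_p) (C : 'M[R]_p).
Hypothesis hX : forall n, (p <= n)%N -> \rank (design x n) = p.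
Hypothesis hgram : gram x n @[n --> \oo] --> C.
Hypothesis uC : C \in unitmx.
Variable sigma : R.
Variables (dT : nat -> measure_display) (T : forall n, measurableType (dT n)).
Variables (P : forall n, probability (T n) R) (e : forall n, 'I_n -> {RV (P n) >-> R}).
Arguments e : clear implicits.
Variable mu : set R -> \bar R.
Hypothesis hindep : forall n, (p <= n)%N -> mutually_independent (e n).
Hypothesis hlaw : forall n, (p <= n)%N -> forall i, has_law (e n i) mu.
Hypothesis hmean : forall n, (p <= n)%N -> forall i, ('E_(P n)[e n i] = 0)%E.
Hypothesis hvar : forall n, (p <= n)%N -> forall i, ('V_(P n)[e n i] = (sigma ^+ 2)%:E)%E.
Variables (lam : nat -> 'cV[R]_p) (lam0 : 'cV[R]_p).
Hypothesis hlim : (Num.sqrt n%:R)^-1 *: lam n @[n --> \oo] --> lam0.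
Variable d : 'cV[R]_p.

(** The vector [V_n^d], for a vector [d] of signs. *)
Definition scaled_error n (w : T n) : 'cV[R]_p :=
  Num.sqrt n%:R *: signed_error (design x n) (lam n) d (\col_i e n i w).

Lemma measurable_scaled_error (n : nat) (j : 'I_p) :
  measurable_fun setT (fun w => @scaled_error n w j 0).
Proof.
rewrite /scaled_error /signed_error.
set B := invmx _; set c := diag_mx _ *m d.
rewrite (_ : (fun w => _) = (fun w => Num.sqrt n%:R *
    (\sum_i (B *m (design x n)^T) j i * e n i w - (B *m c) j 0))).
  apply: measurable_funM => //; apply: measurable_funB => //.
  by apply: measurable_sum => i; apply: measurable_funM.
apply/funext => w; rewrite mxZE mulmxBr mxBE mulmxA; congr (_ * (_ - _)).
by rewrite mxE; apply: eq_bigr => i _; rewrite [X in _ * X]mxE.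
Qed.

Let m : 'cV[R]_p := - (invmx C *m diag_mx lam0^T *m d).

Lemma cvg_score_bias t : score_bias x n t d (lam n) @[n --> \oo] --> dot t m.
Proof.
rewrite /score_bias /m dotNr -mulmxA; apply: cvgN; apply: cvg_dot.
apply: cvg_mulmx; first exact: cvg_gram_inv.
apply: cvg_mulmx => i j; last exact: cvg_cst.
have cl : ((Num.sqrt n%:R)^-1 *: lam n) i 0 @[n --> \oo] --> lam0 i 0.
  exact: (@cvg_entry R p 1 _ _ hlim i 0).
have dE (z : 'cV[R]_p) : (diag_mx z^T) i j = (i == j)%:R * z i 0.
  by rewrite !mxE mulr_natl.
rewrite dE (_ : (fun n => _) = (fun n => (i == j)%:R * ((Num.sqrt n%:R)^-1 *: lam n) i 0)).
  exact: cvgMr.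
by apply/funext => n; rewrite dE.
Qed.

Let delta_of eta (eta0 : 0 < eta) := weighted_cos (hmean (leqnSn p) ord0) (hvar (leqnSn p) ord0)
  (hlaw (leqnSn p) ord0) eta0.

Lemma scaled_error_cos t b :
  mean (P n) (fun w => cos (dot t (scaled_error w) + b)) @[n --> \oo] -->
  expR (- (sigma ^+ 2 * dot t (invmx C *m t) / 2)) * cos (dot t m + b).
Proof.
pose v n := dot t (invmx (gram x n) *m t); pose v0 := dot t (invmx C *m t).
have cv : v n @[n --> \oo] --> v0 by exact: cvg_score_square.
have cg : expR (- (sigma ^+ 2 * v n / 2)) * cos (score_bias x n t d (lam n) + b) @[n --> \oo] -->
    expR (- (sigma ^+ 2 * v0 / 2)) * cos (dot t m + b).
  apply: cvgM.
    apply: (@cvg_comp _ _ _ (fun n => - (sigma ^+ 2 * v n / 2)) expR); last exact: continuous_expR.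
    by apply: cvgN; apply: cvgMl; apply: cvgMr.
  apply: (@cvg_comp _ _ _ (fun n => score_bias x n t d (lam n) + b) cos); last exact: continuous_cos.
  by apply: cvgD; [exact: cvg_score_bias|exact: cvg_cst].
apply/cvgrPdist_le => eps e0; have e20 : 0 < eps / 2 by rewrite divr_gt0.
have v00 : 0 < `|v0| + 1 by rewrite ltr_wpDl.
have eta0 : 0 < eps / 2 / (`|v0| + 1) by rewrite divr_gt0.
(* the sum of the squared weights is eventually at most [`|v0| + 1] *)
have [delta d0 H] := delta_of eta0.
move/cvgrPdist_le : cg => /(_ _ e20) [n1 _ H1].
move/cvgrPdist_le : cv => /(_ _ ltr01) [n2 _ H2].
have [n3 _ H3] := score_weight_small hgram uC t d0.
exists (maxn p.+1 (maxn n1 (maxn n2 n3))) => // n /=; rewrite !geq_max => /and4P[pn /H1 h1 /H2 h2 /H3 h3].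
have pn' := ltnW pn; have n0 : (0 < n)%N by exact: leq_ltn_trans pn.
have := H _ _ _ _ (e n) (fun i => score_weight x n t i 0) (score_bias x n t d (lam n) + b)
  (hindep pn') (hlaw pn') h3.
rewrite (dot_score_weight hX)// -/(v n).
have -> : (fun w => cos (\sum_i score_weight x n t i 0 * e n i w + (score_bias x n t d (lam n) + b))) =
    (fun w => cos (dot t (scaled_error w) + b)).
  apply/funext => w; rewrite addrA /scaled_error (dot_scaled_error hX)//.
  by congr (cos (_ + _ + _)); apply: eq_bigr => i _; rewrite [X in _ = _ * X]mxE.
set M := mean _ _ => h4; move: h1; set g := (X in `|_ - X|) in h4 * => h1.
have vn : v n <= `|v0| + 1.
  by move: h2; rewrite ler_distlC => /andP[_ h2]; rewrite (le_trans h2)// lerD2r ler_norm.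
have : eps / 2 / (`|v0| + 1) * v n <= eps / 2.
  by rewrite mulrAC ler_pdivrMr// ler_pM2l.
move=> h5; have h6 := le_trans h4 h5.
rewrite [eps]splitr -[X in `|X|](subrKA g) (le_trans (ler_normD _ _))// lerD//.
by rewrite distrC.
Qed.

(** Each coordinate is a weighted sum of errors with a bounded sum of squared
    weights, plus a bounded constant. *)
Lemma scaled_error_tight eps : 0 < eps -> exists L, \forall n \near \oo,
  pr (P n) [set w | exists j, L < `|scaled_error w j 0|] <= eps.
Proof.
move=> e0.
pose t (j : 'I_p) : 'cV[R]_p := delta_mx j 0.
have tE j (z : 'cV[R]_p) : dot (t j) z = z j 0.
  rewrite /dot (bigD1 j)//= big1 => [|i ij]; first by rewrite mxE !eqxx mul1r addr0.
  by rewrite mxE (negbTE ij)/= mul0r.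
pose v j n := dot (t j) (invmx (gram x n) *m t j); pose v0 j := dot (t j) (invmx C *m t j).
pose K := \sum_j (`|v0 j| + 1); have K0 : 0 <= K by apply: sumr_ge0 => j _; rewrite addr_ge0.
pose c := 2 * sigma ^+ 2 + 4.
have c0 : 0 < c by rewrite ltr_wpDl// mulr_ge0// sqr_ge0.
(* [c K / L1^2 <= eps], because [L1 >= 1] and [L1 >= c K / eps] *)
pose L1 := 1 + c * K / eps.
have L11 : 1 <= L1 by rewrite lerDl divr_ge0 ?mulr_ge0// ltW.
have L10 : 0 < L1 by exact: lt_le_trans L11.
have cL : c * K / L1 ^+ 2 <= eps.
  have L20 : 0 < L1 ^+ 2 by exact: exprn_gt0.
  rewrite ler_pdivrMr// -ler_pdivrMl// mulrC.
  apply: (@le_trans _ _ L1); first by rewrite lerDr.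
  by rewrite expr2 ler_peMr// ltW.
pose B := \sum_j (`|dot (t j) m| + 1).
exists (L1 + B).
pose H1 j n := `|v0 j - v j n| <= 1.
have H1n j : \forall n \near \oo, H1 j n.
  have cv : v j n @[n --> \oo] --> v0 j by exact: cvg_score_square.
  by move/cvgrPdist_le : cv; apply.
pose H2 j n := `|dot (t j) m - score_bias x n (t j) d (lam n)| <= 1.
have H2n j : \forall n \near \oo, H2 j n.
  have cb : score_bias x n (t j) d (lam n) @[n --> \oo] --> dot (t j) m.
    exact: cvg_score_bias.
  by move/cvgrPdist_le : cb; apply.
have [n1 _ HH1] := @filter_forall _ _ H1 _ _ H1n.
have [n2 _ HH2] := @filter_forall _ _ H2 _ _ H2n.
exists (maxn p.+1 (maxn n1 n2)) => // n /=; rewrite !geq_max => /and3P[pn /HH1 nH1 /HH2 nH2].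
have pn' := ltnW pn; have n0 : (0 < n)%N by exact: leq_ltn_trans pn.
pose S j w := \sum_i score_weight x n (t j) i 0 * e n i w.
have SE j w : scaled_error w j 0 = S j w + score_bias x n (t j) d (lam n).
  rewrite -tE /scaled_error (dot_scaled_error hX)//.
  by congr (_ + _); apply: eq_bigr => i _; rewrite [X in _ * X = _]mxE.
have mS j : measurable_fun setT (S j).
  by apply: measurable_sum => i; apply: measurable_funM.
have mabs (f : T n -> R) L : measurable_fun setT f -> measurable [set w | L < `|f w|].
  move=> mf; have mn : measurable_fun setT (fun w => `|f w|) by exact: measurableT_comp.
  have := mn measurableT `]L, +oo[%classic (measurable_itv _).
  by rewrite setTI; congr (measurable _); apply/seteqP; split => w /=; rewrite in_itv/= andbT.
apply: (@le_trans _ _ (pr (P n) (\bigcup_(j in [set: 'I_p]) [set w | L1 < `|S j w|]))).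
  apply: pr_le.
  - have -> : [set w : T n | exists j, L1 + B < `|scaled_error w j 0|] =
        \bigcup_(j in [set: 'I_p]) [set w : T n | L1 + B < `|scaled_error w j 0|].
      by apply/seteqP; split => w [j]; exists j.
    apply: fin_bigcup_measurable => [|j _]; first exact: finite_finset.
    by apply: mabs; exact: measurable_scaled_error.
  - by apply: fin_bigcup_measurable => [|j _]; [exact: finite_finset|exact: mabs].
  - move=> w [j]; rewrite SE => Lw; exists j => //=.
    have bB : `|score_bias x n (t j) d (lam n)| <= B.
      have := nH2 j; rewrite /H2 distrC => h.
      have -> : score_bias x n (t j) d (lam n) = dot (t j) m +
        (score_bias x n (t j) d (lam n) - dot (t j) m) by rewrite addrCA subrr addr0.
      rewrite (le_trans (ler_normD _ _))// /B (bigD1 j)//= -[leLHS]addr0 lerD//.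
        by rewrite lerD2l.
      by apply: sumr_ge0 => i _; rewrite addr_ge0.
    by have := ler_normD (S j w) (score_bias x n (t j) d (lam n)); lra.
apply: (le_trans (pr_finU_le _ _)) => [j|]; first exact: mabs.
apply: (le_trans _ cL).
rewrite /K mulr_sumr mulr_suml; apply: ler_sum => j _.
have := weighted_tail (hmean (leqnSn p) ord0) (hvar (leqnSn p) ord0) (hlaw (leqnSn p) ord0)
  (fun i => score_weight x n (t j) i 0) (hindep pn') (hlaw pn') L10.
move=> /le_trans; apply; rewrite (dot_score_weight hX)// -/(v j n) -/c.
rewrite ler_pM2r ?invr_gt0 ?exprn_gt0// ler_pM2l//.
have := nH1 j; rewrite /H1 ler_distlC => /andP[_ h]; rewrite (le_trans h)// lerD2r ler_norm.
by [].
Qed.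

(** Convergence in law of the scaled error, in the only form that is used: the
    lower bound for open sets, which for complements gives the upper bound for
    closed sets. *)
Lemma scaled_error_open (dU : measure_display) (U : measurableType dU) (Q : probability U R)
    (Z : U -> 'cV[R]_p) (E : set 'cV[R]_p) (eps : R) :
  gaussian_vector Q Z m (sigma ^+ 2 *: invmx C) -> open E -> 0 < eps ->
  \forall n \near \oo, pr Q [set w | E (Z w)] <= pr (P n) [set w | E (scaled_error w)] + eps.
Proof.
move=> gZ; apply: portmanteau_open.
- exact: measurable_scaled_error.
- exact: gaussian_measurable gZ.
- move=> t b; rewrite (gaussian_cos t b gZ) -scalemxAl dotZr; exact: scaled_error_cos.
- exact: scaled_error_tight.
Qed.

End scaled_error_limit.

(** * Coverage probabilities *)

Lemma reflected_setE {R : realType} {p : nat} (a b : 'cV[R]_p) (k : R) (M : set 'cV[R]_p) :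
  0 < k -> reflected_set a k^-1 M b = M (k *: (a - b)).
Proof.
move=> k0; have kn0 : k != 0 by rewrite gt_eqF.
rewrite /reflected_set; apply/propext; split => /=.
  by case=> z Mz <-; rewrite opprB addrCA subrr addr0 scalerA divff// scale1r.
move=> Mk; exists (k *: (a - b)) => //.
by rewrite scalerA mulVf// scale1r opprB addrCA subrr addr0.
Qed.

(** The strict inequality makes the region open, and the ball of radius [r']
    contains the closed ball of radius [r] that the lower bound asks for. *)
Definition inner_region {R : realType} {p : nat} (M : set 'cV[R]_p) (r : R) : set 'cV[R]_p :=
  [set z | exists2 r', r < r' & ball z r' `<=` M].

Lemma open_inner_region {R : realType} {p : nat} (M : set 'cV[R]_p) (r : R) :
  open (inner_region M r).
Proof.
rewrite openE => z [r' rr' zM]; apply/nbhs_ballP; exists ((r' - r) / 2) => /=.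
  by rewrite divr_gt0// subr_gt0.
move=> y zy; exists ((r + r') / 2); first by lra.
move=> y' yy'; apply: zM.
have -> : r' = (r' - r) / 2 + (r + r') / 2 by lra.
exact: ball_triangle zy yy'.
Qed.

Lemma interior_inner_region {R : realType} {p : nat} (M : set 'cV[R]_p) :
  interior M = \bigcup_k inner_region M k.+1%:R^-1.
Proof.
apply/seteqP; split => z.
  move=> /nbhs_ballP[e /= e0 eM]; exists (Num.truncn e^-1) => //; exists e => //.
  by rewrite invf_plt ?posrE// truncnS_gt.
case=> k _ [r' kr' rM]; apply/nbhs_ballP; exists r' => //=.
by rewrite (lt_trans _ kr')// invr_gt0.
Qed.

Lemma inner_region_incr {R : realType} {p : nat} (M : set 'cV[R]_p) k :
  inner_region M k.+1%:R^-1 `<=` inner_region M k.+2%:R^-1.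
Proof.
move=> z [r' kr' zM]; exists r' => //; apply: le_lt_trans kr'.
by rewrite lef_pV2 ?posrE// ler_nat.
Qed.

Section lasso_coverage.
Context {R : realType} {n p : nat} {d : measure_display} {T : measurableType d}.
Variables (P : probability T R) (X : 'M[R]_(n, p)) (lam : 'cV[R]_p).
Variable e : 'I_n -> {RV P >-> R}.
Hypothesis rkX : \rank X = p.
Hypothesis lam_ge0 : forall j, 0 <= lam j 0.

Let eps w : 'cV[R]_n := \col_i e i w.
Let k : R := Num.sqrt n%:R.

(** The estimator is a continuous function of the data. *)
Lemma measurable_lasso_error (beta : 'cV[R]_p) j :
  measurable_fun setT (fun w => (k *: (lasso X lam (X *m beta + eps w) - beta)) j 0).
Proof.
have meps i : measurable_fun setT (fun w => eps w i 0).
  rewrite (_ : (fun w => _) = e i); first exact: measurable_funPT.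
  by apply/funext => w; rewrite mxE.
pose f (y : 'cV[R]_n) := k * (lasso X lam (X *m beta + y) j 0 - beta j 0).
have cf : continuous f.
  move=> y; have FF : Filter (nbhs y) by exact: nbhs_filter.
  have c1 : X *m beta + y' @[y' --> y] --> X *m beta + y.
    by apply: (@cvgD _ _ _ _ _ (fun=> X *m beta) id); [exact: cvg_cst|exact: cvg_id].
  have c2 : lasso X lam (X *m beta + y') @[y' --> y] --> lasso X lam (X *m beta + y).
    by apply: (@cvg_comp _ _ _ (fun y' => X *m beta + y') (lasso X lam) _ _ _ c1);
      exact: lasso_continuous.
  have c3 : lasso X lam (X *m beta + y') j 0 @[y' --> y] --> lasso X lam (X *m beta + y) j 0.
    by apply: (@cvg_comp _ _ _ (fun y' => lasso X lam (X *m beta + y')) (fun b : 'cV[R]_p => b j 0)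
      _ _ _ c2); exact: coord_continuous.
  have c4 : lasso X lam (X *m beta + y') j 0 - beta j 0 @[y' --> y] -->
      lasso X lam (X *m beta + y) j 0 - beta j 0.
    by apply: cvgB; [exact: c3|exact: cvg_cst].
  have c5 : k * (lasso X lam (X *m beta + y') j 0 - beta j 0) @[y' --> y] -->
      k * (lasso X lam (X *m beta + y) j 0 - beta j 0) by apply: cvgMr; exact: c4.
  exact: c5.
rewrite (_ : (fun w => _) = f \o eps); last by apply/funext => w; rewrite /f/= mxZE mxBE.
apply: (measurability (@RGenOInfty.G R)); first exact: RGenOInfty.measurableE.
move=> _ [_ [a ->] <-]; rewrite setTI comp_preimage.
apply: (measurable_open_preimage meps); apply: open_comp => [y _|]; first exact: cf.
by rewrite set_itvE; exact: open_gt.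
Qed.

Let cover (M : set 'cV[R]_p) beta :=
  [set w | M (k *: (lasso X lam (X *m beta + eps w) - beta))].

Lemma coverageE (M : set 'cV[R]_p) beta : (0 < n)%N -> borel_set M ->
  coverage X lam e M beta = (pr P (cover M beta))%:E.
Proof.
move=> n0 hM; rewrite /coverage -prE.
  by congr (P _); apply/seteqP; split => w /=; rewrite reflected_setE ?sqrtr_gt0 ?ltr0n.
exact: (measurable_borel_preimage (measurable_lasso_error beta) hM).
Qed.

Let verr (s : {ffun 'I_p -> bool}) w : 'cV[R]_p := k *: signed_error X lam (sign_vector R s) (eps w).

Lemma cover_lower (C : 'M[R]_p) (M : set 'cV[R]_p) (r : R) (beta : 'cV[R]_p)
    (s : {ffun 'I_p -> bool}) :
  (0 < n)%N -> borel_set M -> C \in unitmx -> conditionA C M ->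
  (forall j, 0 <= (-1) ^+ s j * beta j 0) ->
  p%:R * `|invmx (k ^- 2 *: (X^T *m X)) - invmx C| * (k^-1 * (2 * `|lam|)) <= r ->
  (forall j, measurable_fun setT (fun w => verr s w j 0)) ->
  pr P [set w | inner_region M r (verr s w)] <= pr P (cover M beta).
Proof.
move=> n0 hM uC cA sb rr mv; apply: pr_le.
- by apply: (measurable_open_preimage mv); exact: open_inner_region.
- exact: (measurable_borel_preimage (measurable_lasso_error beta) hM).
move=> w [r' rr' zM]; rewrite /cover/=.
apply: (conditionA_ball rkX lam_ge0 uC cA _ sb rr); first by rewrite sqrtr_gt0 ltr0n.
move=> z zr; apply: zM; rewrite mx_norm_ball /ball_/= distrC.
exact: le_lt_trans rr'.
Qed.

(** Far out in the orthant of [s] all components of the estimator keep the sign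
    of [s] with high probability, and there the estimator is linear. *)
Lemma cover_far (M : set 'cV[R]_p) (s : {ffun 'I_p -> bool}) (eta : R) : (0 < n)%N -> borel_set M ->
  (forall j, measurable_fun setT (fun w => verr s w j 0)) -> 0 < eta ->
  exists beta, pr P (cover M beta) <= pr P [set w | M (verr s w)] + eta.
Proof.
move=> n0 hM mv eta0; have k0 : 0 < k by rewrite sqrtr_gt0 ltr0n.
pose F m := [set w | ball (0 : 'cV[R]_p) m.+1%:R (verr s w)].
have mF m : measurable (F m).
  exact: (measurable_open_preimage mv (ball_open (0 : 'cV[R]_p) _)).
have incF m : F m `<=` F m.+1.
  by move=> w; apply: le_ball; rewrite ler_nat.
have [N] := pr_bigcup_approx P mF incF eta0.
have -> : \bigcup_m F m = setT.
  apply/seteqP; split => // w _; exists (Num.truncn `|verr s w|) => //.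
  by rewrite /F /= mx_norm_ball /ball_/= sub0r normrN truncnS_gt.
have -> : pr P setT = 1 by rewrite /pr probability_setT.
move=> FN; pose c := N.+1%:R / k; exists (c *: sign_vector R s).
have mM : measurable [set w | M (verr s w)] by exact: (measurable_borel_preimage mv hM).
apply: (@le_trans _ _ (pr P ([set w | M (verr s w)] `|` ~` F N))).
  apply: pr_le.
  - exact: (measurable_borel_preimage (measurable_lasso_error _) hM).
  - by apply: measurableU => //; exact: measurableC.
  move=> w /=; have [Fw|nF] := pselect (F N w); last by right.
  rewrite /cover/= (lasso_signed rkX lam_ge0 (s := s)) => [|j].
    by rewrite addrAC subrr add0r; left.
  have -> : (c *: sign_vector R s + signed_error X lam (sign_vector R s) (eps w)) j 0 =
      c * (-1) ^+ s j + k^-1 * verr s w j 0.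
    have -> : verr s w j 0 = k * signed_error X lam (sign_vector R s) (eps w) j 0 by rewrite mxZE.
    by rewrite mulKf ?gt_eqF// [in LHS]mxE mxZE [sign_vector R s j 0]mxE.
  rewrite mulrDr mulrCA -expr2 sqrr_sign mulr1 mulrCA.
  rewrite /c [N.+1%:R / k]mulrC -mulrDr mulr_ge0 ?invr_ge0 ?(ltW k0)//.
  have : `|(-1) ^+ s j * verr s w j 0| <= N.+1%:R.
    rewrite normrM normr_sign mul1r (le_trans (mxnorm_entry _ _ _))//.
    by move: Fw; rewrite /F /= mx_norm_ball /ball_/= sub0r normrN => /ltW.
  by rewrite ler_norml => /andP[+ _]; rewrite -subr_ge0 opprK addrC.
apply: (le_trans (prU_le _ _ _)) => //; first exact: measurableC.
by rewrite lerD2l prC//; lra.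
Qed.

End lasso_coverage.

Theorem corollary11 (R : realType) (p : nat)
  (x : nat -> 'rV[R]_p)
  (hX : forall n, (p <= n)%N -> \rank (design x n) = p)
  (C : 'M[R]_p) (hC : positive_definite C)
  (hgram : gram x n @[n --> \oo] --> C)
  (sigma : R) (hsigma : 0 < sigma)
  (dT : nat -> measure_display) (T : forall n, measurableType (dT n))
  (P : forall n, probability (T n) R)
  (e : forall n, 'I_n -> {RV (P n) >-> R})
  (mu : set R -> \bar R)
  (hindep : forall n, (p <= n)%N -> mutually_independent (e n))
  (hlaw : forall n, (p <= n)%N -> forall i, has_law (e n i) mu)
  (hmean : forall n, (p <= n)%N -> forall i, ('E_(P n)[e n i] = 0)%E)
  (hvar : forall n, (p <= n)%N -> forall i,
     ('V_(P n)[e n i] = (sigma ^+ 2)%:E)%E)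
  (lam : nat -> 'cV[R]_p)
  (hlam : forall n, (p <= n)%N -> forall j, 0 <= lam n j 0)
  (lam0 : 'cV[R]_p) (hlam0 : forall j, 0 <= lam0 j 0)
  (hlim : (Num.sqrt n%:R)^-1 *: lam n @[n --> \oo] --> lam0)
  (alpha : R) (halpha : 0 <= alpha <= 1)
  (M : set 'cV[R]_p) (hM : borel_set M) (hA : conditionA C M)
  (dU : measure_display) (U : measurableType dU) (Q : probability U R)
  (u : {ffun 'I_p -> bool} -> U -> 'cV[R]_p)
  (hu : forall s, gaussian_vector Q (u s)
     (- (invmx C *m diag_mx lam0^T *m sign_vector R s))
     (sigma ^+ 2 *: invmx C))
  (hmin : \big[Order.min/+oo%E]_(s : {ffun 'I_p -> bool}) Q (u s @^-1` M)
          = (1 - alpha)%:E) :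
  limn_einf (fun n =>
    ereal_inf [set coverage (design x n) (lam n) (e n) M beta
              | beta in [set: 'cV[R]_p]])
  = (1 - alpha)%:E.
Proof.
have uC := positive_definite_unit hC.
have uS : sigma ^+ 2 *: invmx C \in unitmx.
  by rewrite unitmxZ ?unitmx_inv// unitfE expf_neq0// gt_eqF.
have mu_ s j : measurable_fun setT (fun w => u s w j 0) by exact: gaussian_measurable (hu s) j.
have muM s : measurable (u s @^-1` M) by exact: (measurable_borel_preimage (mu_ s) hM).
have mopen s E : open E -> measurable (u s @^-1` E) by exact: measurable_open_preimage.
have oclM : open (~` closure M) by exact: (closed_openC (@closed_closure _ M)).
have mucl s : measurable (u s @^-1` closure M).
  by rewrite -[closure M]setCK preimage_setC; apply: measurableC; exact: (mopen s _ oclM).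
have boundary s : pr Q (u s @^-1` closure M) <= pr Q (u s @^-1` interior M).
  exact: (gaussian_closure_le (hu s) uS uC hA).
pose V s n := @scaled_error R p x dT T P e lam (sign_vector R s) n.
have mV s n j : measurable_fun setT (fun w => V s n w j 0) by exact: measurable_scaled_error.
have clt s E eps : open E -> 0 < eps ->
    \forall n \near \oo, pr Q (u s @^-1` E) <= pr (P n) (V s n @^-1` E) + eps.
  exact: (scaled_error_open hX hgram uC hindep hlaw hmean hvar hlim (hu s)).
pose cov n beta := coverage (design x n) (lam n) (@e n) M beta.
(* the distance between [m] and [V_n^d] in the lower bound, uniformly in [beta] *)
have rate0 : p%:R * `|invmx (gram x n) - invmx C| * (2 * `|(Num.sqrt n%:R)^-1 *: lam n|)
    @[n --> \oo] --> (0 : R).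
  have c1 : p%:R * `|invmx (gram x n) - invmx C| @[n --> \oo] --> (p%:R * 0 : R).
    by apply: cvgMr; apply: cvg_norm_entry; exact: cvg_gram_inv.
  have c2 : 2 * `|(Num.sqrt n%:R)^-1 *: lam n| @[n --> \oo] --> (2 * `|lam0| : R).
    by apply: cvgMr; exact: cvg_norm.
  have := cvgM c1 c2; rewrite mulr0 mul0r; exact.
have lower eps : 0 < eps -> \forall n \near \oo, forall beta, ((1 - alpha - eps)%:E <= cov n beta)%E.
  move=> e0; have e20 : 0 < eps / 2 by rewrite divr_gt0.
  (* finitely many orthants, so it is enough to treat a single one; zero
     coordinates of [beta] count as positive *)
  pose H (s : {ffun 'I_p -> bool}) n := forall beta : 'cV[R]_p, (forall j, 0 <= (-1) ^+ s j * beta j 0) ->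
    ((1 - alpha - eps)%:E <= cov n beta)%E.
  suff Hs s : \forall n \near \oo, H s n.
    have [n0 _ HH] := @filter_forall _ _ H _ _ Hs.
    exists n0 => // n /HH Hn beta; apply: (Hn [ffun j => beta j 0 < 0]) => j.
    rewrite ffunE; case: ltP => b0; last by rewrite mul1r.
    by rewrite expr1 mulN1r oppr_ge0 ltW.
  have p1 : 1 - alpha <= pr Q (u s @^-1` M).
    by rewrite -lee_fin -prE// -hmin; exact: bigmin_le.
  have p2 : pr Q (u s @^-1` M) <= pr Q (u s @^-1` closure M).
    by apply: pr_le => //; apply: preimage_subset; exact: subset_closure.
  have oI r : open (inner_region M r) by exact: open_inner_region.
  have incI k : u s @^-1` inner_region M k.+1%:R^-1 `<=` u s @^-1` inner_region M k.+2%:R^-1.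
    by apply: preimage_subset; exact: inner_region_incr.
  have mI k : measurable (u s @^-1` inner_region M k.+1%:R^-1).
    exact: (mopen s _ (oI _)).
  have [k p3] := pr_bigcup_approx Q mI incI e20.
  rewrite -preimage_bigcup -interior_inner_region in p3.
  have [n1 _ h1] := clt s _ _ (oI k.+1%:R^-1) e20.
  have k0 : 0 < k.+1%:R^-1 :> R by rewrite invr_gt0.
  move/cvgr0_norm_le : rate0 => /(_ _ k0) [n2 _ h2].
  exists (maxn p.+1 (maxn n1 n2)) => // n /=; rewrite !geq_max => /and3P[pn /h1 nh1 /h2 nh2].
  have pn' := ltnW pn; have n0 : (0 < n)%N by exact: leq_ltn_trans pn.
  move=> beta sb; rewrite /cov coverageE ?hX//; last exact: hlam.
  rewrite lee_fin.
  have rr : p%:R * `|invmx (Num.sqrt n%:R ^- 2 *: ((design x n)^T *m design x n)) - invmx C| *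
      ((Num.sqrt n%:R)^-1 * (2 * `|lam n|)) <= k.+1%:R^-1.
    rewrite sqr_sqrtr ?ler0n// -/(gram x n) (le_trans _ nh2)//.
    rewrite ger0_norm ?mulr_ge0// normrZ ger0_norm ?invr_ge0 ?sqrtr_ge0//.
    by rewrite [X in _ * X]mulrCA.
  have nh3 : 1 - alpha - eps <= pr (P n) (V s n @^-1` inner_region M k.+1%:R^-1).
    by move: (boundary s) p1 p2 p3 nh1; lra.
  apply: (le_trans nh3).
  exact: (cover_lower (P := P n) (e := @e n) (hX n pn') (hlam n pn') n0 hM uC hA sb rr (mV s n)).
have upper eps : 0 < eps -> \forall n \near \oo, exists beta, (cov n beta <= (1 - alpha + eps)%:E)%E.
  move=> e0; have e20 : 0 < eps / 2 by rewrite divr_gt0.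
  have [s p1] : exists s, pr Q (u s @^-1` M) <= 1 - alpha.
    have : (\big[Order.min/+oo%E]_(s : {ffun 'I_p -> bool}) Q (u s @^-1` M) <= (1 - alpha)%:E)%E.
      by rewrite hmin.
    move=> /bigmin_leP[//|[s _]]; rewrite prE// lee_fin => ?; by exists s.
  have p2 : pr Q (u s @^-1` interior M) <= pr Q (u s @^-1` M).
    apply: pr_le => //; first exact: (mopen s _ (@open_interior _ M)).
    by apply: preimage_subset; exact: interior_subset.
  have [n1 _ h1] := clt s _ _ oclM e20.
  exists (maxn p.+1 n1) => // n /=; rewrite geq_max => /andP[pn /h1 nh1].
  have pn' := ltnW pn; have n0 : (0 < n)%N by exact: leq_ltn_trans pn.
  have [beta hb] := cover_far (P := P n) (e := @e n) (hX n pn') (hlam n pn') n0 hM (mV s n) e20.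
  exists beta; rewrite /cov coverageE ?hX//; last exact: hlam.
  rewrite lee_fin (le_trans hb)//.
  have mVcl : measurable (V s n @^-1` closure M).
    rewrite -[closure M]setCK preimage_setC; apply: measurableC.
    exact: (measurable_open_preimage (mV s n) oclM).
  have p3 : pr (P n) (V s n @^-1` M) <= pr (P n) (V s n @^-1` closure M).
    apply: pr_le => //; first exact: (measurable_borel_preimage (mV s n) hM).
    by apply: preimage_subset; exact: subset_closure.
  have q1 : pr Q (u s @^-1` (~` closure M)) = 1 - pr Q (u s @^-1` closure M).
    exact: (prC Q (mucl s)).
  have q2 : pr (P n) (V s n @^-1` (~` closure M)) = 1 - pr (P n) (V s n @^-1` closure M).
    exact: (prC (P n) mVcl).
  have p4 : pr (P n) (V s n @^-1` M) + eps / 2 <= 1 - alpha + eps.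
    by move: p1 p2 p3 (boundary s) nh1 q1 q2; lra.
  exact: p4.
apply: (cvg_limn_einf_sup _).1; apply/fine_cvgP.
have bounds eps : 0 < eps -> \forall n \near \oo,
    ((1 - alpha - eps)%:E <= ereal_inf [set cov n beta | beta in setT] <= (1 - alpha + eps)%:E)%E.
  move=> e0; have [n1 _ h1] := lower _ e0; have [n2 _ h2] := upper _ e0.
  exists (maxn n1 n2) => // n /=; rewrite geq_max => /andP[/h1 nh1 /h2 [beta nh2]].
  apply/andP; split.
    by apply/ereal_infP => _ [b _ <-].
  by apply: le_trans nh2; apply: ereal_inf_lbound; exists beta.
have fin_of eps n : ((1 - alpha - eps)%:E <= ereal_inf [set cov n beta | beta in setT] <= (1 - alpha + eps)%:E)%E ->
    ereal_inf [set cov n beta | beta in setT] \is a fin_num.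
  by case: (ereal_inf _) => [r| |] //=; rewrite ?leNye_eq// andbC.
split.
  by have [n1 _ h] := bounds _ ltr01; exists n1 => // n /h; exact: fin_of.
apply/cvgrPdist_le => eps e0; have [n1 _ h] := bounds _ e0; exists n1 => // n /h hn.
have fn := fin_of _ _ hn; move: hn; rewrite /= -/(cov n).
rewrite -(fineK fn) !lee_fin => /andP[b1 b2].
by rewrite ler_distlC; apply/andP; split; lra.
Qed.
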